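(* Let $n=1$ and $\alpha\in\{0,-1,+1\}$. Given $(x_*,t_* )\in\mathbb{R}\times(\mathbb{R}\setminus\{0\})$, there exists $u_0\in C^\infty(\mathbb{R})\cap L^2(\mathbb{R})\cap L^\infty(\mathbb{R})$ such that the solution $u\in C_{\rm b}(\mathbb{R};L^2(\mathbb{R}))$ of $$i\partial_tu-\alpha\,\partial_x^2u+\partial_x^4u=0,\qquad u|_{t=0}=u_0,$$ has the following properties. (1) The solution $u$ blows up at $(x_*,t_* )$, which is to say $\displaystyle\lim_{(x,t)\in\mathbb{R}^2\to(x_*,t_* )}|u(x,t)|=+\infty$. (2) The function $u$ is continuous in $(x,t)$ on $\mathbb{R}\times(\mathbb{R}\setminus\{t_*\})$. (3) $u(\cdot,t_* )$ is a continuous function on $\mathbb{R}\setminus\{x_*\}$.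
   Context: $C_{\rm b}(\mathbb{R};L^2(\mathbb{R}))$ denotes bounded continuous functions of time with values in $L^2(\mathbb{R})$. *)

(* Defs.v *)
From HB Require Import structures.
From mathcomp Require Import all_boot all_order all_algebra.
From mathcomp Require Import all_classical all_reals all_analysis.
From mathcomp Require Import complex.
Import numFieldNormedType.Exports.
Import ComplexField.Normc.

Set Implicit Arguments.
Unset Strict Implicit.
Unset Printing Implicit Defensive.
Import Order.TTheory GRing.Theory Num.Theory.

Local Open Scope classical_set_scope.
Local Open Scope ring_scope.
Local Open Scope complex_scope.

Section FourthOrderSchroedinger.
Context {R : realType}.
Local Notation mu := (@lebesgue_measure R).

Definition smooth (f : R -> R) : Prop :=
  forall (n : nat) (x : R), derivable (f^`(n)%classic) x 1.

Definition smoothC (f : R -> R[i]) : Prop :=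
  smooth (fun x => complex.Re (f x)) /\ smooth (fun x => complex.Im (f x)).

Definition test_function (phi : R -> R) : Prop :=
  smooth phi /\ exists M : R, forall x : R, M < `|x| -> phi x = 0.

Definition normLp (p : \bar R) (f : R -> R[i]) : \bar R :=
  ('N[mu]_p[EFin \o (fun x : R => normc (f x))])%E.

Definition inLp (p : \bar R) (f : R -> R[i]) : Prop :=
  [/\ measurable_fun [set: R] (fun x => complex.Re (f x)),
      measurable_fun [set: R] (fun x => complex.Im (f x))
    & (normLp p f < +oo)%E].

(* A curve t |-> u t of functions represents an element of C_b(R; L^2(R));
   u t x stands for the value at position x and time t. *)
Definition in_CbL2 (u : R -> R -> R[i]) : Prop :=
  [/\ forall t : R, inLp 2%:E (u t),
      forall t0 : R,
        normLp 2%:E (fun x => u t x - u t0 x) @[t --> t0] --> 0%E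
    & exists M : R, forall t : R, (normLp 2%:E (u t) <= M%:E)%E].

Definition pairing (f : R -> R[i]) (phi : R -> R) : R[i] :=
  (Rintegral mu setT (fun x => complex.Re (f x) * phi x)) +i*
  (Rintegral mu setT (fun x => complex.Im (f x) * phi x)).

(* R[i] is not a normed module over R in the library, so the derivative of a
   complex function of a real variable is taken componentwise. *)
Definition is_deriveC (F : R -> R[i]) (t : R) (d : R[i]) : Prop :=
  is_derive t 1 (fun s => complex.Re (F s)) (complex.Re d) /\
  is_derive t 1 (fun s => complex.Im (F s)) (complex.Im d).

(* i u_t - alpha u_xx + u_xxxx = 0 in the space D'(R) of distributions at every
   time t, with u_t the derivative of the D'(R)-valued curve t |-> u t; the even
   number of integrations by parts leaves the signs unchanged. *)
Definition equation (alpha : R) (u : R -> R -> R[i]) : Prop :=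
  forall phi : R -> R, test_function phi -> forall t : R,
    exists2 d : R[i], is_deriveC (fun s => pairing (u s) phi) t d
      & (0 +i* 1) * d - alpha%:C * pairing (u t) (phi^`(2)%classic) +
          pairing (u t) (phi^`(4)%classic) = 0.

Definition CbL2_solution (alpha : R) (u0 : R -> R[i]) (u : R -> R -> R[i]) :
    Prop :=
  [/\ in_CbL2 u, equation alpha u
    & {ae mu, forall x : R, u 0 x = u0 x}].

(* Elements of C_b(R; L^2(R)) are curves of classes modulo a.e. equality, so u
   represents the solution when every solution is a.e. equal to it at each
   time. *)
Definition the_CbL2_solution (alpha : R) (u0 : R -> R[i])
    (u : R -> R -> R[i]) : Prop :=
  CbL2_solution alpha u0 u /\
  forall v : R -> R -> R[i], CbL2_solution alpha u0 v ->
    forall t : R, {ae mu, forall x : R, v t x = u t x}.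

(* The limit excludes the point itself, where |u| has a (finite, irrelevant)
   value. *)
Definition blows_up_at (u : R -> R -> R[i]) (xs ts : R) : Prop :=
  normc (u p.2 p.1) @[p --> ((xs, ts) : R * R)^'] --> +oo.

(* R[i] with the topology of the modulus, which the library attaches to R[i] seen
   as a numFieldType. *)
Definition continuousC_at {T : topologicalType} (f : T -> R[i]) (p : T) : Prop :=
  {for p, continuous (f : T -> (R[i] : numFieldType))}.

End FourthOrderSchroedinger.

(* Main.v *)
(* The solution is a superposition of standing waves,
     u(t, x) = int_1^oo k^-1 cos (k (x - xs)) exp (i (t - ts) (k^4 + alpha k^2)) dk,
   whose Fourier data k^-1 are square integrable but just fail to be integrable.
   Put tau = t - ts and y = x - xs. Near tau = y = 0 the frequencies below
   L = (|y| + 12 |tau|^(1/4))^-1 contribute at least (ln L) / 4 to the real part,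
   while those above L contribute O(1) by van der Corput's lemma: u blows up.
   For tau <> 0, or tau = 0 and y <> 0, the integral converges locally uniformly
   by integration by parts in k; for tau <> 0 so do all its x-derivatives, because
   k^2 can be traded for lower powers of k against the phase derivative
   4 tau k^3 + 2 alpha tau k. A Plancherel inequality gives the bounds in L^2.

   For uniqueness, pair the difference w of two solutions with the wave packets
   chi(rho^2 x) cos (kappa + xi x). Up to O(rho) this pairing rotates at the
   angular speed xi^4 + alpha xi^2, so it is O(rho) since it vanishes at time 0.
   Averaging over xi with Fejer weights, integrating kappa = - xi y over y in
   [a, b] and letting rho -> 0 shows that w has integral 0 over every [a, b]. *)
Require Import Defs.
From HB Require Import structures.
From mathcomp Require Import all_boot all_order all_algebra.
From mathcomp Require Import all_classical all_reals all_analysis.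
From mathcomp Require Import measurable_realfun complex ring lra.
Import numFieldNormedType.Exports.
Import Order.TTheory GRing.Theory Num.Theory.
Local Open Scope classical_set_scope.
Local Open Scope ring_scope.
Set Implicit Arguments.
Unset Strict Implicit.
Unset Printing Implicit Defensive.

(** * Derivatives and integrals on segments *)

(** All estimates concern real integrals: a free constant [th] in the cosine yields the real part
    ([th = 0]) and the imaginary part ([th = - pi / 2]), a time derivative adds [pi / 2] to it, and
    complex numbers return only at the end. Starting at frequency 1 lets the quartic term dominate:
    for [k >= 1] and [|al| <= 1] the symbol is nonnegative, increasing and convex, so the three
    values of [alpha] are treated alike. In the cut-off, [|tau|^(-1/4)] is the frequency at which
    [tau k^4] starts to turn, and 12 is twice the 6 of [dsymb k <= 6 k^3]: for
    [|y| > 12 |tau|^(1/4)] the term [y] dominates the phase derivative up to that frequency. For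
    uniqueness, plane waves are not test functions, hence the window. At width [rho^-2] its
    derivatives leave an error of size [rho^2] on a length of order [rho^-2], so of L2 norm O(rho):
    the gain in size beats the growth of the support. The constant depends on the range of
    frequencies, which must tend to infinity, so [rho] has to shrink fast enough along with it. *)

Section Derivatives.
Context {R : realType}.
Implicit Types (x df dg : R) (f g : R -> R).

(* [is_derive] itself is a type class: the library instances would be tried on
   every premise and produce derivatives phrased with [*:]. *)
Definition has_derive f x df : Prop := is_derive x (1 : R) f df.

Lemma has_derive_continuous f x df : has_derive f x df -> {for x, continuous f}.
Proof.
by move=> [h _]; apply: differentiable_continuous; exact/derivable1_diffP.
Qed.

Lemma has_derive_eq f x df dg : has_derive f x df -> df = dg ->
  has_derive f x dg.
Proof. by move=> h <-. Qed.

Lemma der_cst (k : R) x : has_derive (fun=> k) x 0.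
Proof. exact: is_derive_cst. Qed.

Lemma der_id x : has_derive (fun z => z) x 1.
Proof. exact: is_derive_id. Qed.

Lemma derD f g x df dg : has_derive f x df -> has_derive g x dg ->
  has_derive (fun z => f z + g z) x (df + dg).
Proof. by move=> hf hg; exact: (@is_deriveD R _ _ f g x 1 df dg). Qed.

Lemma derN f x df : has_derive f x df -> has_derive (fun z => - f z) x (- df).
Proof. by move=> hf; exact: (@is_deriveN R _ _ f x 1 df). Qed.

Lemma derM f g x df dg : has_derive f x df -> has_derive g x dg ->
  has_derive (fun z => f z * g z) x (df * g x + f x * dg).
Proof.
move=> hf hg; rewrite addrC [df * _]mulrC.
exact: (@is_deriveM R _ f g x 1 df dg).
Qed.

Lemma derX f n x df : has_derive f x df ->
  has_derive (fun z => f z ^+ n) x (n%:R * f x ^+ n.-1 * df).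
Proof.
move=> hf; have -> : (fun z => f z ^+ n) = f ^+ n by rewrite exprfctE.
exact: (@is_deriveX R _ f n x 1 df).
Qed.

Lemma derV f x df : f x != 0 -> has_derive f x df ->
  has_derive (fun z => (f z)^-1) x (- (f x) ^- 2 * df).
Proof. by move=> f0 hf; exact: (@is_deriveV R f x df 1). Qed.

Lemma der_comp f g x df dg : has_derive f (g x) df -> has_derive g x dg ->
  has_derive (fun z => f (g z)) x (df * dg).
Proof. by move=> hf hg; exact: (@is_derive1_comp _ f g). Qed.

Definition der_sin g x dg := @der_comp sin g x _ dg (is_derive_sin (g x)).
Definition der_cos g x dg := @der_comp cos g x _ dg (is_derive_cos (g x)).
Definition der_atan g x dg := @der_comp atan g x _ dg (is_derive1_atan (g x)).
Definition der_expR g x dg := @der_comp expR g x _ dg (is_derive_expR (g x)).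

End Derivatives.

Ltac der_step :=
  lazymatch goal with
  | |- has_derive (fun _ => ?k) _ _ => apply: der_cst
  | |- has_derive (fun z => z) _ _ => apply: der_id
  | |- has_derive (fun z => @?f z + @?g z) _ _ => apply: (@derD _ f g)
  | |- has_derive (fun z => - (@?f z)) _ _ => apply: (@derN _ f)
  | |- has_derive (fun z => @?f z * @?g z) _ _ => apply: (@derM _ f g)
  | |- has_derive (fun z => (@?f z) ^+ ?n) _ _ => apply: (@derX _ f n)
  | |- has_derive (fun z => (@?f z)^-1) _ _ => apply: (@derV _ f)
  | |- has_derive (fun z => sin (@?f z)) _ _ => apply: (@der_sin _ f)
  | |- has_derive (fun z => cos (@?f z)) _ _ => apply: (@der_cos _ f)
  | |- has_derive (fun z => atan (@?f z)) _ _ => apply: (@der_atan _ f)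
  | |- has_derive (fun z => expR (@?f z)) _ _ => apply: (@der_expR _ f)
  | |- has_derive _ _ _ => eassumption
  end.
(* Leaves the non-vanishing conditions and the comparison of derivatives. *)
Ltac der := eapply has_derive_eq; [repeat der_step|].
Ltac cont_der := eapply has_derive_continuous; repeat der_step.

(** * Integrals of continuous functions over segments *)

Section RealIntegral.
Context {R : realType}.
Implicit Types (a b c x : R) (f g F G : R -> R).
Local Notation mu := (@lebesgue_measure R).

Lemma normM_le (u v U V : R) : `|u| <= U -> `|v| <= V -> `|u * v| <= U * V.
Proof. by move=> hu hv; rewrite normrM ler_pM. Qed.

Lemma normD_le (u v U V : R) : `|u| <= U -> `|v| <= V -> `|u + v| <= U + V.
Proof. by move=> hu hv; rewrite (le_trans (ler_normD _ _))// lerD. Qed.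

Lemma normB_le (u v U V : R) : `|u| <= U -> `|v| <= V -> `|u - v| <= U + V.
Proof. by move=> hu hv; rewrite (le_trans (ler_normB _ _))// lerD. Qed.

(** Two-sided continuity even at the end points, so that pointwise continuity and derivative rules
    apply unchanged. *)
Definition cont_on a b f := forall x, a <= x <= b -> {for x, continuous f}.

Definition rint a b f : R := \int[mu]_(x in `[a, b]) f x.

Lemma cont_on_within a b f : cont_on a b f -> {within `[a, b], continuous f}.
Proof.
move=> cf; apply: continuous_in_subspaceT => x.
by rewrite inE/= in_itv/= => /cf.
Qed.

Lemma cont_on_integrable a b f : cont_on a b f ->
  mu.-integrable `[a, b] (EFin \o f).
Proof.
move=> cf; apply: continuous_compact_integrable; first exact: segment_compact.
exact: cont_on_within.
Qed.

Lemma eq_rint a b f g : (forall x, a <= x <= b -> f x = g x) ->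
  rint a b f = rint a b g.
Proof. by move=> fg; apply: eq_Rintegral => x; rewrite inE/= in_itv/= => /fg. Qed.

Lemma rint_FTC F a b f : a <= b -> cont_on a b f ->
  (forall x, a <= x <= b -> has_derive F x (f x)) ->
  rint a b f = F b - F a.
Proof.
rewrite le_eqVlt => /predU1P[<- _ _|ab cf dF].
  by rewrite /rint set_itv1 Rintegral_set1 subrr.
have cF x : a <= x <= b -> {for x, continuous F}.
  by move=> /dF; exact: has_derive_continuous.
rewrite /rint /Rintegral (@continuous_FTC2 _ f F)//.
- exact: cont_on_within.
- split.
  + move=> x; rewrite in_itv/= => /andP[ax xb].
    by have [] := dF x; rewrite ?(ltW ax) ?(ltW xb).
  + by apply: cvg_at_right_filter; apply: cF; rewrite lexx ltW.
  + by apply: cvg_at_left_filter; apply: cF; rewrite lexx ltW.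
- move=> x; rewrite in_itv/= => /andP[ax xb].
  by rewrite derive1E; have [] := dF x; rewrite ?(ltW ax) ?(ltW xb).
Qed.

Lemma rintD a b f g : cont_on a b f -> cont_on a b g ->
  rint a b (fun x => f x + g x) = rint a b f + rint a b g.
Proof. by move=> cf cg; apply: RintegralD => //; exact: cont_on_integrable. Qed.

Lemma rintB a b f g : cont_on a b f -> cont_on a b g ->
  rint a b (fun x => f x - g x) = rint a b f - rint a b g.
Proof. by move=> cf cg; apply: RintegralB => //; exact: cont_on_integrable. Qed.

Lemma rintZ a b f (k : R) : cont_on a b f ->
  rint a b (fun x => k * f x) = k * rint a b f.
Proof. by move=> cf; apply: RintegralZl => //; exact: cont_on_integrable. Qed.

Lemma rint_split c a b f : a <= c <= b -> cont_on a b f ->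
  rint a b f = rint a c f + rint c b f.
Proof.
move=> /andP[ac cb] cf; rewrite /rint.
have fi := cont_on_integrable cf.
apply/eqP; rewrite addrC -subr_eq Rintegral_itvB ?bnd_simp//.
rewrite Rintegral_itv_obnd_cbnd//.
by apply: integrableS fi => //; apply: subset_itvr; rewrite bnd_simp.
Qed.

Lemma le_rint a b f g : cont_on a b f -> cont_on a b g ->
  (forall x, a <= x <= b -> f x <= g x) -> rint a b f <= rint a b g.
Proof.
by move=> cf cg fg; apply: le_Rintegral => //; exact: cont_on_integrable.
Qed.

Lemma rint_ge0 a b f : (forall x, a <= x <= b -> 0 <= f x) -> 0 <= rint a b f.
Proof. by move=> f0; apply: Rintegral_ge0 => x; rewrite /= in_itv/=; exact: f0. Qed.

Lemma rint_cst a b (k : R) : a <= b -> rint a b (fun=> k) = k * (b - a).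
Proof.
move=> ab; rewrite mulrBr; apply: (@rint_FTC (fun x => k * x)) => //.
- by move=> x _; exact: cvg_cst.
- by move=> x _; der => //=; ring.
Qed.

Lemma norm_rint_le a b f g : cont_on a b f -> cont_on a b g ->
  (forall x, a <= x <= b -> `|f x| <= g x) -> `|rint a b f| <= rint a b g.
Proof.
move=> cf cg fg; apply: (@le_trans _ _ (rint a b (fun x => `|f x|))).
  by apply: le_normr_Rintegral => //; exact: cont_on_integrable.
apply: le_rint => // x xab; apply: continuous_comp; [exact: cf|exact: norm_continuous].
Qed.

(* Integration by parts in disguise: an explicit approximate primitive [B] of
   the integrand, whose defect is controlled by the monotone function [H]. *)
Lemma rint_compare a b f B H (dB dH : R -> R) : a <= b ->
  cont_on a b f -> cont_on a b dB -> cont_on a b dH ->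
  (forall x, a <= x <= b -> has_derive B x (dB x)) ->
  (forall x, a <= x <= b -> has_derive H x (dH x)) ->
  (forall x, a <= x <= b -> `|f x - dB x| <= dH x) ->
  `|rint a b f - (B b - B a)| <= H b - H a.
Proof.
move=> ab cf cdB cdH hB hH fB.
rewrite -(rint_FTC ab cdB hB) -(rint_FTC ab cdH hH) -rintB//.
by apply: norm_rint_le => // x xab; apply: cvgB; [exact: cf|exact: cdB].
Qed.

End RealIntegral.

(** * Oscillatory integrals *)

Section VanDerCorput.
Context {R : realType} (al : R) (hal : `|al| <= 1).
Implicit Types (th y tau k a b : R).

Definition symb k : R := k ^+ 4 + al * k ^+ 2.
Definition dsymb k : R := 4 * k ^+ 3 + 2 * al * k.
Definition ddsymb k : R := 12 * k ^+ 2 + 2 * al.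
Definition phase th y tau k : R := th + y * k + tau * symb k.

Lemma der_symb k : has_derive symb k (dsymb k).
Proof. by rewrite /symb; der; rewrite /dsymb/=; ring. Qed.

Lemma der_phase th y tau k :
  has_derive (phase th y tau) k (y + tau * dsymb k).
Proof. by rewrite /phase /symb; der; rewrite /dsymb/=; ring. Qed.

Lemma der_dphase y tau k :
  has_derive (fun z => y + tau * dsymb z) k (tau * ddsymb k).
Proof. by rewrite /dsymb; der; rewrite /ddsymb/=; ring. Qed.

Lemma der_cosphase th y tau k :
  has_derive (fun z => cos (phase th y tau z)) k
    (- sin (phase th y tau k) * (y + tau * dsymb k)).
Proof. exact: der_cos (der_phase _ _ _ _). Qed.

(** From frequency 1 on, [2 |al| <= 2 k^2] absorbs the lower-order term into the quartic one. *)
Lemma ddsymb_ge k : 1 <= k -> 10 * k ^+ 2 <= ddsymb k.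
Proof.
move=> k1; rewrite /ddsymb; move: hal; rewrite ler_norml => /andP[h _]; nra.
Qed.

Lemma ddsymb_le k : 1 <= k -> ddsymb k <= 14 * k ^+ 2.
Proof.
move=> k1; rewrite /ddsymb; move: hal; rewrite ler_norml => /andP[_ h]; nra.
Qed.

Lemma dsymb_le k : 1 <= k -> 0 <= dsymb k <= 6 * k ^+ 3.
Proof.
move=> k1; rewrite /dsymb; move: hal; rewrite ler_norml => /andP[h1 h2].
have k3 : k <= k ^+ 3 by nra.
by apply/andP; split; nra.
Qed.

Lemma symb_le k : 1 <= k -> 0 <= symb k <= 2 * k ^+ 4.
Proof.
move=> k1; rewrite /symb; move: hal; rewrite ler_norml => /andP[h1 h2].
have k2 : 1 <= k ^+ 2 by nra.
have -> : k ^+ 4 = k ^+ 2 * k ^+ 2 by ring.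
by apply/andP; split; nra.
Qed.

Lemma cont_oscillation th y tau a b : 0 < a ->
  cont_on a b (fun k => k^-1 * cos (phase th y tau k)).
Proof.
move=> a0 x /andP[ax _]; cont_der; last exact: der_phase.
by rewrite gt_eqF// (lt_le_trans a0).
Qed.

(** The inequality [2 s |v| <= v^2 + s^2], divided out. *)
Lemma norm_div_sqr_le (v s : R) : 0 < s ->
  `|v * (v ^+ 2 + s ^+ 2)^-1| <= (2 * s)^-1.
Proof.
move=> s0; have w0 : 0 < v ^+ 2 + s ^+ 2 by rewrite ltr_wpDl ?sqr_ge0// exprn_gt0.
rewrite normrM [X in _ * X]gtr0_norm ?invr_gt0// ler_pdivrMr// mulrC.
rewrite ler_pdivlMr ?mulr_gt0//.
have : `|v| ^+ 2 = v ^+ 2 by rewrite real_normK ?num_real.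
by have := sqr_ge0 (`|v| - s); nra.
Qed.

(* [v / (v^2 + s^2)] replaces [1 / v] in the integration by parts, so that
   the stationary point needs no separate treatment. *)
Lemma van_der_corput2_pos th y tau a b : 0 < tau -> 1 <= a -> a <= b ->
  `|rint a b (fun k => k^-1 * cos (phase th y tau k))|
    <= (1 + pi) * (a ^+ 2 * Num.sqrt tau)^-1.
Proof.
move=> tau0 a1 ab.
set t := Num.sqrt tau.
have t0 : 0 < t by rewrite sqrtr_gt0.
have tE : tau = t ^+ 2 by rewrite sqr_sqrtr// ltW.
have a0 : 0 < a by lra.
(* Then [s^2 = 9 tau a^2] stays below [dv >= 10 tau k^2], so the defect [s^2 / (v^2 + s^2)] is
   bounded by [dv / (v^2 + s^2)], the derivative of an arctangent up to a factor. *)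
pose s := 3 * t * a.
have s0 : 0 < s by rewrite !mulr_gt0.
pose v k := y + tau * dsymb k.
pose dv k := tau * ddsymb k.
have s2v k : 0 < v k ^+ 2 + s ^+ 2 by rewrite ltr_wpDl ?sqr_ge0// exprn_gt0.
pose ph := phase th y tau.
pose B k := k^-1 * (v k * (v k ^+ 2 + s ^+ 2)^-1) * sin (ph k).
pose dB k := - k ^- 2 * (v k * (v k ^+ 2 + s ^+ 2)^-1) * sin (ph k)
   + k^-1 * (dv k * (s ^+ 2 - v k ^+ 2) * (v k ^+ 2 + s ^+ 2) ^- 2) * sin (ph k)
   + k^-1 * (v k ^+ 2 * (v k ^+ 2 + s ^+ 2)^-1) * cos (ph k).
(* The first term absorbs the derivative of [k^-1], the arctangent all terms in [dv / (v^2 + s^2)].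
   Its variation is at most [pi] whatever [y] is, which is the origin of [pi] in the bound. *)
pose H k := - k^-1 * (2 * s)^-1 + 2 * a^-1 * s^-1 * atan (v k * s^-1).
pose dH k := k ^- 2 * (2 * s)^-1
   + 2 * a^-1 * (dv k * (v k ^+ 2 + s ^+ 2)^-1).
have pos k : a <= k <= b -> 0 < k by move=> /andP[ak _]; lra.
have hv k : has_derive v k (dv k) by exact: der_dphase.
have hph k : has_derive ph k (v k) by exact: der_phase.
have hdv k : has_derive dv k (tau * (24 * k)).
  by rewrite /dv /ddsymb; der => //=; ring.
have hB k : a <= k <= b -> has_derive B k (dB k).
  move=> /pos k0; rewrite /B; der; [|exact: hv| |exact: hv|exact: hph|].
  - by rewrite gt_eqF.
  - by rewrite gt_eqF.
  - by rewrite /dB/=; field; rewrite !gt_eqF.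
have hH k : a <= k <= b -> has_derive H k (dH k).
  move=> /pos k0; rewrite /H; der; [|exact: hv|].
  - by rewrite gt_eqF.
  - have -> : 1 + (v k / s) ^+ 2 = (v k ^+ 2 + s ^+ 2) / s ^+ 2.
      by field; rewrite gt_eqF.
    by rewrite /dH/=; field; rewrite !gt_eqF.
have cB : cont_on a b dB.
{ move=> k /pos k0; rewrite /dB; cont_der => /=.
  all: try exact: hv. all: try exact: hph. all: try exact: hdv.
  all: try apply: expf_neq0; apply: lt0r_neq0 => //; exact: s2v. }
have cH : cont_on a b dH.
{ move=> k /pos k0; rewrite /dH; cont_der => /=.
  all: try exact: hv. all: try exact: hph. all: try exact: hdv.
  all: try apply: expf_neq0; apply: lt0r_neq0 => //; exact: s2v. }
have main : `|rint a b (fun k => k^-1 * cos (ph k)) - (B b - B a)| <= H b - H a.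
  apply: rint_compare hB hH _ => //; first exact: cont_oscillation.
  move=> k akb; have k0 := pos _ akb; move: akb => /andP[ak kb].
  have dvs : s ^+ 2 <= dv k.
    have := ddsymb_ge (le_trans a1 ak); rewrite /dv /s => h.
    have : 10 * k ^+ 2 * tau <= ddsymb k * tau by rewrite ler_pM2r.
    have t2 : 0 < t ^+ 2 by rewrite exprn_gt0.
    have ak2 : a ^+ 2 * t ^+ 2 <= k ^+ 2 * t ^+ 2 by rewrite ler_pM2r//; nra.
    by rewrite !exprMn; move: (sqr_ge0 (k * t)); rewrite exprMn tE; lra.
  have ki : k^-1 <= a^-1 by rewrite lef_pV2.
  pose w := v k ^+ 2 + s ^+ 2.
  have w0 : 0 < w by exact: s2v.
  have -> : k^-1 * cos (ph k) - dB k = k^-1 * cos (ph k) * (s ^+ 2 / w) +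
      (k ^- 2 * (v k / w) * sin (ph k) -
       k^-1 * (dv k / w) * ((s ^+ 2 - v k ^+ 2) / w) * sin (ph k)).
    by rewrite /dB /w; field; rewrite (gt_eqF (s2v k)) gt_eqF.
  have sw : `|s ^+ 2 / w| <= dv k / w.
    by rewrite ger0_norm ?divr_ge0 ?sqr_ge0 ?(ltW w0)// ler_pM2r ?invr_gt0.
  have sw1 : `|(s ^+ 2 - v k ^+ 2) / w| <= 1.
    rewrite normrM [X in _ * X]gtr0_norm ?invr_gt0// ler_pdivrMr// mul1r /w.
    by rewrite ler_norml; have := sqr_ge0 s; have := sqr_ge0 (v k); lra.
  have dw : `|dv k / w| <= dv k / w.
    by rewrite ger0_norm// divr_ge0 ?(ltW w0)// (le_trans _ dvs)// sqr_ge0.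
  have kn : `|k^-1| <= a^-1 by rewrite gtr0_norm ?invr_gt0.
  have kn2 : `|k ^- 2| <= k ^- 2 by rewrite gtr0_norm ?invr_gt0 ?exprn_gt0.
  have -> : dH k = a^-1 * 1 * (dv k / w) + (k ^- 2 * (2 * s)^-1 * 1 +
      a^-1 * (dv k / w) * 1 * 1) by rewrite /dH -/w; ring.
  apply: normD_le; last apply: normB_le.
  - by do 2 apply: normM_le => //; exact: cos_max.
  - apply: normM_le; last exact: sin_max.
    by apply: normM_le => //; exact: norm_div_sqr_le.
  - apply: normM_le; last exact: sin_max.
    by do 2 apply: normM_le => //.
have Ble k : a <= k <= b -> `|B k| <= a^-1 * (2 * s)^-1.
  move=> akb; have k0 := pos _ akb; move: akb => /andP[ak kb].
  rewrite /B -[leRHS]mulr1; apply: normM_le; last exact: sin_max.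
  apply: normM_le; last exact: norm_div_sqr_le.
  by rewrite gtr0_norm ?invr_gt0// lef_pV2.
have Ba : `|B a| <= a^-1 * (2 * s)^-1 by apply: Ble; rewrite lexx.
have Bb : `|B b| <= a^-1 * (2 * s)^-1 by apply: Ble; rewrite lexx ab.
pose q := a^-1 * s^-1.
have q0 : 0 < q by rewrite mulr_gt0 ?invr_gt0.
have -> : (a ^+ 2 * t)^-1 = 3 * q.
  by rewrite /q /s; field; rewrite !gt_eqF.
have hq : a^-1 * (2 * s)^-1 = q / 2 by rewrite /q; field; rewrite !gt_eqF.
have HH : H b - H a <= q / 2 + 2 * q * pi.
  have b0 : 0 < b by lra.
  have -> : H b - H a = - (b^-1 * (2 * s)^-1) + q / 2
      + 2 * q * (atan (v b / s) - atan (v a / s)).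
    by rewrite /H -hq /q; ring.
  have h1 : 0 < b^-1 * (2 * s)^-1 by rewrite mulr_gt0 ?invr_gt0 ?mulr_gt0.
  have h2 := atan_ltpi2 (v b / s); have h3 := atan_gtNpi2 (v a / s).
  have h4 : q * (atan (v b / s) - atan (v a / s)) <= q * pi by rewrite ler_pM2l//; lra.
  lra.
have p0 : 0 < q * pi by rewrite mulr_gt0// pi_gt0.
move: main; rewrite -/ph; set I := rint _ _ _.
move: Ba Bb; rewrite hq !ler_norml => /andP[? ?] /andP[? ?] /andP[? ?].
by apply/andP; split; lra.
Qed.

Lemma phaseN th y tau k : phase (- th) (- y) (- tau) k = - phase th y tau k.
Proof. by rewrite /phase; ring. Qed.

Lemma van_der_corput2 th y tau a b : tau != 0 -> 1 <= a -> a <= b ->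
  `|rint a b (fun k => k^-1 * cos (phase th y tau k))|
    <= (1 + pi) * (a ^+ 2 * Num.sqrt `|tau|)^-1.
Proof.
move=> tau0 a1 ab; have [t0|t0] := ltP 0 tau.
  by rewrite (gtr0_norm t0); exact: van_der_corput2_pos.
rewrite (ler0_norm t0).
have {}t0 : 0 < - tau by rewrite oppr_gt0 lt_neqAle tau0.
rewrite (eq_rint (g := fun k => k^-1 * cos (phase (- th) (- y) (- tau) k))).
  exact: van_der_corput2_pos.
by move=> k _; rewrite phaseN cosN.
Qed.

(** Convexity of the symbol makes the phase derivative [v] monotone, so that [dv / v^2] has one sign
    and integrates exactly to a difference of values of [1 / v]. *)
Lemma van_der_corput1 th y tau lam a b : 0 < lam -> 1 <= a -> a <= b ->
  (forall k, a <= k <= b -> lam <= `|y + tau * dsymb k|) ->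
  `|rint a b (fun k => k^-1 * cos (phase th y tau k))| <= 6 * (a * lam)^-1.
Proof.
move=> lam0 a1 ab hlam.
(* The cosine is even, so all three parameters may change sign together; [0 <= tau] makes [v]
   nondecreasing. *)
wlog tau0 : th y tau hlam / 0 <= tau.
  move=> hw; have [t0|t0] := leP 0 tau; first exact: hw.
  rewrite (eq_rint (g := fun k => k^-1 * cos (phase (- th) (- y) (- tau) k))).
    apply: hw; last by rewrite oppr_ge0 ltW.
    by move=> k /hlam; rewrite mulNr -opprD normrN.
  by move=> k _; rewrite phaseN cosN.
have a0 : 0 < a by lra.
pose v k := y + tau * dsymb k.
pose dv k := tau * ddsymb k.
pose ph := phase th y tau.
pose B k := k^-1 * (v k)^-1 * sin (ph k).
pose dB k := - k ^- 2 * (v k)^-1 * sin (ph k)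
   - k^-1 * (dv k * v k ^- 2) * sin (ph k) + k^-1 * cos (ph k).
pose H k := - k^-1 * lam^-1 - a^-1 * (v k)^-1.
pose dH k := k ^- 2 * lam^-1 + a^-1 * (dv k * v k ^- 2).
have pos k : a <= k <= b -> 0 < k by move=> /andP[ak _]; lra.
have vn0 k : a <= k <= b -> v k != 0.
  by move=> /hlam h; rewrite -normr_gt0 (lt_le_trans lam0).
have hv k : has_derive v k (dv k) by exact: der_dphase.
have hph k : has_derive ph k (v k) by exact: der_phase.
have hdv k : has_derive dv k (tau * (24 * k)).
  by rewrite /dv /ddsymb; der => //=; ring.
have hB k : a <= k <= b -> has_derive B k (dB k).
  move=> akb; have k0 := pos _ akb; have v0 := vn0 _ akb.
  rewrite /B; der; [| |exact: hv|exact: hph|] => //.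
  - by rewrite gt_eqF.
  - by rewrite /dB/=; field; rewrite v0 gt_eqF.
have hH k : a <= k <= b -> has_derive H k (dH k).
  move=> akb; have k0 := pos _ akb; have v0 := vn0 _ akb.
  rewrite /H; der; [| |exact: hv|] => //.
  - by rewrite gt_eqF.
  - by rewrite /dH/=; field; rewrite v0 !gt_eqF.
have cB : cont_on a b dB.
{ move=> k akb; have k0 := pos _ akb; have v0 := vn0 _ akb.
  rewrite /dB; cont_der => /=.
  all: try exact: hv. all: try exact: hph. all: try exact: hdv.
  all: try apply: expf_neq0. all: try exact: v0. all: apply: lt0r_neq0 => //. }
have cH : cont_on a b dH.
{ move=> k akb; have k0 := pos _ akb; have v0 := vn0 _ akb.
  rewrite /dH; cont_der => /=.
  all: try exact: hv. all: try exact: hph. all: try exact: hdv.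
  all: try apply: expf_neq0. all: try exact: v0. all: apply: lt0r_neq0 => //. }
have vV k : a <= k <= b -> `|(v k)^-1| <= lam^-1.
  move=> akb; rewrite normfV lef_pV2 ?posrE ?normr_gt0 ?vn0//.
  exact: hlam.
have kV k : a <= k <= b -> `|k^-1| <= a^-1.
  move=> akb; have k0 := pos _ akb; move: akb => /andP[ak kb].
  by rewrite gtr0_norm ?invr_gt0// lef_pV2.
have main : `|rint a b (fun k => k^-1 * cos (ph k)) - (B b - B a)| <= H b - H a.
  apply: rint_compare hB hH _ => //; first exact: cont_oscillation.
  move=> k akb; have k0 := pos _ akb.
  have -> : k^-1 * cos (ph k) - dB k = k ^- 2 * (v k)^-1 * sin (ph k) +
      k^-1 * (dv k * v k ^- 2) * sin (ph k) by rewrite /dB; ring.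
  have dv0 : 0 <= dv k.
    rewrite mulr_ge0//; have /andP[ak _] := akb.
    by rewrite (le_trans _ (ddsymb_ge (le_trans a1 ak)))// mulr_ge0 ?sqr_ge0.
  have -> : dH k = k ^- 2 * lam^-1 * 1 + a^-1 * (dv k * v k ^- 2) * 1.
    by rewrite /dH; ring.
  apply: normD_le; (apply: normM_le; last exact: sin_max); apply: normM_le.
  - by rewrite gtr0_norm ?invr_gt0 ?exprn_gt0.
  - exact: vV.
  - exact: kV.
  - by rewrite ger0_norm// mulr_ge0// invr_ge0 sqr_ge0.
pose q := a^-1 * lam^-1.
have q0 : 0 < q by rewrite mulr_gt0 ?invr_gt0.
have Ble k : a <= k <= b -> `|B k| <= q.
  move=> akb; rewrite /B -[leRHS]mulr1; apply: normM_le; last exact: sin_max.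
  by apply: normM_le; [exact: kV|exact: vV].
have aab : a <= a <= b by rewrite lexx.
have bab : a <= b <= b by rewrite lexx ab.
have HH : H b - H a <= 3 * q.
  have b0 : 0 < b by lra.
  have -> : H b - H a = - (b^-1 * lam^-1) + q
      + (a^-1 * (v a)^-1 - a^-1 * (v b)^-1) by rewrite /H /q; ring.
  have h1 : 0 < b^-1 * lam^-1 by rewrite mulr_gt0 ?invr_gt0.
  have h2 : `|a^-1 * (v a)^-1| <= q by apply: normM_le; [exact: kV|exact: vV].
  have h3 : `|a^-1 * (v b)^-1| <= q by apply: normM_le; [exact: kV|exact: vV].
  by move: h2 h3; rewrite !ler_norml => /andP[? ?] /andP[? ?]; lra.
rewrite invfM -/q.
move: (Ble _ aab) (Ble _ bab) main; rewrite -/ph; set I := rint _ _ _.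
rewrite !ler_norml => /andP[? ?] /andP[? ?] /andP[? ?].
by apply/andP; split; lra.
Qed.

End VanDerCorput.

Section Sequences.
Context {R : realType}.

Lemma cauchy_lim (u e : nat -> R) :
  (forall N M, (N <= M)%N -> `|u M - u N| <= e N) -> e @ \oo --> (0 : R) ->
  u @ \oo --> limn u /\ forall N, `|limn u - u N| <= e N.
Proof.
move=> ue e0.
have cu : cvgn u.
  apply/cauchy_cvgP/cauchy_exP => d d0.
  have /cvgrPdist_lt/(_ d d0) [N _ hN] := e0.
  exists (u N); exists N => // M /= NM.
  rewrite /ball/= distrC (le_lt_trans (ue _ _ NM))//.
  by have := hN N (leqnn N); rewrite sub0r normrN; exact/le_lt_trans/ler_norm.
split=> // N.
have h : (fun M => `|u M - u N|) @ \oo --> `|limn u - u N|.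
  by apply: cvg_norm; apply: cvgB => //; exact: cvg_cst.
rewrite -(cvg_lim _ h)//; apply: limr_le; first by apply/cvg_ex; eexists; exact: h.
by near=> M; apply: ue; near: M; exact: nbhs_infty_ge.
Unshelve. all: by end_near. Qed.

Lemma norm_derive_le (f df : R -> R) (a b K : R) : a <= b ->
  (forall x, a <= x <= b -> has_derive f x (df x)) ->
  (forall x, a <= x <= b -> `|df x| <= K) -> `|f b - f a| <= K * (b - a).
Proof.
move=> ab hf hK.
have [||x xab ->] := MVT_segment (f := f) (df := df) ab.
- by move=> x; rewrite in_itv/= => /andP[ax xb]; apply: hf; rewrite !ltW.
- apply: continuous_in_subspaceT => x; rewrite inE/= in_itv/= => /hf.
  exact: has_derive_continuous.
rewrite normrM (ger0_norm (_ : 0 <= b - a)) ?subr_ge0//.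
by rewrite ler_wpM2r ?subr_ge0//; apply: hK; move: xab; rewrite in_itv.
Qed.

Lemma cos_lipschitz (a b : R) : `|cos a - cos b| <= `|a - b|.
Proof.
wlog ba : a b / b <= a.
  by move=> h; have [/h//|/ltW/h] := leP b a; rewrite distrC (distrC b).
rewrite (ger0_norm (_ : 0 <= a - b)) ?subr_ge0// -[leRHS]mul1r.
apply: (@norm_derive_le _ (fun x => - sin x)) => // x _.
- exact: is_derive_cos.
- by rewrite normrN; exact: sin_max.
Qed.

Lemma cvg_invSn (c : R) : (fun N => c / N.+1%:R) @ \oo --> (0 : R).
Proof.
by rewrite -[X in _ --> X](mulr0 c); apply: cvgMr; exact: cvg_harmonic.
Qed.

End Sequences.

(** * Truncated standing waves and their limit *)

Section Oscillatory.
Context {R : realType} (al : R) (hal : `|al| <= 1).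
Implicit Types (th y tau k a b : R).
Local Notation symb := (symb al).
Local Notation dsymb := (dsymb al).
Local Notation phase := (phase al).

Definition wave a b th tau y : R :=
  rint a b (fun k => k^-1 * cos (y * k) * cos (th + tau * symb k)).

Lemma cont_wave a b th tau y : 0 < a ->
  cont_on a b (fun k => k^-1 * cos (y * k) * cos (th + tau * symb k)).
Proof.
move=> a0 x /andP[ax _]; rewrite /symb; cont_der.
by rewrite gt_eqF// (lt_le_trans a0).
Qed.

Lemma norm_half_sum (u v K : R) : `|u| <= K -> `|v| <= K ->
  `|2^-1 * u + 2^-1 * v| <= K.
Proof.
by rewrite !ler_norml => /andP[? ?] /andP[? ?]; apply/andP; split; lra.
Qed.

(** A standing wave is the mean of two waves travelling in opposite directions, to which the van der
    Corput bounds apply. *)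
Lemma waveE a b th tau y : 0 < a ->
  wave a b th tau y =
  2^-1 * (rint a b (fun k => k^-1 * cos (phase th y tau k))) +
  2^-1 * (rint a b (fun k => k^-1 * cos (phase th (- y) tau k))).
Proof.
move=> a0; rewrite -!rintZ; try exact: cont_oscillation.
rewrite -rintD; last 2 first.
- move=> x xab; apply: cvgM; first exact: cvg_cst.
  by apply: cont_oscillation xab.
- move=> x xab; apply: cvgM; first exact: cvg_cst.
  by apply: cont_oscillation xab.
apply: eq_rint => k _; rewrite /phase.
have -> : th + y * k + tau * symb k = (th + tau * symb k) + y * k by ring.
have -> : th + - y * k + tau * symb k = (th + tau * symb k) - y * k by ring.
move: (th + _) (y * k) (k^-1) => A B u.
by rewrite cosD cosB; field.
Qed.

Lemma wave_le2 a b th tau y : tau != 0 -> 1 <= a -> a <= b ->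
  `|wave a b th tau y| <= (1 + pi) * (a ^+ 2 * Num.sqrt `|tau|)^-1.
Proof.
move=> tau0 a1 ab; rewrite waveE; last by lra.
by apply: norm_half_sum; exact: van_der_corput2.
Qed.

Lemma wave_le1 a b th tau y lam : 0 < lam -> 1 <= a -> a <= b ->
  (forall k, a <= k <= b -> lam <= `|y| - `|tau| * dsymb k) ->
  `|wave a b th tau y| <= 6 * (a * lam)^-1.
Proof.
move=> lam0 a1 ab hlam; rewrite waveE; last by lra.
have h y' : `|y'| = `|y| -> `|rint a b (fun k => k^-1 * cos (phase th y' tau k))|
    <= 6 * (a * lam)^-1.
  move=> yE; apply: (van_der_corput1 hal) => // k akb.
  apply: (le_trans (hlam _ akb)); rewrite -yE.
  have /andP[ak _] := akb; have /andP[d0 _] := dsymb_le hal (le_trans a1 ak).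
  rewrite -{1}(ger0_norm d0) -normrM lerBlDr.
  by rewrite -{1}(addrK (tau * dsymb k) y') ler_normB.
by apply: norm_half_sum; apply: h; rewrite ?normrN.
Qed.

(** The constant grows like [b^5], which is harmless: it serves at a fixed cut-off, the tail being
    controlled separately. *)
Lemma wave_lipschitz a b th tau tau' y y' : 1 <= a -> a <= b ->
  `|wave a b th tau y - wave a b th tau' y'| <=
  (b - a) * (`|y - y'| + 2 * b ^+ 4 * `|tau - tau'|).
Proof.
move=> a1 ab; rewrite /wave -rintB; try by apply: cont_wave; lra.
rewrite mulrC -rint_cst//; apply: norm_rint_le.
- by move=> x xab; apply: cvgB; apply: cont_wave xab; lra.
- by move=> x _; exact: cvg_cst.
- move=> k /andP[ak kb].
  have k0 : 0 < k by lra.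
  have -> : k^-1 * cos (y * k) * cos (th + tau * symb k) -
      k^-1 * cos (y' * k) * cos (th + tau' * symb k) =
      k^-1 * (cos (y * k) - cos (y' * k)) * cos (th + tau * symb k) +
      (k^-1 * cos (y' * k)) * (cos (th + tau * symb k) - cos (th + tau' * symb k)).
    by ring.
  apply: normD_le.
  + rewrite -[leRHS]mulr1; apply: normM_le; last exact: cos_max.
    rewrite normrM gtr0_norm ?invr_gt0// ler_pdivrMl//.
    by rewrite (le_trans (cos_lipschitz _ _))// -mulrBl normrM mulrC gtr0_norm.
  + rewrite -[leRHS]mul1r; apply: normM_le.
      rewrite -[leRHS]mulr1; apply: normM_le; last exact: cos_max.
      by rewrite gtr0_norm ?invr_gt0// invf_le1//; lra.
    rewrite (le_trans (cos_lipschitz _ _))//.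
    have -> : th + tau * symb k - (th + tau' * symb k) = symb k * (tau - tau') by ring.
    rewrite normrM ler_wpM2r//.
    have /andP[s0 s1] := symb_le hal (le_trans a1 ak).
    rewrite ger0_norm// (le_trans s1)// ler_pM2l// lerXn2r// ?nnegrE; lra.
Qed.

Lemma wave_split a c b th tau y : 1 <= a -> a <= c <= b ->
  wave a b th tau y = wave a c th tau y + wave c b th tau y.
Proof.
by move=> a1 acb; apply: rint_split => //; apply: cont_wave; lra.
Qed.

Definition Wn (N : nat) th tau y : R := wave 1 N.+1%:R th tau y.

(* At [tau = y = 0] the integral diverges; the value 0 is irrelevant. *)
Definition W th tau y : R :=
  if (tau == 0) && (y == 0) then 0 else limn (fun N => Wn N th tau y).

Lemma WnB N M th tau y : (N <= M)%N ->
  Wn M th tau y - Wn N th tau y = wave N.+1%:R M.+1%:R th tau y.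
Proof.
move=> NM; rewrite /Wn (@wave_split _ N.+1%:R)//; first by rewrite addrC addKr.
by rewrite ler1n ler_nat.
Qed.

(** The second-derivative bound decays like [(N+1)^-2]; one power is given up so that this case has
    the same rate [c / (N+1)] as [tau = 0]. The bound is uniform in [y]. *)
Lemma W_cauchy_ne0 th tau y : tau != 0 ->
  (fun N => Wn N th tau y) @ \oo --> W th tau y /\
  forall N, `|W th tau y - Wn N th tau y| <=
    (1 + pi) / Num.sqrt `|tau| / N.+1%:R.
Proof.
move=> tau0; rewrite /W (negbTE tau0)/=; apply: cauchy_lim; last exact: cvg_invSn.
move=> N M NM; rewrite WnB//.
apply: (le_trans (wave_le2 _ _ tau0 _ _)); rewrite ?ler1n ?ler_nat//.
rewrite -mulrA; apply: ler_wpM2l; first by rewrite addr_ge0// pi_ge0.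
rewrite -invfM.
have t0 : 0 < Num.sqrt `|tau| by rewrite sqrtr_gt0 normr_gt0.
rewrite lef_pV2 ?posrE ?mulr_gt0 ?exprn_gt0 ?ltr0n// mulrC ler_pM2r//.
by rewrite expr2 ler_peMl// ler1n.
Qed.

Lemma W_cauchy_eq0 th y : y != 0 ->
  (fun N => Wn N th 0 y) @ \oo --> W th 0 y /\
  forall N, `|W th 0 y - Wn N th 0 y| <= 6 / `|y| / N.+1%:R.
Proof.
move=> y0; rewrite /W (negbTE y0) andbF; apply: cauchy_lim; last exact: cvg_invSn.
move=> N M NM; rewrite WnB// -mulrA -invfM mulrC [_ * N.+1%:R]mulrC mulrC.
apply: wave_le1; rewrite ?normr_gt0 ?ler1n ?ler_nat//.
by move=> k _; rewrite normr0 mul0r subr0.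
Qed.

Lemma W_cvg th tau y : (tau != 0) || (y != 0) ->
  (fun N => Wn N th tau y) @ \oo --> W th tau y.
Proof.
have [->/=|t0 _] := eqVneq tau 0; first by move=> /(W_cauchy_eq0 th)[].
by have [] := W_cauchy_ne0 th y t0.
Qed.

Lemma W_bound th tau y : tau != 0 -> `|W th tau y| <= (1 + pi) / Num.sqrt `|tau|.
Proof.
(* [Wn 0] is an integral over the single point 1, so the error at [N = 0] is [W] itself. *)
move=> t0; have [_ /(_ 0)] := W_cauchy_ne0 th y t0.
by rewrite /Wn /wave /rint set_itv1 Rintegral_set1 subr0 divr1.
Qed.

End Oscillatory.

(** * Continuity away from the singular point *)

Section Continuity.
Context {R : realType} (al : R) (hal : `|al| <= 1).
Implicit Types (th y tau k a b c e : R).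
Local Notation symb := (symb al).
Local Notation dsymb := (dsymb al).
Local Notation W := (W al).
Local Notation Wn := (Wn al).
Local Notation wave := (wave al).

Lemma ex_invSn_lt c e : 0 < e -> exists N : nat, c / N.+1%:R < e.
Proof.
move=> e0; have /cvgrPdist_lt/(_ e e0) [N _ hN] := cvg_invSn c.
exists N; have := hN N (leqnn N); rewrite sub0r normrN.
exact/le_lt_trans/ler_norm.
Qed.

(** Compare [W] with a truncation at both points, then the truncations with each other. [P] is the
    region where the rate is uniform: times bounded away from 0, or the slice [tau = 0] with [y]
    bounded away from 0, since the rate for [tau != 0] degenerates as [tau] tends to 0. *)
Lemma W_close (P : R -> R -> Prop) c th tau y e :
  (forall tau' y', P tau' y' ->
     forall N, `|W th tau' y' - Wn N th tau' y'| <= c / N.+1%:R) ->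
  P tau y -> 0 < e ->
  exists2 d, 0 < d & forall tau' y', P tau' y' -> `|tau - tau'| < d ->
    `|y - y'| < d -> `|W th tau y - W th tau' y'| < e.
Proof.
move=> hP Py e0; have e4 : 0 < e / 4 by rewrite divr_gt0.
have [N hN] := ex_invSn_lt c e4.
pose L := N.+1%:R * (1 + 2 * N.+1%:R ^+ 4) : R.
have L0 : 0 < L by rewrite mulr_gt0 ?ltr0n// addr_gt0// mulr_gt0// exprn_gt0// ltr0n.
exists (e / 4 / L); first by rewrite divr_gt0.
move=> tau' y' P' ht hy.
have h1 := hP _ _ Py N; have h2 := hP _ _ P' N.
have N1 : 1 <= N.+1%:R :> R by rewrite ler1n.
have := wave_lipschitz hal th tau tau' y y' (lexx 1) N1.
rewrite -/(Wn N th tau y) -/(Wn N th tau' y') => h3.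
have h4 : (N.+1%:R - 1) * (`|y - y'| + 2 * N.+1%:R ^+ 4 * `|tau - tau'|)
    <= L * (e / 4 / L).
  have -> : L * (e / 4 / L) = N.+1%:R * ((1 + 2 * N.+1%:R ^+ 4) * (e / 4 / L)).
    by rewrite [RHS]mulrA.
  apply: ler_pM.
  - by rewrite subr_ge0.
  - by rewrite addr_ge0// !mulr_ge0// exprn_ge0// ler0n.
  - by rewrite gerBl.
  - rewrite [leRHS]mulrDl mul1r; apply: lerD; first exact: ltW.
    by rewrite ler_wpM2l ?ltW// mulr_gt0// exprn_gt0// ltr0n.
have LE : L * (e / 4 / L) = e / 4 by rewrite mulrC divfK ?gt_eqF.
rewrite LE in h4; move: hN h1 h2 (le_trans h3 h4); rewrite !ler_norml ltr_norml.
move: (W _ _ _) (W _ _ _) (Wn _ _ _ _) (Wn _ _ _ _) (c / _) => u v u' v' w hw.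
clear -hw e0.
by move=> /andP[? ?] /andP[? ?] /andP[? ?]; apply/andP; split; lra.
Qed.

Lemma W_close_ne0 th tau y e : tau != 0 -> 0 < e ->
  exists2 d, 0 < d & forall tau' y', `|tau - tau'| < d ->
    `|y - y'| < d -> `|W th tau y - W th tau' y'| < e.
Proof.
move=> t0 e0; have nt : 0 < `|tau| by rewrite normr_gt0.
have h2 : 0 < `|tau| / 2 by rewrite divr_gt0.
have [||d d0 hd] := @W_close (fun tau' _ => `|tau| / 2 <= `|tau'|)
    ((1 + pi) / Num.sqrt (`|tau| / 2)) th tau y e _ _ e0.
- move=> tau' y' h N.
  have t' : 0 < `|tau'| by lra.
  have [_ /(_ N) /le_trans] := W_cauchy_ne0 hal th y' (etrans (esym (normr_gt0 tau')) t').
  apply; rewrite ler_pM2r ?invr_gt0 ?ltr0n//.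
  apply: ler_wpM2l; first by rewrite addr_ge0// pi_ge0.
  by rewrite lef_pV2 ?posrE ?sqrtr_gt0// ler_wsqrtr.
- by rewrite ler_pdivrMr// ler_peMr// ler1n.
exists (Num.min d (`|tau| / 2)); first by rewrite lt_min d0.
move=> tau' y'; rewrite !lt_min => /andP[h h'] /andP[hy _]; apply: hd => //.
have := ler_distD tau' tau 0; rewrite !subr0 => ?; lra.
Qed.

Lemma W_close_eq0 th y e : y != 0 -> 0 < e ->
  exists2 d, 0 < d & forall y', `|y - y'| < d -> `|W th 0 y - W th 0 y'| < e.
Proof.
move=> y0 e0; have ny : 0 < `|y| by rewrite normr_gt0.
have h2 : 0 < `|y| / 2 by rewrite divr_gt0.
have [||d d0 hd] := @W_close (fun tau' y' => tau' = 0 /\ `|y| / 2 <= `|y'|)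
    (6 / (`|y| / 2)) th 0 y e _ _ e0.
- move=> tau' y' [-> h] N.
  have y'0 : 0 < `|y'| by lra.
  have [_ /(_ N) /le_trans] := W_cauchy_eq0 hal th (etrans (esym (normr_gt0 y')) y'0).
  apply; rewrite ler_pM2r ?invr_gt0 ?ltr0n//.
  by rewrite ler_pM2l// lef_pV2.
- by split=> //; rewrite ler_pdivrMr// ler_peMr// ler1n.
exists (Num.min d (`|y| / 2)); first by rewrite lt_min d0.
move=> y'; rewrite !lt_min => /andP[h h']; apply: hd => //; last first.
  by rewrite subrr normr0.
split=> //; have := ler_distD y' y 0; rewrite !subr0 => ?; lra.
Qed.

End Continuity.

(** * Logarithmic blow-up at the singular point *)

Section BlowUp.
Context {R : realType} (al : R) (hal : `|al| <= 1).
Implicit Types (th y tau k a b c e : R).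
Local Notation symb := (symb al).
Local Notation dsymb := (dsymb al).
Local Notation W := (W al).
Local Notation Wn := (Wn al).
Local Notation wave := (wave al).

Lemma norm_sin_le y : `|sin y| <= `|y|.
Proof.
have h a : 0 <= a -> `|sin a| <= a.
  move=> a0; have := @norm_derive_le R sin cos 0 a 1 a0.
  rewrite sin0 !subr0 mul1r; apply=> x _; first exact: is_derive_sin.
  exact: cos_max.
have [y0|y0] := leP 0 y; first by rewrite (ger0_norm y0) h.
by rewrite -normrN -sinN -[leRHS]normrN (ger0_norm (_ : 0 <= - y)) ?h// oppr_ge0 ltW.
Qed.

Lemma onem_cos_le y : 1 - cos y <= y ^+ 2 / 2.
Proof.
have -> : y = y / 2 + y / 2 by field.
rewrite cosD -!expr2 cos2sin2.
have : sin (y / 2) ^+ 2 <= (y / 2) ^+ 2.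
  by rewrite -(real_normK (num_real (sin _))) -[leRHS]real_normK ?num_real// lerXn2r ?nnegrE// norm_sin_le.
by lra.
Qed.

Lemma cos_ge_half y : `|y| <= 1 -> 2^-1 <= cos y.
Proof.
move=> y1; have := onem_cos_le y.
have : y ^+ 2 <= 1 by rewrite -[leLHS]real_normK ?num_real// exprn_ile1.
lra.
Qed.

Lemma rint_inv a b : 0 < a -> a <= b -> rint a b (fun k => k^-1) = ln b - ln a.
Proof.
move=> a0 ab; apply: rint_FTC => // x /andP[ax _].
- by cont_der; rewrite gt_eqF// (lt_le_trans a0).
- by apply: is_derive1_ln; rewrite (lt_le_trans a0).
Qed.

Lemma wave_log_le a b th tau y : 0 < a -> a <= b ->
  `|wave a b th tau y| <= ln b - ln a.
Proof.
move=> a0 ab; rewrite -rint_inv//; apply: norm_rint_le; first exact: cont_wave.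
  by move=> x /andP[ax _]; cont_der; rewrite gt_eqF// (lt_le_trans a0).
move=> k /andP[ak _]; rewrite -[leRHS]mulr1; apply: normM_le; last exact: cos_max.
rewrite -[leRHS]mulr1; apply: normM_le; last exact: cos_max.
by rewrite gtr0_norm// invr_gt0 (lt_le_trans a0).
Qed.

(** On [[1, L]] both cosines have arguments in [[-1, 1]], hence values at least 1/2, and the
    integrand is at least [k^-1 / 4]. The 1/2 in the hypothesis offsets [symb k <= 2 k^4]. *)
Lemma wave_log_ge L tau y : 1 <= L -> `|y| * L <= 1 -> `|tau| * L ^+ 4 <= 2^-1 ->
  4^-1 * ln L <= wave 1 L 0 tau y.
Proof.
move=> L1 hy ht; have := @rint_inv 1 L ltr01 L1; rewrite ln1 subr0 => <-.
have ci : cont_on 1 L (fun k : R => k^-1).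
  by move=> x /andP[ax _]; cont_der; rewrite gt_eqF// (lt_le_trans ltr01).
rewrite -rintZ//; apply: le_rint; last 1 first.
- move=> k /andP[k1 kL]; have k0 : 0 < k by lra.
  rewrite mulrC -mulrA ler_pM2l ?invr_gt0// add0r.
  have -> : 4^-1 = 2^-1 * 2^-1 :> R by field.
  apply: ler_pM => //; apply: cos_ge_half; rewrite normrM.
    by rewrite (le_trans _ hy)// ler_wpM2l// gtr0_norm.
  have /andP[s0 s1] := symb_le hal k1; rewrite (ger0_norm s0).
  have : `|tau| * symb k <= `|tau| * (2 * L ^+ 4).
    apply: ler_wpM2l => //; apply: (le_trans s1); rewrite ler_pM2l//.
    by rewrite lerXn2r ?nnegrE//; lra.
  by move: ht; lra.
- by move=> x hx; apply: cvgM; [exact: cvg_cst|exact: ci].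
- exact: cont_wave.
Qed.

(** Beyond [q^-1] the second-derivative bound is [1 + pi], because [a^2 sqrt |tau| = 1] at
    [a = q^-1]. Between [L] and [q^-1], either [|y| <= 12 q], and the logarithmic length is at most
    [ln 24]; or [|y| > 12 q], and [|tau| dsymb k <= 6 q < |y| / 2] makes the phase nonstationary,
    with the bound [12 / (L |y|) <= 24]. For [q = 0] the phase is nonstationary throughout. *)
Lemma wave_tail tau y q b th (L := (`|y| + 12 * q)^-1) :
  0 <= q -> q ^+ 4 = `|tau| -> 0 < `|y| + 12 * q -> 1 <= L -> L <= b ->
  (q = 0 \/ 1 <= q * b) ->
  `|wave L b th tau y| <= 24 + ln 24 + (1 + pi).
Proof.
move=> q0 qtau D0 L1 Lb hq.
have l24 : 0 <= ln 24 :> R by rewrite ln_ge0// ler1n.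
have p0 : 0 <= pi :> R by exact: pi_ge0.
have LE : L^-1 = `|y| + 12 * q by rewrite invrK.
have [/andP[yq qb]|hne] := boolP ((12 * q < `|y|) && (q == 0)).
  have y0 : 0 < `|y| by rewrite (le_lt_trans _ yq)// mulr_ge0.
  have t0 : tau = 0.
    by apply/eqP; rewrite -normr_eq0 -qtau (eqP qb) expr0n.
  apply: (@le_trans _ _ (6 * (L * `|y|)^-1)).
    by apply: wave_le1 => // k _; rewrite t0 normr0 mul0r subr0.
  rewrite invfM LE (eqP qb) mulr0 addr0 divff ?gt_eqF//; lra.
have q1 : 0 < q.
  rewrite lt_neqAle q0 andbT eq_sym; apply/eqP => qE.
  move: hne; rewrite qE eqxx andbT mulr0 -leNgt => y0.
  by move: D0; rewrite qE mulr0 addr0 ltNge y0.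
have qb : 1 <= q * b by case: hq => // qE; rewrite qE ltxx in q1.
have Lq : L <= q^-1.
  by rewrite lef_pV2 ?posrE//; have := normr_ge0 y; lra.
have qb' : q^-1 <= b by rewrite -[q^-1]mulr1 ler_pdivrMl.
have tau0 : tau != 0 by rewrite -normr_gt0 -qtau exprn_gt0.
rewrite (@wave_split _ _ _ q^-1) ?Lq//.
apply: normD_le.
  have [yq|yq] := leP `|y| (12 * q).
    rewrite (le_trans (wave_log_le _ _ _ _ _))//; first by lra.
    have h : ln (`|y| + 12 * q) <= ln 24 + ln q.
      by rewrite -lnM ?posrE// ler_ln ?posrE ?mulr_gt0//; lra.
    by rewrite /L !lnV ?posrE//; lra.
  have y0 : 0 < `|y| by rewrite (le_lt_trans _ yq)// mulr_ge0.
  apply: (@le_trans _ _ (6 * (L * (`|y| / 2))^-1)).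
    apply: wave_le1 => //; first by rewrite divr_gt0.
    move=> k /andP[Lk kq].
    have k1 : 1 <= k by lra.
    have /andP[d0 d1] := dsymb_le hal k1.
    have qk : q * k <= 1 by rewrite mulrC -ler_pdivlMr// mul1r.
    have : `|tau| * dsymb k <= 6 * q.
      rewrite -qtau; apply: (@le_trans _ _ (q ^+ 4 * (6 * k ^+ 3))).
        by rewrite ler_pM2l// exprn_gt0.
      have -> : q ^+ 4 * (6 * k ^+ 3) = 6 * q * (q * k) ^+ 3 by ring.
      by rewrite ler_piMr ?mulr_ge0// exprn_ile1// mulr_ge0//; lra.
    by lra.
  rewrite invfM LE invfM invrK mulrA.
  have : (`|y| + 12 * q) / `|y| <= 2 by rewrite ler_pdivrMr//; lra.
  lra.
apply: (le_trans (wave_le2 hal _ _ tau0 _ _)) => //; first by lra.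
rewrite -qtau (_ : q ^+ 4 = (q ^+ 2) ^+ 2); last by ring.
rewrite sqrtr_sqr ger0_norm ?sqr_ge0// exprVn mulVf ?invr1 ?mulr1//.
by rewrite expf_neq0// gt_eqF.
Qed.

Lemma W_lower tau y q (L := (`|y| + 12 * q)^-1) :
  0 <= q -> q ^+ 4 = `|tau| -> 0 < `|y| + 12 * q -> 1 <= L ->
  4^-1 * ln L - (24 + ln 24 + (1 + pi)) <= W 0 tau y.
Proof.
move=> q0 qtau D0 L1.
have LE : L^-1 = `|y| + 12 * q by rewrite invrK.
have L0 : 0 < L by lra.
have nz : (tau != 0) || (y != 0).
  rewrite -negb_and; apply/negP => /andP[/eqP tE /eqP yE].
  have qE : q = 0.
    by apply/eqP; move/eqP: qtau; rewrite tE normr0 expf_eq0.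
  by move: D0; rewrite yE qE normr0 mulr0 addr0 ltxx.
have hc := W_cvg hal (th := 0) nz.
rewrite -(cvg_lim _ hc)//; apply: limr_ge; first by apply/cvg_ex; eexists; exact: hc.
near=> N.
have Lb : L <= N.+1%:R.
  rewrite (@le_trans _ _ N%:R)// ?ler_nat//; near: N; exact: nbhs_infty_ger.
have qb : q = 0 \/ 1 <= q * N.+1%:R.
  have [->|qn] := eqVneq q 0; [by left|right].
  rewrite -ler_pdivrMl ?lt_neqAle ?q0 1?eq_sym ?qn// mulr1.
  rewrite (@le_trans _ _ N%:R)// ?ler_nat//; near: N; exact: nbhs_infty_ger.
rewrite /Wn (@wave_split _ _ _ L) ?L1//.
have := wave_tail 0 q0 qtau D0 L1 Lb qb; rewrite ler_norml => /andP[h _].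
have h2 : 4^-1 * ln L <= wave 1 L 0 tau y.
  apply: wave_log_ge => //.
    by rewrite -ler_pdivlMr// mul1r LE lerDl mulr_ge0.
  rewrite -qtau -exprMn.
  have : q * L <= 12^-1.
    rewrite -ler_pdivlMr// LE; have := normr_ge0 y; lra.
  move=> h3; apply: (@le_trans _ _ (12^-1 ^+ 4)).
    by rewrite lerXn2r// nnegrE ?mulr_ge0 ?invr_ge0// ltW.
  lra.
by move: h h2; rewrite /L; lra.
Unshelve. all: by end_near. Qed.

Lemma W_blowup (A : R) : exists2 d, 0 < d & forall tau y,
  `|tau| < d -> `|y| < d -> (tau != 0) || (y != 0) -> A <= W 0 tau y.
Proof.
pose M := 4 * (`|A| + (24 + ln 24 + (1 + pi))) : R.
have M0 : 0 <= M.
  have l24 : 0 <= ln 24 :> R by rewrite ln_ge0// ler1n.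
  have p0 : 0 <= pi :> R by exact: pi_ge0.
  by rewrite /M; have := normr_ge0 A; lra.
(* If [|y| < r] and [q < r] then [|y| + 12 q <= 13 r = expR (- M)], so [ln L >= M]; and [M / 4] is
   [|A|] plus the loss in [W_lower]. *)
pose r := expR (- M) / 13.
have r0 : 0 < r by rewrite divr_gt0 ?expR_gt0.
exists (Num.min r (r ^+ 4)); first by rewrite lt_min r0 exprn_gt0.
move=> tau y; rewrite !lt_min => /andP[_ ht] /andP[hy _] nz.
pose q := Num.sqrt (Num.sqrt `|tau|).
have q0 : 0 <= q by exact: sqrtr_ge0.
have qtau : q ^+ 4 = `|tau|.
  have -> : q ^+ 4 = (q ^+ 2) ^+ 2 by rewrite -exprM.
  by rewrite sqr_sqrtr ?sqrtr_ge0// sqr_sqrtr.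
have qr : q < r by rewrite -(@ltr_pXn2r _ 4%N) ?nnegrE ?(ltW r0)// qtau.
have D0 : 0 < `|y| + 12 * q.
  case/orP: nz => h.
    rewrite ltr_wpDl// mulr_gt0// lt_neqAle q0 andbT eq_sym.
    by apply: contraNneq h => qE; rewrite -normr_eq0 -qtau qE expr0n.
  by rewrite ltr_pwDl ?normr_gt0// mulr_ge0.
have DM : `|y| + 12 * q <= expR (- M).
  have : expR (- M) = 13 * r by rewrite /r; field.
  by move=> ->; lra.
have LM : expR M <= (`|y| + 12 * q)^-1.
  by rewrite -[expR M]invrK -expRN lef_pV2 ?posrE ?expR_gt0.
have L1 : 1 <= (`|y| + 12 * q)^-1 by rewrite (le_trans _ LM)// -expR0 ler_expR.
have := W_lower q0 qtau D0 L1.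
have : M <= ln (`|y| + 12 * q)^-1.
  by rewrite -[M]expRK ler_ln ?posrE ?expR_gt0 ?invr_gt0.
rewrite /M; have := ler_norm A; lra.
Qed.

End BlowUp.

(** * Smoothness away from the singular time *)

Section DerivativeCriteria.
Context {R : realType}.
Implicit Types (f g : R -> R) (x d e : R).

Lemma has_derive_epsP f x d : has_derive f x d <->
  forall e, 0 < e -> exists2 r, 0 < r & forall h, `|h| < r ->
    `|f (x + h) - f x - h * d| <= e * `|h|.
Proof.
split=> [[df dfE] e e0|H].
  have : h^-1 *: (f (h *: (1 : R) + x) - f x) @[h --> (0 : R)^'] --> d.
    by move: df; rewrite /derivable -dfE.
  move=> /cvgrPdist_le/(_ e e0) => -[r /= r0 hr].
  exists r => // h hlt; have [->|h0] := eqVneq h 0.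
    by rewrite addr0 subrr mul0r subrr normr0 mulr0.
  have := hr h; rewrite /ball/= sub0r normrN => /(_ hlt h0).
  rewrite /GRing.scale/= mulr1 [h + x]addrC => h1.
  have -> : f (x + h) - f x - h * d = - (h * (d - h^-1 * (f (x + h) - f x))).
    by field.
  by rewrite normrN normrM mulrC ler_wpM2r.
have hc : h^-1 *: (f (h *: (1 : R) + x) - f x) @[h --> (0 : R)^'] --> d.
  apply/cvgrPdist_le => e e0; have [r r0 hr] := H _ e0.
  exists r => //= h; rewrite /ball/= sub0r normrN => hlt h0.
  rewrite /GRing.scale/= mulr1 [h + x]addrC.
  have -> : d - h^-1 * (f (x + h) - f x) = - (h^-1 * (f (x + h) - f x - h * d)).
    by field.
  by rewrite normrN normrM normfV ler_pdivrMl ?normr_gt0// [leRHS]mulrC; exact: hr.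
split; first by apply/cvg_ex; exists d.
exact: cvg_lim hc.
Qed.

Lemma has_derive_quadratic f x d C :
  (forall h, `|f (x + h) - f x - h * d| <= C * h ^+ 2) -> has_derive f x d.
Proof.
move=> hC; apply/has_derive_epsP => e e0.
have C1 : 0 < `|C| + 1 by rewrite ltr_wpDl.
exists (e / (`|C| + 1)); first by rewrite divr_gt0.
move=> h hlt; apply: (le_trans (hC h)).
rewrite -(real_normK (num_real h)) expr2 mulrA ler_wpM2r//.
have h1 : `|h| * (`|C| + 1) <= e by rewrite -ler_pdivlMr// ltW.
apply: (le_trans _ h1); rewrite mulrC ler_wpM2l//.
by rewrite (le_trans (ler_norm _))// lerDl.
Qed.

Lemma norm_derive_le_sym f df x h K :
  (forall z, `|z - x| <= `|h| -> has_derive f z (df z)) ->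
  (forall z, `|z - x| <= `|h| -> `|df z| <= K) ->
  `|f (x + h) - f x| <= K * `|h|.
Proof.
move=> hf hK; have [h0|h0] := leP 0 h.
  have := @norm_derive_le R f df x (x + h) K; rewrite addrAC subrr add0r.
  rewrite lerDl => /(_ h0); rewrite (ger0_norm h0); apply => z /andP[z1 z2];
    [apply: hf|apply: hK]; by rewrite (ger0_norm h0) ger0_norm; lra.
have := @norm_derive_le R f df (x + h) x K; rewrite opprD addrA subrr sub0r.
rewrite gerDl (ltW h0) distrC (ltr0_norm h0) => /(_ isT); apply => z /andP[z1 z2];
  [apply: hf|apply: hK]; by rewrite (ltr0_norm h0) ler0_norm; lra.
Qed.

(** Termwise differentiation: the mean value inequality for [fn M - fn n0], whose derivative is
    locally small, bounds its increments by a small multiple of [|h|] uniformly in [M], and [M] goes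
    to infinity. *)
Lemma has_derive_lim (fn gn : nat -> R -> R) f g :
  (forall n x, has_derive (fn n) x (gn n x)) ->
  (forall x, fn ^~ x @ \oo --> f x) ->
  (forall Y e, 0 < e -> exists n0, forall n, (n0 <= n)%N -> forall x,
     `|x| <= Y -> `|g x - gn n x| <= e) ->
  forall x, has_derive f x (g x).
Proof.
move=> hd hf hg x; apply/has_derive_epsP => e e0.
have e4 : 0 < e / 4 by rewrite divr_gt0.
have [n0 hn0] := hg (`|x| + 1) _ e4.
have /has_derive_epsP/(_ _ e4) [r r0 hr] := hd n0 x.
exists (Num.min r 1); first by rewrite lt_min r0 ltr01.
move=> h; rewrite lt_min => /andP[hlt h1].
have inY z : `|z - x| <= `|h| -> `|z| <= `|x| + 1.
  by move=> hz; have := ler_distD x z 0; rewrite !subr0; lra.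
have key M : (n0 <= M)%N ->
    `|(fn M (x + h) - fn M x) - (fn n0 (x + h) - fn n0 x)| <= e / 2 * `|h|.
  move=> nM.
  have -> : fn M (x + h) - fn M x - (fn n0 (x + h) - fn n0 x) =
      fn M (x + h) - fn n0 (x + h) - (fn M x - fn n0 x) by ring.
  apply: (@norm_derive_le_sym (fun z => fn M z - fn n0 z) (fun z => gn M z - gn n0 z)) => z hz.
    by apply: derD; [exact: hd|apply: derN; exact: hd].
  have := hn0 _ nM z (inY _ hz); have := hn0 _ (leqnn _) z (inY _ hz).
  rewrite !ler_norml => /andP[? ?] /andP[? ?]; apply/andP; split; lra.
have hlim : (fun M => `|(fn M (x + h) - fn M x) - (fn n0 (x + h) - fn n0 x)|)
    @ \oo --> `|(f (x + h) - f x) - (fn n0 (x + h) - fn n0 x)|.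
  apply: cvg_norm; apply: cvgB; last exact: cvg_cst.
  by apply: cvgB; exact: hf.
have h2 : `|(f (x + h) - f x) - (fn n0 (x + h) - fn n0 x)| <= e / 2 * `|h|.
  rewrite -(cvg_lim _ hlim)//; apply: limr_le.
    by apply/cvg_ex; eexists; exact: hlim.
  by exists n0 => // M /=; exact: key.
have h3 := hr h hlt.
have h4 : `|h * (gn n0 x - g x)| <= e / 4 * `|h|.
  rewrite normrM mulrC ler_wpM2r// distrC; apply: hn0 => //.
  by rewrite lerDl.
have -> : f (x + h) - f x - h * g x =
    ((f (x + h) - f x) - (fn n0 (x + h) - fn n0 x)) +
    ((fn n0 (x + h) - fn n0 x - h * gn n0 x) + h * (gn n0 x - g x)) by ring.
have -> : e * `|h| = e / 2 * `|h| + (e / 4 * `|h| + e / 4 * `|h|) by field.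
by apply: normD_le => //; apply: normD_le.
Qed.

Lemma cos_taylor2 (z h : R) : `|cos (z + h) - cos z + h * sin z| <= h ^+ 2.
Proof.
have -> : cos (z + h) - cos z + h * sin z =
    cos (z + h) + (z + h) * sin z - (cos z + z * sin z) by ring.
have -> : h ^+ 2 = `|h| * `|h| by rewrite -normrM -expr2 ger0_norm ?sqr_ge0.
apply: (@norm_derive_le_sym (fun u => cos u + u * sin z) (fun u => - sin u + sin z)) => u hu.
  by der => /=; ring.
rewrite (le_trans _ hu)// addrC distrC.
have -> : u = z + (u - z) by ring.
have -> : z + (u - z) - z = u - z by ring.
rewrite -[leRHS]mul1r; apply: (@norm_derive_le_sym sin cos) => v _.
  exact: is_derive_sin.
exact: cos_max.
Qed.

(** The Taylor remainder of the cosine is quadratic in the increment with coefficient [|A| q^2], so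
    the integral can be differentiated without a limit theorem. Writing the derivative as a shift by
    [pi / 2] keeps this class of integrals closed under differentiation; it is applied in space,
    time and frequency. *)
Lemma rint_param_derive a b (A q kap : R -> R) (y : R) :
  cont_on a b A -> cont_on a b q -> cont_on a b kap ->
  has_derive (fun y => rint a b (fun k => A k * cos (kap k + y * q k))) y
    (rint a b (fun k => A k * q k * cos (kap k + pi / 2 + y * q k))).
Proof.
move=> cA cq ck.
have cc y' : cont_on a b (fun k => A k * cos (kap k + y' * q k)).
  move=> k kab; apply: cvgM; first exact: cA.
  apply: continuous_comp; last exact: continuous_cos.
  apply: cvgD; first exact: ck.
  by apply: cvgM; [exact: cvg_cst|exact: cq].
have cc' : cont_on a b (fun k => A k * q k * cos (kap k + pi / 2 + y * q k)).
  move=> k kab; apply: cvgM; first by apply: cvgM; [exact: cA|exact: cq].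
  apply: continuous_comp; last exact: continuous_cos.
  apply: cvgD; first by apply: cvgD; [exact: ck|exact: cvg_cst].
  by apply: cvgM; [exact: cvg_cst|exact: cq].
apply: (@has_derive_quadratic _ _ _ (rint a b (fun k => `|A k| * q k ^+ 2))) => h.
have cAq : cont_on a b (fun k => `|A k| * q k ^+ 2).
  move=> k kab; apply: cvgM.
    by apply: continuous_comp; [exact: cA|exact: norm_continuous].
  by apply: cvgM; exact: cq.
rewrite -rintB// -rintZ// -rintB//; last 2 first.
- by move=> k kab; apply: cvgB; exact: cc.
- by move=> k kab; apply: cvgM; [exact: cvg_cst|exact: cc'].
rewrite [leRHS]mulrC -rintZ//; apply: norm_rint_le.
- move=> k kab; apply: cvgB; first by apply: cvgB; exact: cc.
  by apply: cvgM; [exact: cvg_cst|exact: cc'].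
- by move=> k kab; apply: cvgM; [exact: cvg_cst|exact: cAq].
- move=> k _; rewrite [kap k + _ + _]addrAC cosDpihalf.
  have -> : A k * cos (kap k + (y + h) * q k) - A k * cos (kap k + y * q k) -
      h * (A k * q k * - sin (kap k + y * q k)) =
      A k * (cos (kap k + y * q k + h * q k) - cos (kap k + y * q k) +
        h * q k * sin (kap k + y * q k)).
    by rewrite mulrDl addrA; ring.
  rewrite normrM mulrCA ler_wpM2l//.
  by rewrite -exprMn cos_taylor2.
Qed.

End DerivativeCriteria.

Section SmoothClosure.
Context {R : realType}.
Implicit Types (f g : R -> R).

(* Unlike the library's iterated derivative, this form is stable under sums and
   products by a direct induction. *)
Fixpoint Ck (n : nat) f : Prop :=
  if n is m.+1 then exists2 g, (forall x, has_derive f x (g x)) & Ck m g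
  else True.

Lemma CkS n f : Ck n.+1 f -> Ck n f.
Proof.
elim: n f => [//|n IH] f [g fg cg]; exists g => //; exact: IH.
Qed.

Lemma has_derive1 f g : (forall x, has_derive f x (g x)) -> f^`()%classic = g.
Proof.
by move=> fg; apply/funext => x; rewrite derive1E; have [_ ] := fg x.
Qed.

Lemma Ck_smooth f : (forall n, Ck n f) -> smooth f.
Proof.
move=> cf n; have := cf n.+1; elim: n f {cf} => [|n IH] f.
  by move=> [g fg _] x; have [] := fg x.
move=> [g fg cg] x.
have -> : f^`(n.+1)%classic = g^`(n)%classic.
  by rewrite /derive1n iterSr (has_derive1 fg).
exact: IH.
Qed.

Lemma smooth_has_derive f n x : smooth f ->
  has_derive (f^`(n)%classic) x (f^`(n.+1)%classic x).
Proof.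
by move=> sf; rewrite derive1nS derive1E; apply/derivableP; exact: sf.
Qed.

Lemma Ck_cst n (c : R) : Ck n (fun=> c).
Proof. by elim: n c => [//|n IH] c; exists (fun=> 0) => // x; exact: der_cst. Qed.

Lemma CkD n f g : Ck n f -> Ck n g -> Ck n (fun x => f x + g x).
Proof.
elim: n f g => [//|n IH] f g [f' ff cf] [g' gg cg].
by exists (fun x => f' x + g' x); [move=> x; exact: derD|exact: IH].
Qed.

Lemma CkM n f g : Ck n f -> Ck n g -> Ck n (fun x => f x * g x).
Proof.
elim: n f g => [//|n IH] f g hf hg.
have cf := CkS hf; have cg := CkS hg.
case: hf hg => [f' ff cf'] [g' gg cg'].
exists (fun x => f' x * g x + f x * g' x); first by move=> x; exact: derM.
by apply: CkD; exact: IH.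
Qed.

Lemma Ck_id n : Ck n (fun x => x : R).
Proof. by case: n => [//|n]; exists (fun=> 1); [exact: der_id|exact: Ck_cst]. Qed.

Lemma Ck_cos n (kap c : R) : Ck n (fun x => cos (kap + c * x)).
Proof.
elim: n kap => [//|n IH] kap.
exists (fun x => c * cos (kap + pi / 2 + c * x)).
  by move=> x; der; rewrite addrAC cosDpihalf; ring.
by apply: CkM; [exact: Ck_cst|exact: IH].
Qed.

Lemma Ck_affine n f (a b : R) : Ck n f -> Ck n (fun x => f (a * x + b)).
Proof.
elim: n f => [//|n IH] f [g fg cg].
exists (fun x => g (a * x + b) * a); last by apply: CkM; [exact: IH|exact: Ck_cst].
by move=> x; apply: (@der_comp R f (fun x => a * x + b)); [exact: fg|der => /=; ring].
Qed.

End SmoothClosure.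

(** * Nonstationary phase with growing amplitudes *)

Section Amplitude.
Context {R : realType} (al : R) (hal : `|al| <= 1).
Implicit Types (th y tau k a b c e kap : R).
Local Notation symb := (symb al).
Local Notation dsymb := (dsymb al).
Local Notation ddsymb := (ddsymb al).
Local Notation phase := (phase al).

(* The growth that one integration by parts in [k] can absorb: the phase has a
   derivative of order [k^3]. *)
Definition amplitude (A dA : R -> R) := forall k, 1 <= k ->
  [/\ has_derive A k (dA k), {for k, continuous dA}, `|A k| <= k & `|dA k| <= 2].

Lemma amplitude_cont A dA a b : amplitude A dA -> 1 <= a -> cont_on a b A.
Proof.
move=> hA a1 k /andP[ak _]; have [h _ _ _] := hA k (le_trans a1 ak).
exact: has_derive_continuous h.
Qed.

Lemma cont_amplitude_cos A dA th y tau a b : amplitude A dA -> 1 <= a ->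
  cont_on a b (fun k => A k * cos (phase th y tau k)).
Proof.
move=> hA a1 k kab; apply: cvgM; first exact: amplitude_cont hA a1 _ kab.
exact: has_derive_continuous (der_cosphase _ _ _ _ _).
Qed.

(** From [dsymb k >= 2 k^3] and [|y| <= tau a] the phase derivative is at least [tau k^3]. One
    integration by parts leaves at most [(14 + 2) tau^-1 k^-3], of integral at most [8 tau^-1 a^-2],
    and boundary terms of [tau^-1 a^-2] each. *)
Lemma nonstationary_le A dA th y tau a b : amplitude A dA -> 0 < tau ->
  1 <= a -> a <= b -> `|y| <= tau * a ->
  `|rint a b (fun k => A k * cos (phase th y tau k))| <= 11 / tau / a ^+ 2.
Proof.
move=> hA tau0 a1 ab ya.
have a0 : 0 < a by lra.
pose v k := y + tau * dsymb k.
pose dv k := tau * ddsymb k.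
pose ph := phase th y tau.
pose B k := A k * (v k)^-1 * sin (ph k).
pose dB k := (dA k * (v k)^-1 - A k * (dv k * v k ^- 2)) * sin (ph k)
  + A k * cos (ph k).
pose H k := - (8 / tau) * k ^- 2.
pose dH k := 16 / tau * k ^- 3.
have pos k : a <= k <= b -> 0 < k by move=> /andP[ak _]; lra.
have ge1 k : a <= k <= b -> 1 <= k by move=> /andP[ak _]; lra.
have vge k : a <= k <= b -> tau * k ^+ 3 <= v k.
  move=> akb; have k1 := ge1 _ akb; have /andP[ak _] := akb.
  have dk : 2 * k ^+ 3 <= dsymb k.
    rewrite /dsymb; move: hal; rewrite ler_norml => /andP[h1 h2].
    have k3 : k <= k ^+ 3 by nra.
    by nra.
  have k3 : k <= k ^+ 3 by nra.
  have h1 : tau * (2 * k ^+ 3) <= tau * dsymb k by rewrite ler_pM2l.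
  have h2 : tau * a <= tau * k ^+ 3 by rewrite ler_pM2l//; lra.
  move: ya; rewrite ler_norml => /andP[? ?]; rewrite /v; lra.
have vpos k : a <= k <= b -> 0 < v k.
  move=> akb; apply: lt_le_trans (vge _ akb).
  by rewrite mulr_gt0// exprn_gt0// pos.
have hv k : has_derive v k (dv k) by exact: der_dphase.
have hph k : has_derive ph k (v k) by exact: der_phase.
have hdv k : has_derive dv k (tau * (24 * k)).
  by rewrite /dv /ddsymb; der => //=; ring.
have hB k : a <= k <= b -> has_derive B k (dB k).
  move=> akb; have v0 := vpos _ akb; have [hAk _ _ _] := hA k (ge1 _ akb).
  rewrite /B; der; [|exact: hv|exact: hph|].
  - by rewrite gt_eqF.
  - by rewrite /dB/=; field; rewrite gt_eqF.
have hH k : a <= k <= b -> has_derive H k (dH k).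
  move=> akb; have k0 := pos _ akb.
  rewrite /H; der; first by rewrite expf_neq0// gt_eqF.
  by rewrite /dH/=; field; rewrite !gt_eqF.
have cB : cont_on a b dB.
  move=> k akb; have v0 := vpos _ akb; have [hAk cdA _ _] := hA k (ge1 _ akb).
  have cA := has_derive_continuous hAk.
  have cV : {for k, continuous (fun z => (v z)^-1)}.
    by cont_der; [rewrite gt_eqF|exact: hv].
  have cD : {for k, continuous (fun z => dv z * v z ^- 2)}.
    by cont_der; [exact: hdv|rewrite expf_neq0// gt_eqF|exact: hv].
  have cS : {for k, continuous (fun z => sin (ph z))}.
    by cont_der; exact: hph.
  have cC : {for k, continuous (fun z => cos (ph z))}.
    by cont_der; exact: hph.
  apply: cvgD; apply: cvgM => //.
  by apply: cvgB; apply: cvgM.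
have cH : cont_on a b dH.
  move=> k akb; have k0 := pos _ akb.
  by rewrite /dH; cont_der; rewrite expf_neq0// gt_eqF.
have vV k : a <= k <= b -> `|(v k)^-1| <= tau^-1 * k ^- 3.
  move=> akb; have k0 := pos _ akb; rewrite gtr0_norm ?invr_gt0 ?vpos// -invfM.
  by rewrite lef_pV2 ?posrE ?vpos ?vge// mulr_gt0// exprn_gt0.
have main : `|rint a b (fun k => A k * cos (ph k)) - (B b - B a)| <= H b - H a.
  apply: rint_compare hB hH _ => //; first exact: cont_amplitude_cos hA a1.
  move=> k akb; have k0 := pos _ akb; have k1 := ge1 _ akb.
  have [_ _ Ak dAk] := hA k k1.
  have -> : A k * cos (ph k) - dB k =
      (A k * (dv k * v k ^- 2) - dA k * (v k)^-1) * sin (ph k).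
    by rewrite /dB; ring.
  have -> : dH k = (k * (tau * (14 * k ^+ 2) * (tau^-1 * k ^- 3) ^+ 2)
      + 2 * (tau^-1 * k ^- 3)) * 1.
    by rewrite /dH; field; rewrite !gt_eqF.
  apply: normM_le; last exact: sin_max.
  apply: normB_le; apply: normM_le => //; last exact: vV.
  apply: normM_le.
    rewrite ger0_norm ?mulr_ge0 ?(ltW tau0)//.
      by rewrite ler_pM2l// ddsymb_le.
    by rewrite (le_trans _ (ddsymb_ge hal k1))// mulr_ge0 ?sqr_ge0.
  by rewrite normrV ?unitfE ?expf_neq0 ?gt_eqF ?vpos// normrX -exprVn -normfV lerXn2r// ?nnegrE ?vV// mulr_ge0 ?invr_ge0 ?exprn_ge0 ?ltW.
have Ble k : a <= k <= b -> `|B k| <= tau^-1 * a ^- 2.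
  move=> akb; have k0 := pos _ akb; have [_ _ Ak _] := hA k (ge1 _ akb).
  have /andP[ak _] := akb.
  rewrite /B -[leRHS]mulr1; apply: normM_le; last exact: sin_max.
  apply: (@le_trans _ _ (k * (tau^-1 * k ^- 3))).
    by apply: normM_le; [exact: Ak|exact: vV].
  have -> : k * (tau^-1 * k ^- 3) = tau^-1 * k ^- 2 by field; rewrite !gt_eqF.
  rewrite ler_pM2l ?invr_gt0// lef_pV2 ?posrE ?exprn_gt0//.
  by rewrite lerXn2r// nnegrE ltW.
have aab : a <= a <= b by rewrite lexx.
have bab : a <= b <= b by rewrite lexx ab.
have HH : H b - H a <= 8 * (tau^-1 * a ^- 2).
  have b0 : 0 < b by lra.
  have h1 : 0 < 8 / tau * b ^- 2 by rewrite mulr_gt0 ?divr_gt0 ?invr_gt0 ?exprn_gt0.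
  have -> : H b - H a = - (8 / tau * b ^- 2) + 8 * (tau^-1 * a ^- 2).
    by rewrite /H; ring.
  lra.
have -> : 11 / tau / a ^+ 2 = 11 * (tau^-1 * a ^- 2) by rewrite mulrA.
have q0 : 0 < tau^-1 * a ^- 2 by rewrite mulr_gt0 ?invr_gt0 ?exprn_gt0.
move: (Ble _ aab) (Ble _ bab) main q0 HH; rewrite -/ph.
move: (rint _ _ _) (tau^-1 * a ^- 2) (B a) (B b) (H b - H a) => I q Ba Bb Hd.
rewrite !ler_norml => /andP[? ?] /andP[? ?] /andP[? ?] ? ?.
by apply/andP; split; lra.
Qed.

(** Two separate shifts: [kap] advances by [pi / 2] with each derivative in [y], while [th] recedes
    by [pi / 2] in the terms that an integration by parts in [k] produces. *)
Definition gwave (A : R -> R) kap th tau a b y : R :=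
  rint a b (fun k => A k * cos (kap + y * k) * cos (th + tau * symb k)).

Lemma cont_symb_cos th tau a b :
  cont_on a b (fun k => cos (th + tau * symb k)).
Proof. by move=> k _; rewrite /symb; cont_der. Qed.

Lemma cont_lin_cos kap y a b : cont_on a b (fun k => cos (kap + y * k)).
Proof. by move=> k _; cont_der. Qed.

Lemma cont_gwave A kap th tau a b y : cont_on a b A ->
  cont_on a b (fun k => A k * cos (kap + y * k) * cos (th + tau * symb k)).
Proof.
move=> cA k kab; apply: cvgM; last exact: cont_symb_cos kab.
by apply: cvgM; [exact: cA|exact: cont_lin_cos kab].
Qed.

Lemma gwave_le A dA kap th tau a b y : amplitude A dA -> tau != 0 ->
  1 <= a -> a <= b -> `|y| <= `|tau| * a ->
  `|gwave A kap th tau a b y| <= 11 / `|tau| / a ^+ 2.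
Proof.
move=> hA; wlog tau0 : th tau / 0 < tau.
  move=> hw t0; have [h|h] := ltP 0 tau; first exact: hw.
  have {}h : 0 < - tau by rewrite oppr_gt0 lt_neqAle t0.
  have -> : gwave A kap th tau a b y = gwave A kap (- th) (- tau) a b y.
    by apply: eq_rint => k _; rewrite mulNr -opprD cosN.
  by rewrite -[`|tau|]normrN; apply: hw => //; rewrite oppr_eq0.
move=> _ a1 ab; rewrite (gtr0_norm tau0) => ya.
have -> : gwave A kap th tau a b y =
    2^-1 * (rint a b (fun k => A k * cos (phase (th + kap) y tau k))) +
    2^-1 * (rint a b (fun k => A k * cos (phase (th - kap) (- y) tau k))).
  have c1 : cont_on a b (fun k => A k * cos (phase (th + kap) y tau k)).
    exact: cont_amplitude_cos hA a1.
  have c2 : cont_on a b (fun k => A k * cos (phase (th - kap) (- y) tau k)).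
    exact: cont_amplitude_cos hA a1.
  rewrite -!rintZ// -rintD; last 2 first.
  - by move=> k kab; apply: cvgM; [exact: cvg_cst|exact: c1].
  - by move=> k kab; apply: cvgM; [exact: cvg_cst|exact: c2].
  apply: eq_rint => k _; rewrite /phase.
  have -> : th + kap + y * k + tau * symb k = (th + tau * symb k) + (kap + y * k) by ring.
  have -> : th - kap + - y * k + tau * symb k = (th + tau * symb k) - (kap + y * k) by ring.
  move: (th + _) (kap + _) (A k) => P Q u.
  by rewrite cosD cosB; field.
by apply: norm_half_sum; apply: nonstationary_le hA _ _ _ _; rewrite ?normrN.
Qed.

Definition gwn A kap th tau (N : nat) y : R := gwave A kap th tau 1 N.+1%:R y.
Definition glim A kap th tau y : R := limn (fun N => gwn A kap th tau N y).

(** Convergence is only locally uniform: for [|y| <= Y] the phase is known to be nonstationary once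
    the cut-off exceeds [Y / |tau|]. *)
Lemma glim_cvg A dA kap th tau : amplitude A dA -> tau != 0 ->
  (forall y, (fun N => gwn A kap th tau N y) @ \oo --> glim A kap th tau y) /\
  (forall Y e, 0 < e -> exists n0, forall n, (n0 <= n)%N -> forall y,
     `|y| <= Y -> `|glim A kap th tau y - gwn A kap th tau n y| <= e).
Proof.
move=> hA t0; have nt : 0 < `|tau| by rewrite normr_gt0.
have key Y : exists n0, forall y, `|y| <= Y -> forall N M, (n0 <= N)%N -> (N <= M)%N ->
    `|gwn A kap th tau M y - gwn A kap th tau N y| <= 11 / `|tau| / N.+1%:R.
  have [n0 hn0] : exists n0 : nat, Y / `|tau| <= n0%:R.
    exists (Num.Def.archi_bound (Y / `|tau|)).
    have [h|h] := leP 0 (Y / `|tau|); first exact/ltW/archi_boundP.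
    by rewrite (le_trans (ltW h)).
  exists n0 => y yY N M nN NM.
  have N1 : 1 <= N.+1%:R :> R by rewrite ler1n.
  have NM' : N.+1%:R <= M.+1%:R :> R by rewrite ler_nat.
  rewrite /gwn /gwave (@rint_split R N.+1%:R); last 2 first.
  - by rewrite N1.
  - by apply: cont_gwave; exact: amplitude_cont hA _.
  rewrite addrC addKr.
  apply: (le_trans (gwave_le kap th hA t0 N1 NM' _)).
    rewrite (le_trans yY)// mulrC -ler_pdivrMr// (le_trans hn0)// ler_nat.
    by rewrite (leq_trans nN).
  apply: ler_wpM2l; first by rewrite divr_ge0.
  rewrite lef_pV2 ?posrE ?exprn_gt0 ?ltr0n// expr2 ler_peMr// ler0n.
have cv Y : exists n0, forall y, `|y| <= Y ->
   (fun N => gwn A kap th tau N y) @ \oo --> glim A kap th tau y /\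
   forall N, (n0 <= N)%N ->
     `|glim A kap th tau y - gwn A kap th tau N y| <= 11 / `|tau| / N.+1%:R.
  have [n0 hn0] := key Y; exists n0 => y yY.
  (* The shift starts the sequence at the first index where the Cauchy estimate holds. *)
  pose u N := gwn A kap th tau (N + n0)%N y.
  have [||cu lu] := @cauchy_lim R u (fun N => 11 / `|tau| / (N + n0).+1%:R).
  - by move=> N M NM; apply: hn0; rewrite ?leq_addl// leq_add2r.
  - by rewrite (cvg_shiftn n0 (fun N => 11 / `|tau| / N.+1%:R)); exact: cvg_invSn.
  have cg : (fun N => gwn A kap th tau N y) @ \oo --> limn u.
    by rewrite -(cvg_shiftn n0).
  have gE : glim A kap th tau y = limn u by exact: cvg_lim cg.
  split; first by rewrite gE.
  by move=> N nN; rewrite gE; have := lu (N - n0)%N; rewrite /u subnK.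
split=> [y|Y e e0]; first by have [n0 /(_ y (lexx _))[]] := cv `|y|.
have [n0 hn0] := cv Y; have [N hN] := ex_invSn_lt (11 / `|tau|) e0.
exists (maxn n0 N) => n; rewrite geq_max => /andP[nn Nn] y yY.
have [_ /(_ n nn) /le_trans] := hn0 _ yY; apply.
apply: le_trans (ltW hN); apply: ler_wpM2l; first by rewrite divr_ge0.
by rewrite lef_pV2 ?posrE ?ltr0n// ler_nat.
Qed.

Lemma der_gwave A kap th tau a b y : cont_on a b A ->
  has_derive (gwave A kap th tau a b) y
    (gwave (fun k => A k * k) (kap + pi / 2) th tau a b y).
Proof.
move=> cA.
have := @rint_param_derive R a b (fun k => A k * cos (th + tau * symb k)) id
  (fun=> kap) y.
have -> : (fun y => rint a b (fun k => A k * cos (th + tau * symb k) *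
    cos (kap + y * id k))) = gwave A kap th tau a b.
  by apply/funext => z; apply: eq_rint => k _ /=; ring.
have -> : rint a b (fun k => A k * cos (th + tau * symb k) * id k *
    cos (kap + pi / 2 + y * id k)) =
    gwave (fun k => A k * k) (kap + pi / 2) th tau a b y.
  by apply: eq_rint => k _ /=; ring.
apply.
- by move=> k kab; apply: cvgM; [exact: cA|exact: cont_symb_cos kab].
- by move=> k _; exact: cvg_id.
- by move=> k _; exact: cvg_cst.
Qed.

End Amplitude.

Section Smoothness.
Context {R : realType} (al : R) (hal : `|al| <= 1).
Implicit Types (th y tau k a b c e kap : R).
Local Notation symb := (symb al).
Local Notation dsymb := (dsymb al).
Local Notation gwn := (gwn al).
Local Notation glim := (glim al).

(* Differentiating in [y] raises the power of [k] by one. The power [k^2] is out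
   of reach of one integration by parts, but [gwn_reduction] brings it back to
   lower ones, so these four amplitudes are closed under differentiation. *)
Let A1 k : R := k.
Let A0 k : R := 1.
Let B1 k : R := k^-1.
Let B2 k : R := k ^- 2.

Lemma amplitude1 : amplitude A1 (fun=> 1).
Proof.
move=> k k1; split; rewrite /A1 ?normr1 ?ler1n//.
- exact: der_id.
- exact: cvg_cst.
- by rewrite ger0_norm//; lra.
Qed.

Lemma amplitude0 : amplitude A0 (fun=> 0).
Proof.
move=> k k1; split; rewrite /A0 ?normr1 ?normr0//.
- exact: der_cst.
- exact: cvg_cst.
Qed.

Lemma amplitudeV1 : amplitude B1 (fun k => - k ^- 2).
Proof.
move=> k k1; have k0 : 0 < k by lra.
have ki : k^-1 <= 1 by rewrite invf_le1.
split; rewrite /B1.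
- by der; [rewrite gt_eqF|move=> /=; ring].
- by cont_der; rewrite expf_neq0// gt_eqF.
- by rewrite gtr0_norm ?invr_gt0//; lra.
- rewrite normrN gtr0_norm ?invr_gt0 ?exprn_gt0// -exprVn.
  by have : k^-1 ^+ 2 <= 1 by [rewrite exprn_ile1// invr_ge0 ltW]; lra.
Qed.

Lemma amplitudeV2 : amplitude B2 (fun k => - 2 * k ^- 3).
Proof.
move=> k k1; have k0 : 0 < k by lra.
have ki : k^-1 <= 1 by rewrite invf_le1.
split; rewrite /B2.
- by der; [rewrite expf_neq0// gt_eqF|move=> /=; field; rewrite gt_eqF].
- by cont_der; rewrite expf_neq0// gt_eqF.
- rewrite gtr0_norm ?invr_gt0 ?exprn_gt0// -exprVn.
  by have : k^-1 ^+ 2 <= 1 by [rewrite exprn_ile1// invr_ge0 ltW]; lra.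
- rewrite normrM normrN (ger0_norm (_ : 0 <= 2))// gtr0_norm ?invr_gt0 ?exprn_gt0//.
  rewrite -exprVn.
  by have : k^-1 ^+ 3 <= 1 by [rewrite exprn_ile1// invr_ge0 ltW]; lra.
Qed.

Lemma gwn_der A dA kap th tau N y : amplitude A dA ->
  has_derive (gwn A kap th tau N) y (gwn (fun k => A k * k) (kap + pi / 2) th tau N y).
Proof. by move=> hA; apply: der_gwave; exact: amplitude_cont hA _. Qed.

Lemma glim_der A dA A' dA' kap th tau : amplitude A dA -> amplitude A' dA' ->
  (forall k, 1 <= k -> A k * k = A' k) -> tau != 0 ->
  forall y, has_derive (glim A kap th tau) y (glim A' (kap + pi / 2) th tau y).
Proof.
move=> hA hA' AA' t0; have [cA _] := glim_cvg hal kap th hA t0.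
have [_ cA'] := glim_cvg hal (kap + pi / 2) th hA' t0.
apply: (@has_derive_lim R (gwn A kap th tau) (gwn A' (kap + pi / 2) th tau)).
- move=> N y.
  have -> : gwn A' (kap + pi / 2) th tau N y = gwn (fun k => A k * k) (kap + pi / 2) th tau N y.
    by apply: eq_rint => k /andP[k1 _]; rewrite AA'.
  exact: gwn_der hA.
- by move=> y; exact: cA.
- exact: cA'.
Qed.

Lemma rint_lin4 a b (g1 g2 g3 g4 : R -> R) (c1 c2 c3 c4 : R) :
  cont_on a b g1 -> cont_on a b g2 -> cont_on a b g3 -> cont_on a b g4 ->
  cont_on a b (fun k => c1 * g1 k + c2 * g2 k + (c3 * g3 k + c4 * g4 k)) /\
  rint a b (fun k => c1 * g1 k + c2 * g2 k + (c3 * g3 k + c4 * g4 k)) =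
  c1 * rint a b g1 + c2 * rint a b g2 + (c3 * rint a b g3 + c4 * rint a b g4).
Proof.
move=> h1 h2 h3 h4.
have hc (u : R) (g : R -> R) : cont_on a b g -> cont_on a b (fun k => u * g k).
  by move=> cg k kb; apply: cvgM; [exact: cvg_cst|exact: cg].
have hD (g h : R -> R) : cont_on a b g -> cont_on a b h ->
    cont_on a b (fun k => g k + h k).
  by move=> cg ch k kb; apply: cvgD; [exact: cg|exact: ch].
have k1 := hc c1 _ h1; have k2 := hc c2 _ h2.
have k3 := hc c3 _ h3; have k4 := hc c4 _ h4.
have k12 := hD _ _ k1 k2; have k34 := hD _ _ k3 k4.
split; first exact: hD k12 k34.
by rewrite (rintD k12 k34) (rintD k1 k2) (rintD k3 k4) !rintZ.
Qed.

(* d/dk [cos(kap + y k) sin(th + tau symb k) / k], integrated: since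
   k (1/k)' = - 1/k, this expresses the amplitude k^2 through the lower ones. *)
Lemma gwn_reduction kap th tau N y : tau != 0 ->
  gwn (fun k => k ^+ 2) kap th tau N y =
  (4 * tau)^-1 * (
    (N.+1%:R^-1 * cos (kap + y * N.+1%:R) * cos (th - pi / 2 + tau * symb N.+1%:R)
     - cos (kap + y) * cos (th - pi / 2 + tau * symb 1))
    + gwn B2 kap (th - pi / 2) tau N y
    - y * gwn B1 (kap + pi / 2) (th - pi / 2) tau N y)
  - al / 2 * gwn A0 kap th tau N y.
Proof.
move=> t0; set b : R := N.+1%:R.
have b1 : 1 <= b by rewrite ler1n.
pose F k := k^-1 * cos (kap + y * k) * cos (th - pi / 2 + tau * symb k).
pose f k := -1 * (B2 k * cos (kap + y * k) * cos (th - pi / 2 + tau * symb k))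
  + y * (B1 k * cos (kap + pi / 2 + y * k) * cos (th - pi / 2 + tau * symb k))
  + (4 * tau * (k ^+ 2 * cos (kap + y * k) * cos (th + tau * symb k))
  + 2 * tau * al * (A0 k * cos (kap + y * k) * cos (th + tau * symb k))).
have cE z : cos (th + z) = - sin (th - pi / 2 + z).
  by rewrite -cosDpihalf; congr cos; ring.
have hF k : 1 <= k <= b -> has_derive F k (f k).
  move=> /andP[k1 _]; have k0 : 0 < k by lra.
  rewrite /F; der; [|exact: der_symb|].
    by rewrite gt_eqF.
  rewrite /f cE (addrAC kap) cosDpihalf /B1 /B2 /A0 /dsymb /=.
  by move: (cos _) (cos _) (sin _) (sin _) => ? ? ? ?; field; rewrite gt_eqF.
have c2 : cont_on 1 b (fun k => B2 k * cos (kap + y * k) * cos (th - pi / 2 + tau * symb k)).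
  by apply: cont_gwave; exact: amplitude_cont amplitudeV2 _.
have c1 : cont_on 1 b (fun k => B1 k * cos (kap + pi / 2 + y * k) * cos (th - pi / 2 + tau * symb k)).
  by apply: cont_gwave; exact: amplitude_cont amplitudeV1 _.
have c0 : cont_on 1 b (fun k => A0 k * cos (kap + y * k) * cos (th + tau * symb k)).
  by apply: cont_gwave; exact: amplitude_cont amplitude0 _.
have cs : cont_on 1 b (fun k => k ^+ 2 * cos (kap + y * k) * cos (th + tau * symb k)).
  by apply: cont_gwave => k _; cont_der.
have [cf fE] := rint_lin4 (-1) y (4 * tau) (2 * tau * al) c2 c1 cs c0.
have := rint_FTC b1 cf hF.
rewrite fE /F invr1 !mul1r !mulr1.
rewrite -/(gwave al B2 _ _ _ _ _ _) -/(gwave al B1 _ _ _ _ _ _).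
rewrite -/(gwave al A0 _ _ _ _ _ _) -/(gwave al (fun k => k ^+ 2) _ _ _ _ _ _).
rewrite /gwn -/b.
move: (gwave _ B2 _ _ _ _ _ _) (gwave _ B1 _ _ _ _ _ _) (gwave _ A0 _ _ _ _ _ _).
move: (gwave _ _ _ _ _ _ _ _) (cos _) (cos _) (cos _) (cos _) b^-1.
move=> g3 x1 x2 x3 x4 x5 g1 g2 g4 h.
by rewrite -h; field.
Qed.

(** The boundary term at [k = 1], which survives the limit; the one at the upper end carries a
    factor [b^-1] and vanishes. *)
Definition low_frequency kap th tau y : R :=
  - (cos (kap + y) * cos (th - pi / 2 + tau * symb 1)).

(** The derivative of the truncations has amplitude [k^2], whose convergence is not known
    beforehand: the reduction formula both proves it, locally uniformly in [y], and names the
    limit. *)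
Lemma glim_reduction kap th tau : tau != 0 -> forall y,
  has_derive (glim A1 kap th tau) y
    ((4 * tau)^-1 * (low_frequency (kap + pi / 2) th tau y
      + glim B2 (kap + pi / 2) (th - pi / 2) tau y
      - y * glim B1 (kap + pi / 2 + pi / 2) (th - pi / 2) tau y)
    - al / 2 * glim A0 (kap + pi / 2) th tau y).
Proof.
move=> t0.
have [cA1 _] := glim_cvg hal kap th amplitude1 t0.
have [_ u2] := glim_cvg hal (kap + pi / 2) (th - pi / 2) amplitudeV2 t0.
have [_ u1] := glim_cvg hal (kap + pi / 2 + pi / 2) (th - pi / 2) amplitudeV1 t0.
have [_ u0] := glim_cvg hal (kap + pi / 2) th amplitude0 t0.
apply: (@has_derive_lim R (gwn A1 kap th tau)
  (gwn (fun k => k ^+ 2) (kap + pi / 2) th tau)) => //.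
  move=> N y; have := gwn_der kap th tau N y amplitude1.
  by congr has_derive; apply: eq_rint => k _; rewrite /A1 expr2.
move=> Y e e0.
have nt : 0 < `|tau| by rewrite normr_gt0.
pose C : R := `|4 * tau|^-1 * (2 + `|Y|) + `|al / 2|.
have C0 : 0 <= C by rewrite addr_ge0// mulr_ge0 ?invr_ge0// addr_ge0.
pose d := e / (C + 1).
have C1 : 0 < C + 1 by lra.
have d0 : 0 < d by rewrite divr_gt0.
have [n2 h2] := u2 Y d d0; have [n1 h1] := u1 Y d d0; have [n0 h0] := u0 Y d d0.
have [n3 h3] := @ex_invSn_lt R 1 d d0.
exists (maxn (maxn n0 n1) (maxn n2 n3)) => n.
rewrite !geq_max => /andP[/andP[m0 m1] /andP[m2 m3]] y yY.
move: (h2 n m2 y yY) (h1 n m1 y yY) (h0 n m0 y yY) => {h0 h1 h2} h2 h1 h0.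
have h3' : `|n.+1%:R^-1 * cos (kap + pi / 2 + y * n.+1%:R) *
    cos (th - pi / 2 + tau * symb n.+1%:R)| <= d.
  rewrite -[leRHS]mulr1; apply: normM_le; last exact: cos_max.
  rewrite -[leRHS]mulr1; apply: normM_le; last exact: cos_max.
  rewrite gtr0_norm ?invr_gt0 ?ltr0n//; apply: le_trans (ltW h3).
  by rewrite div1r lef_pV2 ?posrE ?ltr0n// ler_nat.
rewrite gwn_reduction// /low_frequency.
move: h0 h1 h2 h3'.
move: (gwn B2 _ _ _ _ _) (gwn B1 _ _ _ _ _) (gwn A0 _ _ _ _ _) => g2 g1 g0.
move: (glim B2 _ _ _ _) (glim B1 _ _ _ _) (glim A0 _ _ _ _) => l2 l1 l0.
move: (n.+1%:R^-1 * _ * _) (cos _ * cos _) => bd low h0 h1 h2 h3'.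
have -> : (4 * tau)^-1 * (- low + l2 - y * l1) - al / 2 * l0 -
   ((4 * tau)^-1 * (bd - low + g2 - y * g1) - al / 2 * g0) =
   (4 * tau)^-1 * (((l2 - g2) - bd) - y * (l1 - g1)) - al / 2 * (l0 - g0).
  by ring.
have : C * d <= e.
  rewrite /d mulrA ler_pdivrMr// mulrDr mulr1 [C * e]mulrC.
  by rewrite lerDl ltW.
apply: le_trans.
have -> : C * d = `|4 * tau|^-1 * (d + d + `|Y| * d) + `|al / 2| * d.
  by rewrite /C; ring.
apply: normB_le; apply: normM_le => //; first by rewrite normfV.
apply: normB_le; first exact: normB_le.
by apply: normM_le => //; rewrite (le_trans yY)// ler_norm.
Qed.

(** The induction runs over all four amplitudes and all shifts at once: differentiation leads from
    [B2] to [B1], [A0] and [A1], and from [A1] back to [B2], [B1] and [A0]. *)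
Lemma glim_Ck tau n : tau != 0 -> forall kap th,
  [/\ Ck n (glim A1 kap th tau), Ck n (glim A0 kap th tau),
      Ck n (glim B1 kap th tau) & Ck n (glim B2 kap th tau)].
Proof.
move=> t0; elim: n => [//|n IH] kap th.
have [c1 c0 cV1 cV2] := IH (kap + pi / 2) th.
have [_ _ _ dV2] := IH (kap + pi / 2) (th - pi / 2).
have [_ _ dV1 _] := IH (kap + pi / 2 + pi / 2) (th - pi / 2).
split.
- eexists; first exact: glim_reduction.
  apply: CkD; last first.
    have -> : (fun x => - (al / 2 * glim A0 (kap + pi / 2) th tau x)) =
        (fun x => - (al / 2) * glim A0 (kap + pi / 2) th tau x).
      by apply/funext => x; rewrite mulNr.
    by apply: CkM => //; exact: Ck_cst.
  apply: CkM; first exact: Ck_cst.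
  apply: CkD; last first.
    have -> : (fun x => - (x * glim B1 (kap + pi / 2 + pi / 2) (th - pi / 2) tau x)) =
        (fun x => -1 * (x * glim B1 (kap + pi / 2 + pi / 2) (th - pi / 2) tau x)).
      by apply/funext => x; rewrite mulN1r.
    by apply: CkM; [exact: Ck_cst|apply: CkM => //; exact: Ck_id].
  apply: CkD => //.
  have -> : low_frequency (kap + pi / 2) th tau =
      (fun y => - cos (th - pi / 2 + tau * symb 1) * cos (kap + pi / 2 + 1 * y)).
    by apply/funext => y; rewrite /low_frequency mul1r mulNr mulrC.
  by apply: CkM; [exact: Ck_cst|exact: Ck_cos].
- exists (glim A1 (kap + pi / 2) th tau) => //.
  by apply: (glim_der _ _ amplitude0 amplitude1) => // k _; rewrite /A0 mul1r.
- exists (glim A0 (kap + pi / 2) th tau) => //.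
  apply: (glim_der _ _ amplitudeV1 amplitude0) => // k k1.
  by rewrite /B1 mulVf// gt_eqF//; lra.
- exists (glim B1 (kap + pi / 2) th tau) => //.
  apply: (glim_der _ _ amplitudeV2 amplitudeV1) => // k k1.
  by rewrite /B1 /B2; field; rewrite gt_eqF//; lra.
Qed.

Lemma W_Ck th tau n : tau != 0 -> Ck n (W al th tau).
Proof.
move=> t0; have [_ _ h _] := glim_Ck n t0 0 th; move: h.
congr (Ck n _); apply/funext => y; rewrite /W (negbTE t0)/=.
rewrite /glim.
have -> // : (fun N => gwn B1 0 th tau N y) = (fun N => Wn al N th tau y).
apply/funext => N; rewrite /gwn /Wn /wave /gwave; apply: eq_rint => k _.
by rewrite add0r.
Qed.

End Smoothness.

(** * Plancherel inequality *)

Section RealFubini.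
Context {R : realType}.

Lemma integrable_mul_bounded d (T : measurableType d)
    (mu : {measure set T -> \bar R}) (D : set T) (h k : T -> R) (C : R) :
  measurable D ->
  mu.-integrable D (EFin \o h) -> measurable_fun D k ->
  (forall x, D x -> `|k x| <= C) ->
  mu.-integrable D (EFin \o (fun x => h x * k x)).
Proof.
move=> mD ih mk kC.
have -> : EFin \o (fun x => h x * k x) = ((EFin \o k) \* (EFin \o h))%E.
  by apply/funext => x /=; rewrite EFinM muleC.
apply: integrableMr => //.
exists C; split; first exact: num_real.
by move=> z /ltW Cz x Dx; rewrite /= (le_trans (kC x Dx)).
Qed.

Lemma integral_norm_fin d (T : measurableType d)
    (mu : {measure set T -> \bar R}) (u : T -> R) :
  mu.-integrable setT (EFin \o u) ->
  exists2 c : R, 0 <= c & (\int[mu]_y `|u y|%:E = c%:E)%E.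
Proof.
move=> iu; have := integrable_fin_num measurableT (integrable_norm iu).
move=> /fineK <-; exists (fine (\int[mu]_y `|u y|%:E)%E) => //.
by apply: fine_ge0; apply: integral_ge0 => y _; rewrite lee_fin.
Qed.

Context d1 d2 (T1 : measurableType d1) (T2 : measurableType d2).
Variable m1 : {sigma_finite_measure set T1 -> \bar R}.
Variable m2 : {sigma_finite_measure set T2 -> \bar R}.
Implicit Types (g : T1 -> R) (h : T2 -> R).

(** With two integrable factors and a bounded kernel, joint integrability follows by Tonelli from
    [C |g(x)| |h(y)|]. *)
Lemma RfubiniT g h (k : T1 * T2 -> R) (C : R) : 0 <= C ->
  m1.-integrable setT (EFin \o g) -> m2.-integrable setT (EFin \o h) ->
  measurable_fun setT k -> (forall z, `|k z| <= C) ->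
  \int[m1]_x (g x * \int[m2]_y (h y * k (x, y))) =
  \int[m2]_y (h y * \int[m1]_x (g x * k (x, y))).
Proof.
move=> C0 ig ih mk kC.
pose f (z : T1 * T2) := (g z.1 * h z.2 * k z)%:E.
have mg : measurable_fun setT g by apply/measurable_EFinP; exact: measurable_int ig.
have mh : measurable_fun setT h by apply/measurable_EFinP; exact: measurable_int ih.
have mf : measurable_fun setT f.
  apply/measurable_EFinP; apply: measurable_funM => //.
  by apply: measurable_funM; exact: measurableT_comp.
have mk1 x : measurable_fun setT (fun y => k (x, y)).
  by apply: measurableT_comp => //; exact: pair1_measurable.
have mk2 y : measurable_fun setT (fun x => k (x, y)).
  by apply: measurableT_comp => //; exact: pair2_measurable.
have ih1 x : m2.-integrable setT (EFin \o (fun y => h y * k (x, y))).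
  by apply: (integrable_mul_bounded _ ih (mk1 x)) => // y _; exact: kC.
have ig1 y : m1.-integrable setT (EFin \o (fun x => g x * k (x, y))).
  by apply: (integrable_mul_bounded _ ig (mk2 y)) => // x _; exact: kC.
have if_ : (m1 \x m2)%E.-integrable setT f.
  apply/integrable12ltyP => //.
  apply: (@le_lt_trans _ _ (\int[m1]_x \int[m2]_y ((C * `|g x| * `|h y|)%:E))%E).
    apply: ge0_le_integral => //=.
    - by move=> x _; apply: integral_ge0.
    - apply: (measurable_fun_fubini_tonelli_F (abse \o f)) => //=.
      exact: measurableT_comp.
    - pose f2 (z : T1 * T2) := (C * `|g z.1| * `|h z.2|)%:E.
      apply: (measurable_fun_fubini_tonelli_F f2) => //=.
        apply/measurable_EFinP; apply: measurable_funM.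
          apply: measurable_funM => //; apply: measurableT_comp => //.
          exact: measurableT_comp.
        apply: measurableT_comp => //.
        exact: measurableT_comp.
      by move=> z; rewrite lee_fin !mulr_ge0.
    - move=> x _; apply: ge0_le_integral => //=.
      + apply/measurable_EFinP; apply: measurableT_comp => //.
        by apply: measurable_funM => //; exact: measurable_funM.
      + apply/measurable_EFinP; apply: measurable_funM => //.
        exact: measurableT_comp.
      + move=> y _; rewrite lee_fin 2!normrM mulrC -mulrA.
        by rewrite ler_wpM2r ?mulr_ge0// kC.
  have [ch ch0 hE] := integral_norm_fin ih; have [cg cg0 gE] := integral_norm_fin ig.
  under eq_integral => x _.
    under eq_integral do rewrite EFinM.
    rewrite ge0_integralZl//; last 2 first.
    - by apply: measurableT_comp => //; exact: measurableT_comp.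
    - by rewrite lee_fin mulr_ge0.
    rewrite hE -EFinM mulrAC EFinM.
    over.
  rewrite ge0_integralZl//; last 2 first.
  - by apply: measurableT_comp => //; exact: measurableT_comp.
  - by rewrite lee_fin mulr_ge0.
  by rewrite gE -EFinM ltry.
have := Fubini if_; rewrite /f /=.
have -> : (fun x => (\int[m2]_y (g x * h y * k (x, y))%:E)%E) =
    (fun x => (g x * \int[m2]_y (h y * k (x, y)))%:E).
  apply/funext => x; under eq_integral do rewrite -mulrA EFinM.
  rewrite integralZl; [|by []|exact: (ih1 x)].
  by rewrite EFinM /Rintegral fineK//; exact: integrable_fin_num (ih1 x).
have -> : (fun y => (\int[m1]_x (g x * h y * k (x, y))%:E)%E) =
    (fun y => (h y * \int[m1]_x (g x * k (x, y)))%:E).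
  apply/funext => y; under eq_integral do rewrite [g _ * _]mulrC -mulrA EFinM.
  rewrite integralZl; [|by []|exact: (ig1 y)].
  by rewrite EFinM /Rintegral fineK//; exact: integrable_fin_num (ig1 y).
by move=> E; rewrite /Rintegral E.
Qed.

Lemma Rfubini (D : set T1) (E : set T2) g h (k : T1 * T2 -> R) (C : R) :
  0 <= C ->
  measurable D -> measurable E ->
  m1.-integrable D (EFin \o g) -> m2.-integrable E (EFin \o h) ->
  measurable_fun setT k -> (forall z, `|k z| <= C) ->
  \int[m1]_(x in D) (g x * \int[m2]_(y in E) (h y * k (x, y))) =
  \int[m2]_(y in E) (h y * \int[m1]_(x in D) (g x * k (x, y))).
Proof.
move=> C0 mD mE ig ih mk kC.
have ig' : m1.-integrable setT (EFin \o (g \_ D)).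
  by rewrite -restrict_EFin; exact: (integrable_mkcond _ mD).1 ig.
have ih' : m2.-integrable setT (EFin \o (h \_ E)).
  by rewrite -restrict_EFin; exact: (integrable_mkcond _ mE).1 ih.
have patchM T (A : set T) (u v : T -> R) : (fun x => u x * v x) \_ A = (fun x => (u \_ A) x * v x).
  by apply/funext => x; rewrite !patchE; case: ifPn => //; rewrite mul0r.
rewrite Rintegral_mkcond [RHS]Rintegral_mkcond !patchM.
under eq_Rintegral do rewrite Rintegral_mkcond patchM.
under [RHS]eq_Rintegral do rewrite Rintegral_mkcond patchM.
exact: RfubiniT C0 ig' ih' mk kC.
Qed.

End RealFubini.

Lemma rint_fubini (R : realType) (a b c d : R) (g h : R -> R)
    (k : measurableTypeR R * measurableTypeR R -> R) (C : R) :
  cont_on a b g -> cont_on c d h -> 0 <= C ->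
  measurable_fun setT k -> (forall z, `|k z| <= C) ->
  rint a b (fun x => g x * rint c d (fun y => h y * k (x, y))) =
  rint c d (fun y => h y * rint a b (fun x => g x * k (x, y))).
Proof.
move=> cg ch C0 mk kC.
by apply: Rfubini C0 _ _ _ _ mk kC => //; exact: cont_on_integrable.
Qed.

(** * The Fejer kernel and the Plancherel inequality on segments *)

Section Plancherel.
Context {R : realType}.
Implicit Types (a b x y z L X : R) (g h : R -> R).

Definition fejer L z : R := rint 0 L (fun x => (1 - x / L) * cos (z * x)).

Lemma cont_fejer L z a b : cont_on a b (fun x => (1 - x / L) * cos (z * x)).
Proof. by move=> x _; cont_der. Qed.

Lemma fejerE L z : 0 < L -> z != 0 -> fejer L z = (1 - cos (L * z)) / (L * z ^+ 2).
Proof.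
move=> L0 z0; have Ln : L != 0 by rewrite gt_eqF.
rewrite /fejer (@rint_FTC _ (fun x => (1 - x / L) * (sin (z * x) / z) -
  cos (z * x) / (L * z ^+ 2)) 0 L _ (ltW L0)); last 2 first.
- exact: cont_fejer.
- by move=> x _; der => /=; field; rewrite ?z0 ?Ln.
rewrite mulr0 sin0 cos0 [z * L]mulrC; move: (cos _) (sin _) => u v.
by field; rewrite Ln z0.
Qed.

Lemma fejer_at0 L : 0 < L -> fejer L 0 = L / 2.
Proof.
move=> L0; rewrite /fejer (@rint_FTC _ (fun x => x - x ^+ 2 / (2 * L)) 0 L).
- by field; rewrite gt_eqF.
- exact: ltW.
- exact: cont_fejer.
- by move=> x _; der => /=; rewrite mul0r cos0; field; rewrite gt_eqF.
Qed.

Lemma fejer_ge0 L z : 0 < L -> 0 <= fejer L z.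
Proof.
move=> L0; have [->|z0] := eqVneq z 0; first by rewrite fejer_at0// divr_ge0// ltW.
rewrite fejerE//; apply: divr_ge0; first by rewrite subr_ge0 cos_le1.
by rewrite mulr_ge0 ?sqr_ge0// ltW.
Qed.

(** With [v = (L z)^2], [1 - cos (L z)] is at most [v / 2] and at most 2, so its product with
    [1 + v] is at most [5 v / 2]. The majorant has an arctangent as primitive. *)
Lemma fejer_le L z : 0 < L -> fejer L z <= 3 * L / (1 + (L * z) ^+ 2).
Proof.
move=> L0; have D0 : 0 < 1 + (L * z) ^+ 2 by rewrite ltr_pwDl ?sqr_ge0.
have [->|z0] := eqVneq z 0.
  by rewrite fejer_at0// mulr0 expr0n addr0 divr1; lra.
have z2 : 0 < z ^+ 2 by rewrite lt_neqAle sqr_ge0 andbT eq_sym sqrf_eq0.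
have Lz : 0 < L * z ^+ 2 by rewrite mulr_gt0.
rewrite fejerE// ler_pdivlMr// mulrAC ler_pdivrMr//.
have h1 := onem_cos_le (L * z); have h2 := cos_geN1 (L * z).
have v0 : 0 < (L * z) ^+ 2 by rewrite exprMn mulr_gt0// exprn_gt0.
have -> : 3 * L * (L * z ^+ 2) = 3 * (L * z) ^+ 2 by ring.
move: h1 h2 v0; move: ((L * z) ^+ 2) (cos _) => v c h1 h2 v0.
by rewrite mulrDr mulr1; nra.
Qed.

Lemma fejer_lipschitz L z z' : 0 < L ->
  `|fejer L z - fejer L z'| <= L ^+ 2 * `|z - z'|.
Proof.
move=> L0; rewrite /fejer -rintB; try exact: cont_fejer.
have -> : L ^+ 2 * `|z - z'| = rint 0 L (fun=> L * `|z - z'|).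
  by rewrite rint_cst ?(ltW L0)//; ring.
apply: norm_rint_le.
- by move=> x xL; apply: cvgB; apply: cont_fejer xL.
- by move=> x _; exact: cvg_cst.
- move=> x /andP[x0 xL]; rewrite -mulrBr -[leRHS]mul1r; apply: normM_le.
    have h : 0 <= x / L <= 1 by rewrite divr_ge0 ?(ltW L0)// ler_pdivrMr// mul1r.
    by move: h => /andP[? ?]; rewrite ger0_norm; lra.
  rewrite (le_trans (cos_lipschitz _ _))// -mulrBl normrM mulrC (ger0_norm x0).
  by rewrite ler_wpM2r.
Qed.

Lemma lipschitz_continuous (f : R -> R) (C : R) x :
  (forall y, `|f x - f y| <= C * `|x - y|) -> {for x, continuous f}.
Proof.
move=> hC; apply/cvgrPdist_le => e e0.
have C1 : 0 < `|C| + 1 by rewrite ltr_wpDl.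
exists (e / (`|C| + 1)); first by rewrite /= divr_gt0.
move=> y; rewrite /ball/= => hxy; apply: (le_trans (hC y)).
apply: (@le_trans _ _ ((`|C| + 1) * `|x - y|)).
  by rewrite ler_wpM2r// (le_trans (ler_norm _))// lerDl.
by rewrite mulrC -ler_pdivlMr// ltW.
Qed.

Lemma measurable_fejer L : 0 < L -> measurable_fun setT (fejer L).
Proof.
move=> L0; apply: continuous_measurable_fun => x.
by apply: (@lipschitz_continuous _ (L ^+ 2)) => y; exact: fejer_lipschitz.
Qed.

(** The weighted integral of [cos (u x) cos (u y)] over [u] in [[0, L]], after the product has been
    turned into a sum. *)
Definition cos_kernel L (z : measurableTypeR R * measurableTypeR R) : R :=
  2^-1 * fejer L (z.1 - z.2) + 2^-1 * fejer L (z.1 + z.2).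

Lemma cos_kernel_ge0 L (z : measurableTypeR R * measurableTypeR R) : 0 < L -> 0 <= cos_kernel L z.
Proof. by move=> L0; rewrite addr_ge0// mulr_ge0// fejer_ge0. Qed.

Lemma cos_kernelC L x y : cos_kernel L (x, y) = cos_kernel L (y, x).
Proof.
rewrite /cos_kernel/= [y + x]addrC; congr (_ * _ + _).
by apply: eq_rint => u _; rewrite -[x - y]opprB mulNr cosN.
Qed.

Lemma cos_kernelE L x y : rint 0 L (fun u => (1 - u / L) * cos (u * x) * cos (u * y))
  = cos_kernel L (x, y).
Proof.
rewrite /cos_kernel/fejer/= -!rintZ; try exact: cont_fejer.
rewrite -rintD; last 2 first.
- by move=> u _; cont_der.
- by move=> u _; cont_der.
apply: eq_rint => u _.
have -> : (x - y) * u = u * x - u * y by ring.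
have -> : (x + y) * u = u * x + u * y by ring.
by rewrite cosB cosD; move: (1 - _) (cos _) (cos _) (sin _) (sin _) => *; field.
Qed.

Lemma fejer_bound L z : 0 < L -> `|fejer L z| <= 3 * L.
Proof.
move=> L0; rewrite ger0_norm ?fejer_ge0// (le_trans (fejer_le z L0))//.
rewrite ler_pdivrMr ?ltr_pwDl ?sqr_ge0// ler_peMr ?mulr_ge0 ?(ltW L0)//.
by rewrite lerDl sqr_ge0.
Qed.

Lemma cos_kernel_bound L (z : measurableTypeR R * measurableTypeR R) : 0 < L -> `|cos_kernel L z| <= 3 * L.
Proof. by move=> L0; apply: norm_half_sum; exact: fejer_bound. Qed.

Lemma measurable_cos_kernel L : 0 < L -> measurable_fun setT (cos_kernel L).
Proof.
move=> L0; have mf := measurable_fejer L0.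
apply: measurable_funD; apply: measurable_funM => //.
  apply: (measurableT_comp mf); exact: measurable_funB.
apply: (measurableT_comp mf); exact: measurable_funD.
Qed.

Lemma cos_kernel_lipschitz L x x' y : 0 < L ->
  `|cos_kernel L (x, y) - cos_kernel L (x', y)| <= L ^+ 2 * `|x - x'|.
Proof.
move=> L0; rewrite /cos_kernel/=.
have -> : 2^-1 * fejer L (x - y) + 2^-1 * fejer L (x + y) -
  (2^-1 * fejer L (x' - y) + 2^-1 * fejer L (x' + y)) =
  2^-1 * (fejer L (x - y) - fejer L (x' - y)) +
  2^-1 * (fejer L (x + y) - fejer L (x' + y)) by ring.
apply: norm_half_sum; apply: (le_trans (fejer_lipschitz _ _ L0)).
  by have -> : x - y - (x' - y) = x - x' by ring.
by have -> : x + y - (x' + y) = x - x' by ring.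
Qed.

Lemma cont_cos_kernel L x a b y : 0 < L -> a <= y <= b ->
  {for y, continuous (fun y => cos_kernel L (x, y))}.
Proof.
move=> L0 _; apply: (@lipschitz_continuous _ (L ^+ 2)) => y'.
by rewrite ![cos_kernel L (x, _)]cos_kernelC; exact: cos_kernel_lipschitz.
Qed.

Lemma cont_kernel_integral L a b c d h : 0 < L -> cont_on a b h ->
  cont_on c d (fun x => rint a b (fun y => h y * cos_kernel L (x, y))).
Proof.
move=> L0 ch x _.
apply: (@lipschitz_continuous _ (rint a b (fun y => `|h y| * L ^+ 2))) => x'.
have ck z : cont_on a b (fun y => h y * cos_kernel L (z, y)).
  by move=> y yab; apply: cvgM; [exact: ch|exact: (cont_cos_kernel L0 yab)].
have cn : cont_on a b (fun y => `|h y| * L ^+ 2).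
  move=> y yab; apply: cvgM; last exact: cvg_cst.
  by apply: continuous_comp; [exact: ch|exact: norm_continuous].
rewrite -rintB// mulrC -rintZ//; apply: norm_rint_le.
- by move=> y yab; apply: cvgB; exact: ck.
- by move=> y yab; apply: cvgM; [exact: cvg_cst|exact: cn].
- move=> y _; rewrite -mulrBr normrM.
  have -> : `|x - x'| * (`|h y| * L ^+ 2) = `|h y| * (L ^+ 2 * `|x - x'|) by ring.
  by rewrite ler_wpM2l// cos_kernel_lipschitz.
Qed.

(** The majorant of each Fejer kernel integrates to at most [3 pi], and each enters with weight 1/2.
    Uniformity in [L], [x] and the segment is what Schur's test needs. *)
Lemma cos_kernel_mass L x a b : 0 < L -> a <= b ->
  rint a b (fun y => 1 * cos_kernel L (x, y)) <= 3 * pi.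
Proof.
move=> L0 ab.
pose H y := 3 / 2 * atan (L * (y - x)) + 3 / 2 * atan (L * (y + x)).
pose dH y := 3 / 2 * (L * (1 + (L * (y - x)) ^+ 2)^-1)
  + 3 / 2 * (L * (1 + (L * (y + x)) ^+ 2)^-1).
have D0 (u : R) : 1 + u ^+ 2 != 0 by rewrite gt_eqF// ltr_pwDl ?sqr_ge0.
have hH y : a <= y <= b -> has_derive H y (dH y).
  by move=> _; rewrite /H; der; rewrite /dH/=; field; rewrite !D0.
have cH : cont_on a b dH by move=> y _; rewrite /dH; cont_der => /=; exact: D0.
apply: (@le_trans _ _ (rint a b dH)).
  apply: le_rint => //.
    by move=> y yab; apply: cvgM; [exact: cvg_cst|exact: (cont_cos_kernel L0 yab)].
  move=> y _; rewrite mul1r /cos_kernel/= /dH.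
  have h1 := fejer_le (x - y) L0; have h2 := fejer_le (x + y) L0.
  have -> : (L * (y - x)) ^+ 2 = (L * (x - y)) ^+ 2 by ring.
  by rewrite [y + x]addrC; lra.
rewrite (rint_FTC ab cH hH) /H.
have b1 := atan_ltpi2 (L * (b - x)); have b2 := atan_ltpi2 (L * (b + x)).
have a1 := atan_gtNpi2 (L * (a - x)); have a2 := atan_gtNpi2 (L * (a + x)).
lra.
Qed.

Lemma measurable_cos_shift x : measurable_fun setT
  (fun z : measurableTypeR R * measurableTypeR R => cos ((z.1 - x) * z.2)).
Proof.
apply: (@measurableT_comp _ _ _ _ _ _ cos).
  by apply: continuous_measurable_fun; exact: continuous_cos.
by apply: measurable_funM => //; exact: measurable_funB.
Qed.

Lemma measurable_cosM : measurable_fun setT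
  (fun z : measurableTypeR R * measurableTypeR R => cos (z.1 * z.2)).
Proof.
apply: eq_measurable_fun (measurable_cos_shift 0) => z _.
by rewrite /= subr0.
Qed.

Definition cos_transform a b (bt : R -> R) y : R :=
  rint a b (fun k => bt k * cos (y * k)).

Lemma cont_cos_transform a b c d bt : cont_on a b bt ->
  cont_on c d (cos_transform a b bt).
Proof.
move=> cb y _.
have h := @rint_param_derive R a b bt id (fun=> 0) y cb.
have hd : has_derive (fun y => rint a b (fun k => bt k * cos (0 + y * id k))) y
    (rint a b (fun k => bt k * id k * cos (0 + pi / 2 + y * id k))).
  by apply: h; [move=> x _; exact: cvg_id|move=> x _; exact: cvg_cst].
have -> : cos_transform a b bt = (fun y => rint a b (fun k => bt k * cos (0 + y * id k))).
  by apply/funext => u; apply: eq_rint => k _; rewrite add0r.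
exact: has_derive_continuous hd.
Qed.

(* Expanding the square and integrating in [x] first leaves a nonnegative kernel
   of mass at most [3 pi]; then [b(y) b(k) <= (b(y)^2 + b(k)^2) / 2]. *)
Lemma plancherel_fejer L a b bt : 0 < L -> a <= b -> cont_on a b bt ->
  rint 0 L (fun x => (1 - x / L) * cos_transform a b bt x ^+ 2) <=
  3 * pi * rint a b (fun k => bt k ^+ 2).
Proof.
move=> L0 ab cb; set f := cos_transform a b bt.
have cf c d : cont_on c d f by exact: cont_cos_transform.
have cw c d : cont_on c d (fun x => 1 - x / L) by move=> x _; cont_der.
have cb2 : cont_on a b (fun k => bt k ^+ 2).
  by move=> k kab; apply: cvgM; exact: cb.
have c1 : cont_on a b (fun=> 1 : R) by move=> x _; exact: cvg_cst.
pose T h y := rint a b (fun k => h k * cos_kernel L (y, k)).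
have cT h : cont_on a b h -> cont_on a b (T h) by exact: cont_kernel_integral.
have cos1 (z : measurableTypeR R * measurableTypeR R) : `|cos (z.1 * z.2)| <= 1.
  exact: cos_max.
have -> : rint 0 L (fun x => (1 - x / L) * f x ^+ 2) = rint a b (fun y => bt y * T bt y).
  under eq_rint => x _ do rewrite expr2 mulrA.
  have := @rint_fubini R 0 L a b (fun x => (1 - x / L) * f x) bt
    (fun p => cos (p.1 * p.2)) 1 _ cb ler01 measurable_cosM cos1.
  rewrite /= => ->; last by move=> x xL; apply: cvgM; [exact: cw xL|exact: cf xL].
  apply: eq_rint => y _; congr (_ * _).
  under eq_rint => x _ do rewrite mulrAC.
  have := @rint_fubini R 0 L a b (fun x => (1 - x / L) * cos (x * y)) bt
    (fun p => cos (p.1 * p.2)) 1 _ cb ler01 measurable_cosM cos1.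
  rewrite /= => ->; last by move=> x _; cont_der.
  by apply: eq_rint => k _; rewrite cos_kernelE.
have cbT : cont_on a b (fun y => bt y * T bt y).
  by move=> y yab; apply: cvgM; [exact: cb|exact: cT yab].
have cr1 : cont_on a b (fun y => 2^-1 * (bt y ^+ 2 * T (fun=> 1) y)).
  move=> y yab; apply: cvgM; first exact: cvg_cst.
  by apply: cvgM; [exact: cb2|exact: cT yab].
have cr2 : cont_on a b (fun y => 2^-1 * (1 * T (fun k => bt k ^+ 2) y)).
  move=> y yab; apply: cvgM; first exact: cvg_cst.
  by apply: cvgM; [exact: cvg_cst|exact: cT yab].
have ck h y : cont_on a b h -> cont_on a b (fun k => h k * cos_kernel L (y, k)).
  by move=> ch k kab; apply: cvgM; [exact: ch|exact: (cont_cos_kernel L0 kab)].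
have I0 : 0 <= rint a b (fun k => bt k ^+ 2) by apply: rint_ge0 => k _; exact: sqr_ge0.
apply: (@le_trans _ _ (rint a b (fun y => 2^-1 * (bt y ^+ 2 * T (fun=> 1) y) +
    2^-1 * (1 * T (fun k => bt k ^+ 2) y)))).
  apply: le_rint => //; first by move=> y yab; apply: cvgD; [exact: cr1|exact: cr2].
  move=> y _; have k1 := ck _ y cb; have k2 := ck _ y c1; have k3 := ck _ y cb2.
  have cZ (u : R) (g : R -> R) : cont_on a b g -> cont_on a b (fun k => u * g k).
    by move=> cg k kab; apply: cvgM; [exact: cvg_cst|exact: cg].
  have k4 := cZ (bt y) _ k1; have k5 := cZ (bt y ^+ 2) _ k2.
  have k6 := cZ 2^-1 _ k5; have k7 := cZ 2^-1 _ k3.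
  rewrite mul1r /T -(rintZ _ k1) -(rintZ _ k2) -(rintZ _ k5) -(rintZ _ k3).
  rewrite -(rintD k6 k7); apply: le_rint => //.
  - by move=> k kab; apply: cvgD; [exact: k6|exact: k7].
  - move=> k _; have k0 := cos_kernel_ge0 (y, k) L0.
    have := sqr_ge0 (bt y - bt k); move: (cos_kernel _ _) k0 => u u0; nra.
have cA : cont_on a b (fun y => bt y ^+ 2 * T (fun=> 1) y).
  by move=> y yab; apply: cvgM; [exact: cb2|exact: cT yab].
have cB : cont_on a b (fun y => 1 * T (fun k => bt k ^+ 2) y).
  by move=> y yab; apply: cvgM; [exact: cvg_cst|exact: cT yab].
rewrite (rintD cr1 cr2) (rintZ _ cA) (rintZ _ cB).
have E : rint a b (fun y => 1 * T (fun k => bt k ^+ 2) y) =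
    rint a b (fun y => bt y ^+ 2 * T (fun=> 1) y).
  have := @rint_fubini R a b a b (fun=> 1) (fun k => bt k ^+ 2) (cos_kernel L)
    (3 * L) c1 cb2 _ (measurable_cos_kernel L0) (fun p => cos_kernel_bound p L0).
  rewrite /T => ->; last by rewrite mulr_ge0// ltW.
  apply: eq_rint => y _; congr (_ * _); apply: eq_rint => k _.
  by rewrite cos_kernelC.
rewrite E.
suff : rint a b (fun y => bt y ^+ 2 * T (fun=> 1) y) <=
    3 * pi * rint a b (fun k => bt k ^+ 2).
  move: (rint a b _) (3 * pi * _) => I J; clear; lra.
rewrite -rintZ//; apply: le_rint.
  - by move=> y yab; apply: cvgM; [exact: cb2|exact: cT yab].
  - by move=> y yab; apply: cvgM; [exact: cvg_cst|exact: cb2].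
  - by move=> y _; rewrite mulrC ler_wpM2r ?sqr_ge0// cos_kernel_mass.
Qed.

(** For [L = 2 X] the Fejer weight is at least 1/2 on [[0, X]]. This factor 2, and another from
    evenness, turn [3 pi] into [12 pi]. *)
Lemma plancherel_rint X a b bt : 0 < X -> a <= b -> cont_on a b bt ->
  rint (- X) X (fun x => cos_transform a b bt x ^+ 2) <=
  12 * pi * rint a b (fun k => bt k ^+ 2).
Proof.
move=> X0 ab cb; set f := cos_transform a b bt.
have cf c d : cont_on c d (fun x => f x ^+ 2).
  by move=> x xcd; apply: cvgM; apply: cont_cos_transform xcd.
have fN x : f (- x) = f x.
  by apply: eq_rint => k _; rewrite mulNr cosN.
have -> : rint (- X) X (fun x => f x ^+ 2) = 2 * rint 0 X (fun x => f x ^+ 2).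
  rewrite (@rint_split _ 0)//; last by rewrite oppr_le0 ltW// ltW.
  have -> : rint (- X) 0 (fun x => f x ^+ 2) = rint 0 X (fun x => f x ^+ 2).
    rewrite /rint /Rintegral -{1}oppr0.
    rewrite integration_by_substitution_oppr ?(ltW X0)//; last first.
      by rewrite oppr0; exact: cont_on_within.
    by congr fine; apply: eq_integral => x _ /=; rewrite fN.
  by ring.
have L0 : 0 < 2 * X by rewrite mulr_gt0.
have := plancherel_fejer L0 ab cb; rewrite -/f.
have cwf c d : cont_on c d (fun x => (1 - x / (2 * X)) * f x ^+ 2).
  move=> x xcd; apply: cvgM; last exact: cf xcd.
  have : {for x, continuous (fun x => 1 - x / (2 * X))} by cont_der.
  exact.
have : rint 0 X (fun x => 2^-1 * f x ^+ 2) <=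
    rint 0 (2 * X) (fun x => (1 - x / (2 * X)) * f x ^+ 2).
  rewrite (@rint_split _ X 0 (2 * X)); [|by apply/andP; split; lra|exact: cwf].
  rewrite -[leLHS]addr0; apply: lerD.
    apply: le_rint => //.
      by move=> x xX; apply: cvgM; [exact: cvg_cst|exact: cf xX].
    move=> x /andP[x0 xX]; rewrite ler_wpM2r ?sqr_ge0//.
    have : x / (2 * X) <= 2^-1 by rewrite ler_pdivrMr//; lra.
    lra.
  apply: rint_ge0 => x /andP[Xx x2]; rewrite mulr_ge0 ?sqr_ge0//.
  by rewrite subr_ge0 ler_pdivrMr// mul1r.
rewrite rintZ//.
move: (rint 0 X _) (rint 0 (2 * X) _) (rint a b _) => I J K; clear; lra.
Qed.

End Plancherel.

(** * Square integrals over the line by Fatou's lemma *)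

Section SquareIntegrals.
Context {R : realType}.
Local Notation mu := (@lebesgue_measure R).
Implicit Types (a b c x y e : R) (f F : R -> R).

Lemma integral_rint a b f : cont_on a b f ->
  (\int[mu]_(x in `[a, b]) (f x)%:E = (rint a b f)%:E)%E.
Proof.
move=> cf; rewrite /rint /Rintegral fineK//.
by apply: integrable_fin_num => //; exact: cont_on_integrable.
Qed.

Lemma limn_einf_le (u : nat -> \bar R) (C : \bar R) :
  (forall n, (u n <= C)%E) -> (limn_einf u <= C)%E.
Proof.
move=> uC; rewrite limn_einf_lim; apply: lime_le; first exact: is_cvg_einfs.
apply: nearW => n; apply: le_trans (uC n); apply: ereal_inf_lbound.
by exists n => //=.
Qed.

(** Fatou's lemma on growing windows. Convergence is asked only off the origin, because the
    truncated waves diverge there at the singular time; the origin is a null set. *)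
Lemma square_integral_fatou (F : R -> R) (Fn : nat -> R -> R) c :
  measurable_fun setT F -> (forall n a b, cont_on a b (Fn n)) ->
  (forall x, x != 0 -> (fun n => Fn n x) @ \oo --> F x) ->
  (forall n, rint (- n.+1%:R) n.+1%:R (fun x => Fn n x ^+ 2) <= c) ->
  (\int[mu]_x (F x ^+ 2)%:E <= c%:E)%E.
Proof.
move=> mF cF FnF hc.
have mF2 : measurable_fun setT (fun x => (F x ^+ 2)%:E).
  by apply/measurable_EFinP; exact: measurable_funX.
pose D : set R := setT `\ 0.
have mD : measurable D by apply: measurableD.
rewrite -(@integral_setD1 _ _ 0) -/D//; last exact: measurable_funTS.
pose A n : set R := `[- n.+1%:R, n.+1%:R]%classic.
pose g n := (fun x => (Fn n x ^+ 2)%:E) \_ (A n).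
have cF2 n a b : cont_on a b (fun x => Fn n x ^+ 2).
  by move=> x xab; apply: cvgM; exact: cF xab.
have mg n : measurable_fun setT (g n).
  apply/(measurable_restrictT _ _).1; first exact: measurable_itv.
  apply/measurable_EFinP.
  have := cont_on_integrable (cF2 n (- n.+1%:R) n.+1%:R).
  by move=> /measurable_int/measurable_EFinP.
have g0 n x : (0 <= g n x)%E.
  by rewrite /g patchE; case: ifPn => // _; rewrite lee_fin sqr_ge0.
have -> : (\int[mu]_(x in D) (F x ^+ 2)%:E)%E =
    (\int[mu]_(x in D) limn_einf (g ^~ x))%E.
  apply: eq_integral => x; rewrite inE => -[_ /eqP x0].
  have : (fun n => g n x) @ \oo --> (F x ^+ 2)%:E.
    apply: (@cvg_trans _ ((fun n => (Fn n x ^+ 2)%:E) @ \oo)).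
      apply: near_eq_cvg; near=> n.
      have xA : x \in A n.
        rewrite inE /A /= in_itv /= -ler_norml.
        rewrite (@le_trans _ _ n%:R)// ?ler_nat//; near: n.
        exact: nbhs_infty_ger.
      by rewrite /g patchE xA.
    by apply: cvg_EFin; [exact: nearW|apply: cvgM; exact: FnF].
  by move=> /cvg_limn_einf_sup[-> _].
apply: (@le_trans _ _ (limn_einf (fun n => \int[mu]_(x in D) g n x)%E)).
  apply: fatou => // n; apply: measurable_funTS; exact: mg.
apply: limn_einf_le => n.
apply: (@le_trans _ _ (\int[mu]_x g n x)%E).
  by apply: ge0_subset_integral => //; exact: mg.
by rewrite /g -integral_mkcond integral_rint// lee_fin.
Unshelve. all: by end_near. Qed.

Lemma square_integral_cos_transform a (b : nat -> R) (bt F : R -> R) c :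
  measurable_fun setT F -> (forall b, cont_on a b bt) ->
  (forall n, a <= b n) ->
  (forall y, y != 0 -> (fun n => cos_transform a (b n) bt y) @ \oo --> F y) ->
  (forall n, rint a (b n) (fun k => bt k ^+ 2) <= c) ->
  (\int[mu]_x (F x ^+ 2)%:E <= (12 * pi * c)%:E)%E.
Proof.
move=> mF cb ab hF hc.
apply: (@square_integral_fatou _ (fun n => cos_transform a (b n) bt)) => //.
  by move=> n c' d'; exact: cont_cos_transform.
move=> n; apply: (le_trans (plancherel_rint _ (ab n) (cb _))) => //.
by rewrite ler_wpM2l// mulr_ge0// pi_ge0.
Qed.

Lemma rint_invsqr a b : 0 < a -> a <= b -> rint a b (fun k => k ^- 2) = a^-1 - b^-1.
Proof.
move=> a0 ab; rewrite (_ : a^-1 - b^-1 = - b^-1 - - a^-1); last by ring.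
apply: (@rint_FTC _ (fun k => - k^-1)) => // k /andP[ak _].
  by cont_der; rewrite expf_neq0// gt_eqF// (lt_le_trans a0).
by der; [rewrite gt_eqF// (lt_le_trans a0)|move=> /=; ring].
Qed.

End SquareIntegrals.

(** * Bounds and continuity in time in L2 *)

Section WaveSquareIntegrals.
Context {R : realType} (al : R) (hal : `|al| <= 1).
Local Notation mu := (@lebesgue_measure R).
Implicit Types (th y tau k a b c e : R).
Local Notation symb := (symb al).
Local Notation W := (W al).
Local Notation Wn := (Wn al).
Local Notation wave := (wave al).

Definition profile th tau k : R := k^-1 * cos (th + tau * symb k).

Lemma cont_profile th tau a b : 0 < a -> cont_on a b (profile th tau).
Proof.
move=> a0 k /andP[ak _]; rewrite /profile /symb; cont_der.
by rewrite gt_eqF// (lt_le_trans a0).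
Qed.

Lemma cont_profile_cos th tau y a b : 0 < a ->
  cont_on a b (fun k => profile th tau k * cos (y * k)).
Proof.
move=> a0 k kab; apply: cvgM; first exact: cont_profile kab.
have : {for k, continuous (fun k => cos (y * k))} by cont_der.
exact.
Qed.

Lemma wave_cos_transform a b th tau y :
  wave a b th tau y = cos_transform a b (profile th tau) y.
Proof. by apply: eq_rint => k _; rewrite /profile mulrAC. Qed.

Lemma cont_Wn N th tau a b : cont_on a b (Wn N th tau).
Proof.
have -> : Wn N th tau = cos_transform 1 N.+1%:R (profile th tau).
  by apply/funext => y; exact: wave_cos_transform.
by apply: cont_cos_transform; exact: cont_profile.
Qed.

Lemma measurable_Wn N th tau : measurable_fun setT (Wn N th tau).
Proof.
apply: continuous_measurable_fun => x; apply: (@cont_Wn _ _ _ x x).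
by rewrite lexx.
Qed.

Lemma measurable_W th tau : measurable_fun setT (W th tau).
Proof.
have [->|t0] := eqVneq tau 0; last first.
  apply: (measurable_fun_cvg (h := fun N => Wn N th tau)).
    by move=> N; exact: measurable_Wn.
  by move=> y _; apply: W_cvg => //; rewrite t0.
(* At [tau = 0] the truncations are reset to 0 at the origin, which matches the default value of
   [W]. *)
apply: (measurable_fun_cvg (h := fun N => (Wn N th 0) \_ (~` [set 0]))).
  move=> N; apply/(measurable_restrictT _ _).1; first exact: measurableC.
  by apply: measurable_funTS; exact: measurable_Wn.
move=> y _; have [->|y0] := eqVneq y 0.
  rewrite /W !eqxx/=.
  have -> : (fun N => (Wn N th 0 \_ (~` [set 0])) 0) = (fun=> 0).
    apply/funext => N; rewrite patchE ifF//; apply/negbTE/negP.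
    by rewrite inE /=; apply.
  exact: cvg_cst.
have -> : (fun N => (Wn N th 0 \_ (~` [set 0])) y) = (fun N => Wn N th 0 y).
  by apply/funext => N; rewrite patchE mem_set//=; exact/eqP.
by apply: W_cvg => //; rewrite y0 orbT.
Qed.

Lemma profile_sqr_le th tau k : 0 < k -> profile th tau k ^+ 2 <= k ^- 2.
Proof.
move=> k0; have c1 : cos (th + tau * symb k) ^+ 2 <= 1.
  by rewrite -(real_normK (num_real _)) exprn_ile1// cos_max.
by rewrite /profile exprMn -exprVn ler_piMr ?sqr_ge0.
Qed.

Lemma rint_profile_sqr_le th tau a b : 0 < a -> a <= b ->
  rint a b (fun k => profile th tau k ^+ 2) <= a^-1.
Proof.
move=> a0 ab; apply: (@le_trans _ _ (rint a b (fun k => k ^- 2))).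
  apply: le_rint.
  - by move=> k kab; apply: cvgM; apply: cont_profile kab.
  - move=> k /andP[ak _]; cont_der.
    by rewrite expf_neq0// gt_eqF// (lt_le_trans a0).
  - by move=> k /andP[ak _]; apply: profile_sqr_le; exact: lt_le_trans ak.
by rewrite rint_invsqr// gerBl invr_ge0 (le_trans (ltW a0)).
Qed.

Lemma W_square_integral th tau :
  (\int[mu]_y (W th tau y ^+ 2)%:E <= (12 * pi)%:E)%E.
Proof.
have -> : 12 * pi = 12 * pi * 1 :> R by rewrite mulr1.
apply: (@square_integral_cos_transform _ 1 (fun n => n.+1%:R) (profile th tau)).
- exact: measurable_W.
- by move=> b; exact: cont_profile.
- by move=> n; rewrite ler1n.
- move=> y y0.
  have -> : (fun n => cos_transform 1 n.+1%:R (profile th tau) y) = (fun N => Wn N th tau y).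
    by apply/funext => N; rewrite -wave_cos_transform.
  by apply: W_cvg => //; rewrite y0 orbT.
- by move=> n; rewrite (le_trans (rint_profile_sqr_le _ _ _ _))// ?ler1n// invr1.
Qed.

Lemma W_tail_square_integral N th tau :
  (\int[mu]_y ((W th tau y - Wn N th tau y) ^+ 2)%:E <= (12 * pi * N.+1%:R^-1)%:E)%E.
Proof.
apply: (@square_integral_cos_transform _ N.+1%:R (fun n => (n + N).+1%:R) (profile th tau)).
- by apply: measurable_funB; [exact: measurable_W|exact: measurable_Wn].
- by move=> b; exact: cont_profile.
- by move=> n; rewrite ler_nat ltnS leq_addl.
- move=> y y0.
  have -> : (fun n => cos_transform N.+1%:R (n + N).+1%:R (profile th tau) y) =
      (fun n => Wn (n + N)%N th tau y - Wn N th tau y).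
    by apply/funext => n; rewrite WnB ?leq_addl// -wave_cos_transform.
  apply: cvgB; last exact: cvg_cst.
  rewrite (cvg_shiftn N (fun n => Wn n th tau y)).
  by apply: W_cvg => //; rewrite y0 orbT.
- by move=> n; apply: rint_profile_sqr_le => //; rewrite ler_nat ltnS leq_addl.
Qed.

(** Below [K] the difference is at most [k^-1 2 k^4 |tau - tau'|]; above [K] its square is at most
    [4 k^-2], whose integral is at most [4 / K]. *)
Lemma profile_diff_le th tau tau' K b : 1 <= K -> 1 <= b ->
  rint 1 b (fun k => (profile th tau k - profile th tau' k) ^+ 2) <=
  (2 * K ^+ 3 * `|tau - tau'|) ^+ 2 * K + 4 / K.
Proof.
move=> K1 b1; pose f k := (profile th tau k - profile th tau' k) ^+ 2.
have cf a c : 0 < a -> cont_on a c f.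
  by move=> a0 k kac; apply: cvgM; apply: cvgB; apply: cont_profile kac.
have K0 : 0 < K by lra.
(* Enlarging the interval makes the cut at [K] available even when [b < K]. *)
pose b' := Num.max b K.
have bb' : b <= b' by rewrite le_max lexx.
have Kb' : K <= b' by rewrite le_max lexx orbT.
apply: (@le_trans _ _ (rint 1 b' f)).
  rewrite (@rint_split _ b 1 b') ?b1//; last exact: cf.
  by rewrite lerDl; apply: rint_ge0 => k _; exact: sqr_ge0.
rewrite (@rint_split _ K 1 b') ?K1//; last exact: cf.
apply: lerD.
  apply: (@le_trans _ _ (rint 1 K (fun=> (2 * K ^+ 3 * `|tau - tau'|) ^+ 2))).
    apply: le_rint; first exact: cf.
      by move=> k _; exact: cvg_cst.
    move=> k /andP[k1 kK]; have k0 : 0 < k by lra.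
    rewrite /f -(real_normK (num_real _)) lerXn2r ?nnegrE//.
      by apply: mulr_ge0 => //; apply: mulr_ge0 => //; exact: exprn_ge0 (ltW K0).
    rewrite /profile -mulrBr normrM gtr0_norm ?invr_gt0//.
    have h : `|cos (th + tau * symb k) - cos (th + tau' * symb k)| <=
        2 * k ^+ 4 * `|tau - tau'|.
      apply: (le_trans (cos_lipschitz _ _)).
      have -> : th + tau * symb k - (th + tau' * symb k) = symb k * (tau - tau') by ring.
      rewrite normrM ler_wpM2r//; have /andP[s0 s1] := symb_le hal k1.
      by rewrite ger0_norm.
    apply: (@le_trans _ _ (k^-1 * (2 * k ^+ 4 * `|tau - tau'|))).
      by rewrite ler_wpM2l// invr_ge0 ltW.
    have -> : k^-1 * (2 * k ^+ 4 * `|tau - tau'|) = 2 * k ^+ 3 * `|tau - tau'|.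
      by field; rewrite gt_eqF.
    by rewrite ler_wpM2r// ler_pM2l// lerXn2r// nnegrE ltW.
  by rewrite rint_cst// ler_wpM2l ?sqr_ge0//; lra.
apply: (@le_trans _ _ (rint K b' (fun k => 4 * k ^- 2))).
  apply: le_rint; first exact: cf.
    move=> k /andP[ak _]; cont_der.
    by rewrite expf_neq0// gt_eqF// (lt_le_trans K0).
  move=> k /andP[Kk _]; have k0 : 0 < k by lra.
  have h1 := profile_sqr_le th tau k0; have h2 := profile_sqr_le th tau' k0.
  have := sqr_ge0 (profile th tau k + profile th tau' k); rewrite /f.
  move: (profile _ _ _) (profile _ _ _) (k ^- 2) h1 h2 => u v w h1 h2; nra.
rewrite rintZ; last first.
  move=> k /andP[ak _]; cont_der.
  by rewrite expf_neq0// gt_eqF// (lt_le_trans K0).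
rewrite rint_invsqr// ler_pM2l// gerBl invr_ge0; lra.
Qed.

Lemma W_diff_square_integral th tau e : 0 < e ->
  exists2 d, 0 < d & forall tau', `|tau - tau'| < d ->
    (\int[mu]_y ((W th tau y - W th tau' y) ^+ 2)%:E <= e%:E)%E.
Proof.
move=> e0; pose P : R := 12 * pi.
have P0 : 0 < P by rewrite mulr_gt0// pi_gt0.
(* [K] brings the high-frequency part [4 P / K] below [e / 2]; [d] does the same for
   [4 P K^7 |tau - tau'|^2], its bound by 1 reducing the square to the first power. *)
pose K : R := 1 + 8 * P / e.
have K1 : 1 <= K.
  rewrite lerDl; apply: divr_ge0; last exact: ltW.
  by apply: mulr_ge0 => //; exact: ltW.
have K0 : 0 < K by lra.
pose d : R := Num.min 1 (e / (8 * P * K ^+ 7)).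
have D0 : 0 < 8 * P * K ^+ 7.
  by apply: mulr_gt0; [exact: mulr_gt0|exact: exprn_gt0].
have d0 : 0 < d by rewrite lt_min ltr01 divr_gt0.
exists d => // tau' ht.
pose c := (2 * K ^+ 3 * `|tau - tau'|) ^+ 2 * K + 4 / K.
apply: (@le_trans _ _ (12 * pi * c)%:E).
  apply: (@square_integral_cos_transform _ 1 (fun n => n.+1%:R)
      (fun k => profile th tau k - profile th tau' k)).
  - by apply: measurable_funB; exact: measurable_W.
  - by move=> b k kb; apply: cvgB; apply: cont_profile kb.
  - by move=> n; rewrite ler1n.
  - move=> y y0.
    have -> : (fun n => cos_transform 1 n.+1%:R
        (fun k => profile th tau k - profile th tau' k) y) =
        (fun N => Wn N th tau y - Wn N th tau' y).
      apply/funext => N; rewrite /Wn !wave_cos_transform /cos_transform -rintB.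
      - by apply: eq_rint => k _; rewrite mulrBl.
      - exact: cont_profile_cos.
      - exact: cont_profile_cos.
    by apply: cvgB; apply: W_cvg => //; rewrite y0 orbT.
  - by move=> n; apply: profile_diff_le => //; rewrite ler1n.
rewrite lee_fin -/P /c.
have h1 : P * (4 / K) <= e / 2.
  have : 8 * P <= e * K.
    rewrite /K mulrDr mulr1 [e * _]mulrC divfK ?gt_eqF//; lra.
  by move=> h; rewrite [P * _]mulrA ler_pdivrMr//; lra.
have hd : `|tau - tau'| <= 1 /\ `|tau - tau'| <= e / (8 * P * K ^+ 7).
  by move: ht; rewrite lt_min => /andP[/ltW ? /ltW ?].
have [h2 h3] := hd.
have h4 : `|tau - tau'| ^+ 2 <= e / (8 * P * K ^+ 7).
  by rewrite expr2 (le_trans _ h3)// ler_piMl.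
have h5 : `|tau - tau'| ^+ 2 * (8 * P * K ^+ 7) <= e by rewrite -ler_pdivlMr.
have -> : P * ((2 * K ^+ 3 * `|tau - tau'|) ^+ 2 * K + 4 / K) =
    (`|tau - tau'| ^+ 2 * (8 * P * K ^+ 7)) / 2 + P * (4 / K).
  by field; rewrite gt_eqF.
lra.
Qed.

End WaveSquareIntegrals.

(** * The weak equation *)

Section SquareIntegrable.
Context {R : realType}.
Local Notation mu := (@lebesgue_measure R).
Implicit Types (f g phi : R -> R) (A B c s x : R).

Lemma measurable_shift c : measurable_fun setT (fun x : R => x - c).
Proof. exact: measurable_funB. Qed.

(** Uniqueness of Lebesgue measure reduces translation invariance to half-open intervals. *)
Lemma lebesgue_measure_shift c (A : set R) : measurable A ->
  pushforward mu ((fun x => x - c) : _ -> measurableTypeR R) A = mu A.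
Proof.
move=> mA; have mf := measurable_shift c.
apply/esym/lebesgue_measure_unique => //= _ [[a b]] _ <-.
rewrite /pushforward.
have -> : (fun x => x - c) @^-1` `]a, b]%classic = `]a + c, b + c]%classic.
  by apply/seteqP; split => x /=; rewrite !in_itv/= ltrBrDr lerBlDr.
by rewrite !lebesgue_measure_itv/= !lte_fin ltrD2r -!EFinB opprD addrACA subrr addr0.
Qed.

Lemma ge0_integral_shift c (f : R -> \bar R) : measurable_fun setT f ->
  (forall x, 0 <= f x)%E -> (\int[mu]_x f (x - c)%R = \int[mu]_x f x)%E.
Proof.
move=> mf f0.
rewrite -[in LHS](preimage_setT ((fun x => x - c) : R -> measurableTypeR R)).
have := @ge0_integral_pushforward _ _ (measurableTypeR R) (measurableTypeR R) R
  (fun x => x - c) (measurable_shift c) mu setT f measurableT mf (fun x _ => f0 x).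
rewrite /comp /= => <-.
have mc := measurable_shift c.
by apply: eq_measure_integral => //= A mA _; exact: lebesgue_measure_shift.
Qed.

Lemma integrable_scale k f : mu.-integrable setT (EFin \o f) ->
  mu.-integrable setT (EFin \o (fun x => k * f x)).
Proof.
move=> ih; have -> : EFin \o (fun x => k * f x) = (fun x => k%:E * (EFin \o f) x)%E.
  by apply/funext => x /=; rewrite EFinM.
exact: integrableZl.
Qed.

Lemma integrable_sum2 f g : mu.-integrable setT (EFin \o f) ->
  mu.-integrable setT (EFin \o g) ->
  mu.-integrable setT (EFin \o (fun x => f x + g x)).
Proof.
move=> ih1 ih2.
have -> : EFin \o (fun x => f x + g x) = ((EFin \o f) \+ (EFin \o g))%E.
  by apply/funext => x /=; rewrite EFinD.
exact: integrableD.
Qed.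

Definition sq_le f A : Prop :=
  measurable_fun setT f /\ (\int[mu]_x (f x ^+ 2)%:E <= A%:E)%E.

Lemma sq_le_ge0 f A : sq_le f A -> 0 <= A.
Proof.
move=> [_ h]; rewrite -lee_fin (le_trans _ h)//.
by apply: integral_ge0 => x _; rewrite lee_fin sqr_ge0.
Qed.

Lemma sq_le_integrable f A : sq_le f A ->
  mu.-integrable setT (EFin \o (fun x => f x ^+ 2)).
Proof.
move=> [mf h]; apply/integrableP; split.
  by apply/measurable_EFinP; exact: measurable_funX.
under eq_integral do rewrite /= ger0_norm ?sqr_ge0//.
by rewrite (le_lt_trans h)// ltry.
Qed.

Lemma sq_le_Rintegral f A : sq_le f A -> \int[mu]_x (f x ^+ 2) <= A.
Proof.
move=> h; have ih := sq_le_integrable h; case: h => _ h.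
by rewrite -lee_fin /Rintegral fineK//; exact: integrable_fin_num ih.
Qed.

Lemma sq_leB f g A B : sq_le f A -> sq_le g B ->
  sq_le (fun x => f x - g x) (2 * A + 2 * B).
Proof.
move=> h1 h2; have [m1 _] := h1; have [m2 _] := h2.
split; first exact: measurable_funB.
have i1 := integrable_scale 2 (sq_le_integrable h1).
have i2 := integrable_scale 2 (sq_le_integrable h2).
have i3 := integrable_sum2 i1 i2.
apply: (@le_trans _ _ (\int[mu]_x (2 * f x ^+ 2 + 2 * g x ^+ 2)%:E)%E).
  apply: ge0_le_integral => //.
  - by move=> x _; rewrite lee_fin sqr_ge0.
  - by apply/measurable_EFinP; apply: measurable_funX; exact: measurable_funB.
  - by have /measurable_int := i3.
  - move=> x _; rewrite lee_fin.
    by have := sqr_ge0 (f x + g x); move: (f x) (g x) => a b; nra.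
rewrite -[leLHS]fineK; last by apply: integrable_fin_num => //; exact: i3.
rewrite lee_fin -/(Rintegral mu setT _) RintegralD// !RintegralZl//.
- by rewrite lerD// ler_pM2l//; [exact: sq_le_Rintegral h1|exact: sq_le_Rintegral h2].
- exact: sq_le_integrable h2.
- exact: sq_le_integrable h1.
Qed.

Lemma sq_le_shift f A c : sq_le f A -> sq_le (fun x => f (x - c)) A.
Proof.
move=> [mf h]; split.
  by apply: (measurableT_comp mf); exact: measurable_shift.
rewrite (@ge0_integral_shift c (fun x => (f x ^+ 2)%:E))//.
- by apply/measurable_EFinP; exact: measurable_funX.
- by move=> x; rewrite lee_fin sqr_ge0.
Qed.

Lemma young_le (u v s : R) : 0 < s -> `|u * v| <= 2^-1 * (s * u ^+ 2 + s^-1 * v ^+ 2).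
Proof.
move=> s0; rewrite normrM -(real_normK (num_real u)) -(real_normK (num_real v)).
move: `|u| `|v| => a b.
have : 0 <= s^-1 * (s * a - b) ^+ 2 by rewrite mulr_ge0 ?sqr_ge0// invr_ge0 ltW.
have -> : s^-1 * (s * a - b) ^+ 2 = s * a ^+ 2 + s^-1 * b ^+ 2 - 2 * (a * b).
  by field; rewrite gt_eqF.
lra.
Qed.

Lemma sq_le_mul_integrable f g A B : sq_le f A -> sq_le g B ->
  mu.-integrable setT (EFin \o (fun x => f x * g x)).
Proof.
move=> hf hg; have [mf _] := hf; have [mg _] := hg.
have i1 : mu.-integrable setT (EFin \o (fun x => 2^-1 * (f x ^+ 2 + g x ^+ 2))).
  apply: integrable_scale; apply: integrable_sum2.
    exact: sq_le_integrable hf.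
  exact: sq_le_integrable hg.
apply: (le_integrable _ _ _ i1) => //.
- by apply/measurable_EFinP; exact: measurable_funM.
- move=> x _; rewrite /= lee_fin; apply: le_trans (ler_norm _).
  by have := young_le (f x) (g x) ltr01; rewrite invr1 !mul1r.
Qed.

(** A substitute for Cauchy-Schwarz: the free [s] balances the two squared norms and spares all
    square roots. *)
Lemma norm_pair_le f g A B s : sq_le f A -> sq_le g B -> 0 < s ->
  `|\int[mu]_x (f x * g x)| <= 2^-1 * (s * A + s^-1 * B).
Proof.
move=> hf hg s0; have ifg := sq_le_mul_integrable hf hg.
have i1 := sq_le_integrable hf; have i2 := sq_le_integrable hg.
have j1 := integrable_scale s i1; have j2 := integrable_scale s^-1 i2.
have j3 := integrable_sum2 j1 j2.
apply: (le_trans (le_normr_Rintegral _ ifg)) => //.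
apply: (@le_trans _ _ (\int[mu]_x (2^-1 * (s * f x ^+ 2 + s^-1 * g x ^+ 2)))).
  apply: le_Rintegral => //; first exact: integrable_norm ifg.
    exact: integrable_scale.
  by move=> x _; exact: young_le.
rewrite RintegralZl// RintegralD// RintegralZl// RintegralZl//.
rewrite ler_pM2l// lerD// ler_wpM2l ?invr_ge0 ?(ltW s0)//.
  exact: sq_le_Rintegral.
exact: sq_le_Rintegral.
Qed.

End SquareIntegrable.

(** * Test functions and their cosine transforms *)

Section TestFunctions.
Context {R : realType}.
Local Notation mu := (@lebesgue_measure R).
Implicit Types (f g phi : R -> R) (A B c s x M k : R).

Lemma derive_vanish phi M : smooth phi -> (forall x, M < `|x| -> phi x = 0) ->
  forall x, M < `|x| -> phi^`()%classic x = 0.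
Proof.
move=> sphi h x Mx.
have /has_derive_epsP hd : has_derive phi x (phi^`()%classic x).
  by have := smooth_has_derive 0 x sphi.
apply/eqP; rewrite -normr_le0; apply/ler_addgt0Pr => e e0; rewrite add0r.
have [r r0 hr] := hd e e0.
pose t := Num.min (r / 2) ((`|x| - M) / 2).
have t0 : 0 < t by rewrite lt_min !divr_gt0// subr_gt0.
have tr : t < r by rewrite gt_min ltr_pdivrMr//; apply/orP; left; lra.
have tM : t <= (`|x| - M) / 2 by rewrite ge_min lexx orbT.
have := hr t; rewrite (gtr0_norm t0) => /(_ tr).
rewrite (h x Mx) (h (x + t)); last first.
  have := ler_normB (x + t) t; rewrite addrK (gtr0_norm t0); lra.
by rewrite subrr sub0r normrN normrM (gtr0_norm t0) mulrC ler_pM2r.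
Qed.

Lemma test_function_derive phi : test_function phi -> test_function phi^`()%classic.
Proof.
move=> [sphi [M hM]]; split; last by exists M; exact: derive_vanish.
move=> n x; have -> : (phi^`()^`(n))%classic = phi^`(n.+1)%classic.
  by rewrite /derive1n iterSr.
exact: sphi.
Qed.

Lemma test_function_deriven phi n : test_function phi ->
  test_function phi^`(n)%classic.
Proof.
move=> h; elim: n => [//|n IH]; rewrite derive1nS; exact: test_function_derive.
Qed.

Lemma test_function_cont phi a b : test_function phi -> cont_on a b phi.
Proof.
move=> [sphi _] x _; apply: has_derive_continuous.
exact: (smooth_has_derive 0 x sphi).
Qed.

Lemma Rintegral_support f M : 0 <= M -> (forall x, M < `|x| -> f x = 0) ->
  \int[mu]_x f x = rint (- M) M f.
Proof.
move=> M0 h; rewrite /rint [RHS]Rintegral_mkcond; apply: eq_Rintegral => x _.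
rewrite patchE; case: ifPn => //; rewrite notin_setE/= in_itv/= -ler_norml => /negP.
by rewrite -ltNge => /h.
Qed.

Lemma support_integrable f M : cont_on (- M) M f -> (forall x, M < `|x| -> f x = 0) ->
  mu.-integrable setT (EFin \o f).
Proof.
move=> cf h; have := cont_on_integrable cf.
move=> /(integrable_mkcond _ _).1 => /(_ (measurable_itv _)).
congr (_.-integrable _ _); apply/funext => x.
rewrite /= patchE; case: ifPn => //; rewrite notin_setE/= in_itv/= -ler_norml => /negP.
by rewrite -ltNge => /h ->.
Qed.

Lemma test_function_support phi : test_function phi ->
  exists2 M : R, 0 < M & forall x, M <= `|x| -> phi x = 0 /\ phi^`()%classic x = 0.
Proof.
move=> h; have h' := test_function_derive h.
case: h => _ [M hM]; case: h' => _ [M' hM'].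
exists (`|M| + `|M'| + 1); first by rewrite ltr_wpDl// addr_ge0.
move=> x hx; have := ler_norm M; have := ler_norm M'.
have := normr_ge0 M; have := normr_ge0 M' => ? ? ? ?.
by split; [apply: hM|apply: hM']; lra.
Qed.

Lemma test_function_integrable phi : test_function phi ->
  mu.-integrable setT (EFin \o phi).
Proof.
move=> h; have [M M0 hM] := test_function_support h.
apply: (@support_integrable _ M); first exact: test_function_cont.
by move=> x /ltW /hM[].
Qed.

Lemma test_function_measurable phi : test_function phi -> measurable_fun setT phi.
Proof. by move=> /test_function_integrable/measurable_int/measurable_EFinP. Qed.

Lemma support_sq_le f M : cont_on (- M) M f -> (forall x, M < `|x| -> f x = 0) ->
  sq_le f (rint (- M) M (fun x => f x ^+ 2)).
Proof.
move=> cf h; split.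
  by have /measurable_int/measurable_EFinP := support_integrable cf h.
have cf2 : cont_on (- M) M (fun x => f x ^+ 2) by move=> x xM; apply: cvgM; exact: cf.
rewrite -integral_rint// [leRHS]integral_mkcond le_eqVlt; apply/orP; left; apply/eqP.
apply: eq_integral => x _; rewrite patchE; case: ifPn => //.
rewrite notin_setE/= in_itv/= -ler_norml => /negP.
by rewrite -ltNge => /h ->; rewrite expr0n.
Qed.

Lemma test_function_sq phi : test_function phi -> exists B, sq_le phi B.
Proof.
move=> h; have [M M0 hM] := test_function_support h.
eexists; apply: (@support_sq_le _ M); first exact: test_function_cont.
by move=> x /ltW /hM[].
Qed.

Definition cos_coef (c : R) phi k : R := \int[mu]_x (phi x * cos ((x - c) * k)).

Lemma cos_coefE c phi M k : 0 <= M -> (forall x, M < `|x| -> phi x = 0) ->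
  cos_coef c phi k = rint (- M) M (fun x => phi x * cos ((x - c) * k)).
Proof.
by move=> M0 h; apply: Rintegral_support => // x /h ->; rewrite mul0r.
Qed.

Lemma cont_cos_coef c phi a b : test_function phi -> cont_on a b (cos_coef c phi).
Proof.
move=> h k _; have [M M0 hM] := test_function_support h.
have h0 x : M < `|x| -> phi x = 0 by move=> /ltW /hM[].
have -> : cos_coef c phi = fun k => rint (- M) M (fun x => phi x * cos (0 + k * (x - c))).
  apply/funext => k'; rewrite (cos_coefE c k' (ltW M0) h0).
  by apply: eq_rint => x _; rewrite add0r [k' * _]mulrC.
apply: has_derive_continuous.
apply: (@rint_param_derive R (- M) M phi (fun x => x - c) (fun=> 0)).
- exact: test_function_cont.
- by move=> x _; cont_der.
- by move=> x _; exact: cvg_cst.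
Qed.

Lemma cos_coef_deriv2 c phi k : test_function phi ->
  cos_coef c phi^`(2)%classic k = - (k ^+ 2 * cos_coef c phi k).
Proof.
move=> h; have [M M0 hM] := test_function_support h.
have h2 := test_function_deriven 2 h.
have [M' M'0 hM'] := test_function_support h2.
pose L := M + M'; have L0 : 0 < L by rewrite addr_gt0.
have v0 x : L < `|x| -> phi x = 0 by move=> Lx; have [] := hM x; rewrite /L in Lx; lra.
have v2 x : L < `|x| -> phi^`(2)%classic x = 0.
  by move=> Lx; have [] := hM' x; rewrite /L in Lx; lra.
rewrite (cos_coefE _ _ (ltW L0) v0) (cos_coefE _ _ (ltW L0) v2).
(* A primitive of [(phi'' + k^2 phi) cos ((x - c) k)] that vanishes at both ends: two integrations
   by parts in one. *)
pose G x := phi^`()%classic x * cos ((x - c) * k) + k * phi x * sin ((x - c) * k).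
have [sphi _] := h.
have d0 x : has_derive phi x (phi^`()%classic x) by exact: (smooth_has_derive 0 x sphi).
have d1 x : has_derive phi^`()%classic x (phi^`(2)%classic x).
  exact: (smooth_has_derive 1 x sphi).
have c0 : cont_on (- L) L phi by exact: test_function_cont.
have c2 : cont_on (- L) L phi^`(2)%classic by exact: test_function_cont.
have cc : cont_on (- L) L (fun x => cos ((x - c) * k)) by move=> x _; cont_der.
have cg2 : cont_on (- L) L (fun x => phi^`(2)%classic x * cos ((x - c) * k)).
  by move=> x xL; apply: cvgM; [exact: c2|exact: cc].
have cg0 : cont_on (- L) L (fun x => phi x * cos ((x - c) * k)).
  by move=> x xL; apply: cvgM; [exact: c0|exact: cc].
have cZ : cont_on (- L) L (fun x => k ^+ 2 * (phi x * cos ((x - c) * k))).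
  by move=> x xL; apply: cvgM; [exact: cvg_cst|exact: cg0].
apply/eqP; rewrite -addr_eq0; apply/eqP; rewrite -rintZ// -rintD//.
rewrite (@rint_FTC _ G) ?lerNl ?opprK; first last.
- move=> x _; rewrite /G; der; [exact: d1|exact: d0|].
  by rewrite /=; ring.
- by move=> x xL; apply: cvgD; [exact: cg2|exact: cZ].
- lra.
have [e1 e2] : phi L = 0 /\ phi^`()%classic L = 0.
  by apply: hM; rewrite gtr0_norm// /L; lra.
have [e3 e4] : phi (- L) = 0 /\ phi^`()%classic (- L) = 0.
  by apply: hM; rewrite normrN gtr0_norm// /L; lra.
by rewrite /G e1 e2 e3 e4; ring.
Qed.

End TestFunctions.

Section WeakEquation.
Context {R : realType} (al : R) (hal : `|al| <= 1) (xs ts : R).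
Local Notation mu := (@lebesgue_measure R).
Implicit Types (phi : R -> R) (th t x k s e : R).
Local Notation symb := (symb al).

Definition sol th t x : R := W al th (t - ts) (x - xs).
Definition soln N th t x : R := Wn al N th (t - ts) (x - xs).

(** The formally self-adjoint spatial operator of the equation; on frequency [k] it is
    multiplication by [symb k]. *)
Definition dual_symb phi x : R := phi^`(4)%classic x - al * phi^`(2)%classic x.

Lemma sol_sq th t : sq_le (sol th t) (12 * pi).
Proof.
apply: (@sq_le_shift _ (W al th (t - ts))).
by split; [exact: measurable_W|exact: W_square_integral].
Qed.

Lemma sol_tail_sq N th t :
  sq_le (fun x => sol th t x - soln N th t x) (12 * pi * N.+1%:R^-1).
Proof.
apply: (@sq_le_shift _ (fun y => W al th (t - ts) y - Wn al N th (t - ts) y)).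
split; last exact: W_tail_square_integral.
by apply: measurable_funB; [exact: measurable_W|exact: measurable_Wn].
Qed.

Lemma soln_sq N th t : exists A, sq_le (soln N th t) A.
Proof.
have := sq_leB (sol_sq th t) (sol_tail_sq N th t).
have -> : (fun x => sol th t x - (sol th t x - soln N th t x)) = soln N th t.
  by apply/funext => x; rewrite opprB addrC subrK.
by move=> h; eexists; exact: h.
Qed.

Definition pair (f phi : R -> R) : R := \int[mu]_x (f x * phi x).

(** The L2 bound of the tail does not depend on [t]. This uniformity allows the truncated pairings
    to be differentiated in time termwise. *)
Lemma pair_cvg th phi e : test_function phi -> 0 < e ->
  exists n0, forall N, (n0 <= N)%N -> forall t,
    `|pair (sol th t) phi - pair (soln N th t) phi| <= e.
Proof.
move=> hphi e0; have [B hB] := test_function_sq hphi.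
have B0 := sq_le_ge0 hB.
(* This weight makes the term in [B] at most [e]; the cut-off then makes the other one at most
   [e]. *)
pose s := (B + 1) / e.
have s0 : 0 < s by rewrite divr_gt0// ltr_wpDl.
have [n0 hn0] := ex_invSn_lt (s * (12 * pi)) e0.
exists n0 => N nN t.
have h1 := sol_sq th t; have [A h2] := soln_sq N th t.
have -> : pair (sol th t) phi - pair (soln N th t) phi =
    \int[mu]_x ((sol th t x - soln N th t x) * phi x).
  rewrite /pair -RintegralB//; last 2 first.
  - exact: sq_le_mul_integrable h1 hB.
  - exact: sq_le_mul_integrable h2 hB.
  by apply: eq_Rintegral => x _; rewrite mulrBl.
apply: (le_trans (norm_pair_le (sol_tail_sq N th t) hB s0)).
have h3 : s^-1 * B <= e.
  rewrite /s invf_div mulrAC ler_pdivrMr; last by rewrite ltr_wpDl.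
  by rewrite ler_pM2l// lerDl.
have h4 : s * (12 * pi * N.+1%:R^-1) <= e.
  rewrite mulrA; apply: le_trans (ltW hn0).
  apply: ler_wpM2l; first by apply: mulr_ge0; [exact: ltW|rewrite mulr_ge0// pi_ge0].
  by rewrite lef_pV2 ?posrE ?ltr0n// ler_nat.
by rewrite ler_pdivrMl// [leRHS]mulr_natl mulr2n lerD.
Qed.

Lemma pair_soln N th t phi : test_function phi ->
  pair (soln N th t) phi =
  rint 1 N.+1%:R (fun k => profile al th (t - ts) k * cos_coef xs phi k).
Proof.
move=> hphi.
have cp : cont_on 1 N.+1%:R (profile al th (t - ts)) by exact: cont_profile.
have := @Rfubini R _ _ (measurableTypeR R) (measurableTypeR R) mu mu setT
  `[1, N.+1%:R]%classic phi (profile al th (t - ts))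
  (fun p => cos ((p.1 - xs) * p.2)) 1 ler01 measurableT (measurable_itv _)
  (test_function_integrable hphi) (cont_on_integrable cp) (measurable_cos_shift xs)
  (fun p => cos_max _).
rewrite /= -/(rint _ _ _) => <-.
apply: eq_Rintegral => x _; rewrite mulrC; congr (_ * _).
by rewrite /soln /Wn wave_cos_transform.
Qed.

Lemma cos_coef_dual phi k : test_function phi ->
  cos_coef xs (dual_symb phi) k = symb k * cos_coef xs phi k.
Proof.
move=> h; have h2 := test_function_deriven 2 h; have h4 := test_function_deriven 4 h.
have ic psi : test_function psi -> mu.-integrable setT
    (EFin \o (fun x => psi x * cos ((x - xs) * k))).
  move=> hp; apply: (integrable_mul_bounded _ (test_function_integrable hp) _ (C := 1)) => //.
    by apply: continuous_measurable_fun => x; cont_der.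
  by move=> x _; exact: cos_max.
have -> : cos_coef xs (dual_symb phi) k =
    cos_coef xs phi^`(4)%classic k - al * cos_coef xs phi^`(2)%classic k.
  rewrite /cos_coef -RintegralZl//; last exact: ic.
  rewrite -RintegralB//; last 2 first.
  - exact: ic.
  - by apply: integrable_scale; exact: ic.
  by apply: eq_Rintegral => x _; rewrite /dual_symb mulrBl mulrA.
have e2 := cos_coef_deriv2 xs k h.
have e4 : cos_coef xs phi^`(4)%classic k = k ^+ 4 * cos_coef xs phi k.
  have -> : (phi^`(4) = (phi^`(2))^`(2))%classic.
    by rewrite /derive1n -iterD.
  rewrite (cos_coef_deriv2 xs k h2) e2; ring.
etransitivity; first exact: (congr2 (fun a b => a - al * b) e4 e2).
by rewrite /symb; ring.
Qed.

Lemma smooth_Ck n (f : R -> R) : smooth f -> Ck n f.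
Proof.
elim: n f => [//|n IH] f sf; exists f^`()%classic.
  by move=> x; exact: (smooth_has_derive 0 x sf).
apply: IH => m x; have -> : (f^`()^`(m))%classic = f^`(m.+1)%classic.
  by rewrite /derive1n iterSr.
exact: sf.
Qed.

Lemma test_function_dual phi : test_function phi -> test_function (dual_symb phi).
Proof.
move=> h; have [s4 [M4 v4]] := test_function_deriven 4 h.
have [s2 [M2 v2]] := test_function_deriven 2 h.
split; last first.
  exists (Num.max M4 M2) => x; rewrite gt_max => /andP[x4 x2].
  by rewrite /dual_symb v4// v2// mulr0 subr0.
apply: Ck_smooth => n.
have -> : dual_symb phi = fun x => phi^`(4)%classic x + (- al) * phi^`(2)%classic x.
  by apply/funext => x; rewrite /dual_symb mulNr.
by apply: CkD; [exact: smooth_Ck|apply: CkM; [exact: Ck_cst|exact: smooth_Ck]].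
Qed.

Lemma pair_soln_der N th phi t : test_function phi ->
  has_derive (fun t => pair (soln N th t) phi) t
    (pair (soln N (th + pi / 2) t) (dual_symb phi)).
Proof.
move=> h; have hd := test_function_dual h.
pose A k := k^-1 * cos_coef xs phi k.
pose kap k := th - ts * symb k.
have cA : cont_on 1 N.+1%:R A.
  move=> k kN; apply: cvgM; last exact: (@cont_cos_coef R xs phi 1 N.+1%:R h k kN).
  have : {for k, continuous (fun k : R => k^-1)}.
    by cont_der; rewrite gt_eqF// (lt_le_trans ltr01)//; case/andP: kN.
  exact.
have cq : cont_on 1 N.+1%:R symb by move=> k _; rewrite /symb; cont_der.
have ck : cont_on 1 N.+1%:R kap by move=> k _; rewrite /kap /symb; cont_der.
have -> : (fun t => pair (soln N th t) phi) =
    fun t => rint 1 N.+1%:R (fun k => A k * cos (kap k + t * symb k)).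
  apply/funext => t'; rewrite pair_soln//; apply: eq_rint => k _.
  rewrite /A /profile /kap; have -> : th - ts * symb k + t' * symb k =
    th + (t' - ts) * symb k by ring.
  ring.
rewrite pair_soln//.
have -> : rint 1 N.+1%:R (fun k => profile al (th + pi / 2) (t - ts) k *
    cos_coef xs (dual_symb phi) k) =
    rint 1 N.+1%:R (fun k => A k * symb k * cos (kap k + pi / 2 + t * symb k)).
  apply: eq_rint => k _; rewrite cos_coef_dual// /A /profile /kap.
  have -> : th - ts * symb k + pi / 2 + t * symb k =
    th + pi / 2 + (t - ts) * symb k by ring.
  ring.
exact: rint_param_derive.
Qed.

Lemma sol_der th phi t : test_function phi ->
  has_derive (fun t => pair (sol th t) phi) t
    (pair (sol (th + pi / 2) t) (dual_symb phi)).
Proof.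
move=> h; have hd := test_function_dual h.
apply: (@has_derive_lim R (fun N t => pair (soln N th t) phi)
  (fun N t => pair (soln N (th + pi / 2) t) (dual_symb phi))
  (fun t => pair (sol th t) phi)
  (fun t => pair (sol (th + pi / 2) t) (dual_symb phi))).
- by move=> N x; exact: pair_soln_der.
- move=> x; apply/cvgrPdist_le => e e0; have [n0 hn] := pair_cvg th h e0.
  by exists n0 => // N /= /hn.
- move=> Y e e0; have [n0 hn] := pair_cvg (th + pi / 2) hd e0.
  by exists n0 => N /hn hN x _.
Qed.

End WeakEquation.

(** * Uniqueness *)

Section Bump.
Context {R : realType}.
Implicit Types (x h : R) (k n : nat).

(* The factor [x^-k] makes this family closed under differentiation. *)
Definition flat k x : R := if 0 < x then x^-1 ^+ k * expR (- x^-1) else 0.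

Lemma has_derive_near (f g : R -> R) x d r : 0 < r ->
  (forall h, `|h| < r -> g (x + h) = f (x + h)) -> has_derive f x d -> has_derive g x d.
Proof.
move=> r0 fg /has_derive_epsP hf; apply/has_derive_epsP => e /hf[s s0 hs].
exists (Num.min r s); first by rewrite lt_min r0.
move=> h; rewrite lt_min => /andP[hr hs']; rewrite (fg h hr).
have := fg 0; rewrite normr0 addr0 => /(_ r0) ->; exact: hs.
Qed.

Lemma expR_ge_pow n x : 0 <= x -> (x / n.+1%:R) ^+ n.+1 <= expR x.
Proof.
move=> x0; have -> : expR x = expR (x / n.+1%:R) ^+ n.+1.
  by rewrite -expRM_natl mulrC divfK// pnatr_eq0.
have x1 : 0 <= x / n.+1%:R by rewrite divr_ge0.
by apply: lerXn2r; rewrite ?nnegrE// ?expR_ge0// (le_trans _ (expR_ge1Dx _))// lerDr.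
Qed.

(** The exponential beats the power [k + 2] of [h^-1]; the two spare powers give derivative 0 at the
    origin. *)
Lemma flat_le k h : `|flat k h| <= k.+2%:R ^+ k.+2 * h ^+ 2.
Proof.
rewrite /flat; case: ifPn => h0; last first.
  by rewrite normr0; apply: mulr_ge0; [exact: exprn_ge0|exact: sqr_ge0].
have i0 : 0 < h^-1 by rewrite invr_gt0.
rewrite ger0_norm; last by rewrite mulr_ge0 ?expR_ge0// exprn_ge0// ltW.
have := expR_ge_pow k.+1 (ltW i0); rewrite expRN.
have E0 := expR_gt0 h^-1; rewrite ler_pdivrMr// expr_div_n ler_pdivrMr ?exprn_gt0// => H.
have -> : h^-1 ^+ k = h ^+ 2 * h^-1 ^+ k.+2.
  by rewrite -[k.+2]addn2 exprD mulrCA -exprMn mulfV ?gt_eqF// expr1n mulr1.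
rewrite -[leRHS]mulrA [leRHS]mulrCA; apply: ler_wpM2l; first exact: sqr_ge0.
by rewrite mulrC.
Qed.

Lemma flat_der k x :
  has_derive (flat k) x (- k%:R * flat k.+1 x + flat k.+2 x).
Proof.
have [x0|x0|<-] := ltgtP 0 x.
- apply: (@has_derive_near (fun x => x^-1 ^+ k * expR (- x^-1)) _ x _ x x0).
    move=> h; rewrite ltr_norml => /andP[h1 _]; rewrite /flat ifT//; lra.
  have xn : x != 0 by rewrite gt_eqF.
  der => //; rewrite /flat x0; case: k => [|k] /=; first by field.
  rewrite -!exprVn; move: (expR (- x^-1)) => E; move: x^-1 => y; rewrite !exprS; ring.
- rewrite /flat !ifN -?leNgt ?(ltW x0)// mulr0 addr0.
  apply: (@has_derive_near (fun=> 0) _ x _ (- x)); first by rewrite oppr_gt0.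
    move=> h; rewrite ltr_norml => /andP[_ h1]; rewrite /flat ifN// -leNgt; lra.
  exact: der_cst.
- have f0 j : flat j 0 = 0 by rewrite /flat ltxx.
  rewrite !f0 mulr0 addr0; apply: (@has_derive_quadratic _ _ _ _ (k.+2%:R ^+ k.+2)) => h.
  by rewrite add0r f0 subr0 mulr0 subr0; exact: flat_le.
Qed.

Lemma Ck_flat n k : Ck n (flat k).
Proof.
elim: n k => [//|n IH] k; exists (fun x => - k%:R * flat k.+1 x + flat k.+2 x).
  exact: flat_der.
by apply: CkD; [apply: CkM; [exact: Ck_cst|exact: IH]|exact: IH].
Qed.

(** The factor [expR 2] normalises the value at 0 to 1, so that [bump (r * x)] tends to 1 as [r]
    tends to 0. *)
Definition bump x : R := expR 2 * (flat 0 (1 + x) * flat 0 (1 - x)).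

Lemma bump_support x : 1 < `|x| -> bump x = 0.
Proof.
rewrite ltr_normr => /orP[x1|x1]; rewrite /bump /flat.
  by rewrite [in X in _ * (_ * X)]ifN ?mulr0// -leNgt; lra.
by rewrite ifN ?mul0r ?mulr0// -leNgt; lra.
Qed.

Lemma bump0 : bump 0 = 1.
Proof.
rewrite /bump /flat addr0 subr0 ltr01 expr0 mul1r invr1 -!expRD.
by rewrite (_ : 2 + _ = 0) ?expR0//; ring.
Qed.

Lemma Ck_bump n : Ck n bump.
Proof.
apply: CkM; first exact: Ck_cst.
apply: CkM.
  have -> : (fun x => flat 0 (1 + x)) = (fun x => flat 0 (1 * x + 1)).
    by apply/funext => x; rewrite mul1r addrC.
  by apply: (@Ck_affine R n (flat 0) 1 1); exact: Ck_flat.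
have -> : (fun x => flat 0 (1 - x)) = (fun x => flat 0 (- 1 * x + 1)).
  by apply/funext => x; rewrite mulN1r addrC.
by apply: (@Ck_affine R n (flat 0) (- 1) 1); exact: Ck_flat.
Qed.

Lemma bump_test : test_function bump.
Proof. by split; [apply: Ck_smooth; exact: Ck_bump|exists 1; exact: bump_support]. Qed.

Lemma test_function_bounded (phi : R -> R) : test_function phi ->
  exists2 C : R, 0 < C & forall x, `|phi x| <= C.
Proof.
move=> h; have [M M0 hM] := test_function_support h.
have cp : cont_on (- M) M (fun x => `|phi x|).
  move=> x xM; apply: continuous_comp; first exact: (test_function_cont h xM).
  exact: norm_continuous.
have MM : - M <= M by lra.
have [c _ hc] := EVT_max MM (cont_on_within cp).
exists (`|phi c| + 1); first by rewrite ltr_wpDl.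
move=> x; have [xM|xM] := leP `|x| M.
  rewrite (le_trans (hc x _)) ?lerDl//.
  by rewrite in_itv/= -ler_norml.
by rewrite (hM x (ltW xM)).1 normr0 addr_ge0.
Qed.

End Bump.

(** * Wave packets under the spatial operator *)

Section WavePacket.
Context {R : realType} (al : R) (hal : `|al| <= 1).
Local Notation mu := (@lebesgue_measure R).
Local Notation symb := (symb al).
Local Notation dual_symb := (dual_symb al).
Implicit Types (phi : R -> R) (r kap xi x t : R).

(** [j] derivatives have fallen on the window and [m] on the wave, the latter as shifts by [pi / 2];
    the powers of [r] and [xi] stay outside. *)
Definition packet_term (j m : nat) r kap xi x : R :=
  (@bump R)^`(j)%classic (r * x) * cos (kap + m%:R * (pi / 2) + xi * x).

Definition packet r kap xi x : R := bump (r * x) * cos (kap + xi * x).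

(** The Leibniz terms of orders 4 and 2 in which the window is differentiated at least once, with
    one factor [r] taken out. *)
Definition packet_rem r kap xi x : R :=
  let T j m := packet_term j m r kap xi x in
  r ^+ 3 * T 4 0 + 4 * r ^+ 2 * xi * T 3 1 + 6 * r * xi ^+ 2 * T 2 2 +
  4 * xi ^+ 3 * T 1 3 - al * (r * T 2 0 + 2 * xi * T 1 1).

Lemma bump_deriv_support j x : 1 < `|x| -> (@bump R)^`(j)%classic x = 0.
Proof.
elim: j x => [|j IH] x; first exact: bump_support.
rewrite derive1nS; apply: derive_vanish; last exact: IH.
by have [] := test_function_deriven j (@bump_test R).
Qed.

Lemma packet_term_der j m r kap xi x :
  has_derive (packet_term j m r kap xi) x
    (r * packet_term j.+1 m r kap xi x + xi * packet_term j m.+1 r kap xi x).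
Proof.
have [sb _] := @bump_test R.
have hb : has_derive (fun x => bump^`(j)%classic (r * x)) x
    (bump^`(j.+1)%classic (r * x) * r).
  apply: (@der_comp R _ (fun x => r * x)); first exact: smooth_has_derive.
  by der => /=; ring.
have hc : has_derive (fun x => cos (kap + m%:R * (pi / 2) + xi * x)) x
    (xi * cos (kap + m.+1%:R * (pi / 2) + xi * x)).
  der; rewrite /=; have -> : kap + m.+1%:R * (pi / 2) + xi * x =
    (kap + m%:R * (pi / 2) + xi * x) + pi / 2 by rewrite -natr1; ring.
  by rewrite cosDpihalf; ring.
apply: (has_derive_eq (derM hb hc)); rewrite /packet_term.
move: (bump^`(j)%classic (r * x)) (bump^`(j.+1)%classic (r * x)) => u v; ring.
Qed.

Lemma derive_product_family (T : nat -> nat -> R -> R) r xi :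
  (forall j m z, has_derive (T j m) z (r * T j.+1 m z + xi * T j m.+1 z)) ->
  ((T 0 0)^`(2)%classic = fun z =>
     r ^+ 2 * T 2 0 z + 2 * r * xi * T 1 1 z + xi ^+ 2 * T 0 2 z) /\
  ((T 0 0)^`(4)%classic = fun z =>
     r ^+ 4 * T 4 0 z + 4 * r ^+ 3 * xi * T 3 1 z +
     6 * r ^+ 2 * xi ^+ 2 * T 2 2 z + 4 * r * xi ^+ 3 * T 1 3 z +
     xi ^+ 4 * T 0 4 z).
Proof.
move=> hT.
pose g1 z := r * T 1 0 z + xi * T 0 1 z.
pose g2 z := r ^+ 2 * T 2 0 z + 2 * r * xi * T 1 1 z + xi ^+ 2 * T 0 2 z.
pose g3 z := r ^+ 3 * T 3 0 z + 3 * r ^+ 2 * xi * T 2 1 z +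
  3 * r * xi ^+ 2 * T 1 2 z + xi ^+ 3 * T 0 3 z.
pose g4 z := r ^+ 4 * T 4 0 z + 4 * r ^+ 3 * xi * T 3 1 z +
  6 * r ^+ 2 * xi ^+ 2 * T 2 2 z + 4 * r * xi ^+ 3 * T 1 3 z + xi ^+ 4 * T 0 4 z.
have E1 : (T 0 0)^`()%classic = g1 by apply: has_derive1 => z; exact: hT.
have E2 : g1^`()%classic = g2.
  apply: has_derive1 => z; rewrite /g1; der; [exact: hT|exact: hT|].
  by rewrite /g2 /=; ring.
have E3 : g2^`()%classic = g3.
  apply: has_derive1 => z; rewrite /g2; der; [exact: hT|exact: hT|exact: hT|].
  by rewrite /g3 /=; ring.
have E4 : g3^`()%classic = g4.
  apply: has_derive1 => z; rewrite /g3; der; [exact: hT|exact: hT|exact: hT|exact: hT|].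
  by rewrite /g4 /=; ring.
by rewrite /derive1n /= E1 E2 E3 E4.
Qed.

Lemma packet_dual r kap xi x :
  dual_symb (packet r kap xi) x =
  symb xi * packet r kap xi x + r * packet_rem r kap xi x.
Proof.
have E0 : packet r kap xi = packet_term 0 0 r kap xi.
  by apply/funext => z; rewrite /packet /packet_term mul0r addr0.
have [e2 e4] := @derive_product_family (fun j m => packet_term j m r kap xi) r xi
  (fun j m z => packet_term_der j m r kap xi z).
have T2 : packet_term 0 2 r kap xi x = - packet_term 0 0 r kap xi x.
  rewrite /packet_term mul0r addr0 -mulrN; congr (_ * _).
  by rewrite -cosDpi; congr cos; field.
have T4 : packet_term 0 4 r kap xi x = packet_term 0 0 r kap xi x.
  rewrite /packet_term mul0r addr0; congr (_ * _).
  by rewrite -[RHS]opprK -cosDpi -cosDpi; congr cos; field.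
rewrite /dual_symb E0 e2 e4 T2 T4 /packet_rem /symb.
move: (packet_term 0 0 r kap xi x) (packet_term 4 0 r kap xi x)
  (packet_term 3 1 r kap xi x) (packet_term 2 2 r kap xi x)
  (packet_term 1 3 r kap xi x) (packet_term 2 0 r kap xi x)
  (packet_term 1 1 r kap xi x) => a b c d e f g; ring.
Qed.

Lemma packet_test r kap xi : 0 < r -> test_function (packet r kap xi).
Proof.
move=> r0; split.
  apply: Ck_smooth => n; apply: CkM; last exact: Ck_cos.
  have := @Ck_affine R n bump r 0 (Ck_bump n).
  by congr Ck; apply/funext => x; rewrite addr0.
exists r^-1 => x rx; rewrite /packet bump_support ?mul0r//.
by rewrite normrM gtr0_norm// -ltr_pdivrMl// mulr1.
Qed.

(** The function is bounded by a multiple of [r] and supported on a length [2 / r], so its squared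
    norm is O(r). *)
Lemma packet_rem_sq la : 0 <= la -> exists2 K : R, 0 <= K & forall r kap xi,
  0 < r <= 1 -> 0 <= xi <= la ->
  sq_le (fun x => r * packet_rem r kap xi x) (K * r).
Proof.
move=> la0.
have hb j : exists2 C : R, 0 < C & forall x, `|(@bump R)^`(j)%classic x| <= C.
  by apply: test_function_bounded; exact: test_function_deriven (@bump_test R).
have [C1 p1 h1] := hb 1%N; have [C2 p2 h2] := hb 2%N.
have [C3 p3 h3] := hb 3%N; have [C4 p4 h4] := hb 4%N.
pose K := C4 + 4 * la * C3 + 6 * la ^+ 2 * C2 + 4 * la ^+ 3 * C1 + (C2 + 2 * la * C1).
have l2 : 0 <= la ^+ 2 by exact: exprn_ge0.
have l3 : 0 <= la ^+ 3 by exact: exprn_ge0.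
have K0 : 0 <= K.
  rewrite /K; do ![apply: addr_ge0]; try exact: ltW; apply: mulr_ge0; try exact: ltW;
    exact: mulr_ge0.
exists (2 * K ^+ 2); first by apply: mulr_ge0 => //; exact: exprn_ge0.
move=> r kap xi /andP[r0 r1] /andP[x0 xl].
have ub j m C x : (forall x, `|(@bump R)^`(j)%classic x| <= C) ->
    `|packet_term j m r kap xi x| <= C.
  move=> hC; rewrite normrM (le_trans _ (hC (r * x)))//.
  by rewrite ler_piMr// cos_max.
have mon (c a C u : R) : 0 <= c <= a -> 0 < C -> `|u| <= C -> `|c * u| <= a * C.
  move=> /andP[c0 ca] C0 uC; rewrite normrM (ger0_norm c0).
  by apply: ler_pM.
have pr (m : nat) (c : R) : 0 <= c -> 0 <= c * r ^+ m <= c.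
  move=> c0; rewrite mulr_ge0 ?exprn_ge0 ?(ltW r0)//=.
  by rewrite ler_piMr// exprn_ile1 ?(ltW r0).
have px (m : nat) : 0 <= xi ^+ m <= la ^+ m.
  by rewrite exprn_ge0//=; apply: lerXn2r.
have remK x : `|packet_rem r kap xi x| <= K.
  rewrite /packet_rem /K; apply: normB_le; last first.
    rewrite normrM (le_trans (ler_wpM2r _ hal))// mul1r; apply: normD_le.
      by rewrite -[leRHS]mul1r; apply: mon; [rewrite (ltW r0)|exact: p2|exact: ub].
    apply: mon; [|exact: p1|exact: ub].
    by rewrite mulr_ge0// ler_wpM2l.
  apply: normD_le; last first.
    apply: mon; [|exact: p1|exact: ub].
    by have /andP[? ?] := px 3%N; rewrite mulr_ge0// ler_wpM2l.
  apply: normD_le; last first.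
    apply: mon; [|exact: p2|exact: ub].
    have /andP[? ?] := px 2%N; rewrite !mulr_ge0 ?(ltW r0)//=.
    by apply: ler_pM; rewrite ?mulr_ge0 ?(ltW r0)// -[leRHS]mulr1 ler_wpM2l.
  apply: normD_le; last first.
    apply: mon; [|exact: p3|exact: ub].
    have /andP[u1 u2] := pr 2%N 4 (ler0n _ 4); rewrite mulr_ge0//=.
    exact: ler_pM.
  rewrite -[leRHS]mul1r; apply: mon; [|exact: p4|exact: ub].
  by have := pr 3%N 1 ler01; rewrite mul1r.
have supp x : r^-1 < `|x| -> r * packet_rem r kap xi x = 0.
  move=> rx; have rx1 : 1 < `|r * x|.
    by rewrite normrM gtr0_norm// -ltr_pdivrMl// mulr1.
  have z j m : packet_term j m r kap xi x = 0.
    by rewrite /packet_term bump_deriv_support// mul0r.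
  by rewrite /packet_rem !z; ring.
have cT j m x : {for x, continuous (packet_term j m r kap xi)}.
  by apply: has_derive_continuous; exact: packet_term_der.
have cc : cont_on (- r^-1) r^-1 (fun x => r * packet_rem r kap xi x).
  move=> x _; apply: cvgM; first exact: cvg_cst.
  have cZ c j m : {for x, continuous (fun x => c * packet_term j m r kap xi x)}.
    by apply: cvgM; [exact: cvg_cst|exact: cT].
  rewrite /packet_rem; apply: cvgB; last first.
    by apply: cvgM; [exact: cvg_cst|apply: cvgD; exact: cZ].
  by do 3![apply: cvgD; last exact: cZ]; exact: cZ.
have [mf hf] := support_sq_le cc supp; split => //.
apply: (le_trans hf); rewrite lee_fin.
have V0 : 0 < r^-1 by rewrite invr_gt0.
have VV : - r^-1 <= r^-1 by lra.
have -> : 2 * K ^+ 2 * r = rint (- r^-1) r^-1 (fun=> (r * K) ^+ 2).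
  by rewrite rint_cst//; field; rewrite gt_eqF.
apply: le_rint.
- by move=> x xr; apply: cvgM; exact: cc.
- by move=> x _; exact: cvg_cst.
- move=> x _; rewrite -[leLHS]real_normK ?num_real//; apply: lerXn2r; rewrite ?nnegrE//.
    by rewrite mulr_ge0// ltW.
  by rewrite normrM gtr0_norm// ler_wpM2l// ltW.
Qed.

End WavePacket.

Section WeakSystem.
Context {R : realType} (al : R) (hal : `|al| <= 1).
Local Notation mu := (@lebesgue_measure R).
Local Notation symb := (symb al).
Implicit Types (phi v w : R -> R) (r kap xi x y t la A B : R).

(** The distributional equation for [w1 + i w2], split into real and imaginary parts. *)
Definition weak_system (w1 w2 : R -> R -> R) : Prop :=
  forall phi, test_function phi -> forall t,
    has_derive (fun t => pair (w1 t) phi) t (- pair (w2 t) (dual_symb al phi)) /\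
    has_derive (fun t => pair (w2 t) phi) t (pair (w1 t) (dual_symb al phi)).

Lemma pair_packet_dual w A K r kap xi : 0 < r -> sq_le w A ->
  sq_le (fun x => r * packet_rem al r kap xi x) K ->
  pair w (dual_symb al (packet r kap xi)) = symb xi * pair w (packet r kap xi) +
    pair w (fun x => r * packet_rem al r kap xi x).
Proof.
move=> r0 hw hK; have [B hB] := test_function_sq (packet_test kap xi r0).
have iB := sq_le_mul_integrable hw hB; have iK := sq_le_mul_integrable hw hK.
rewrite /pair -RintegralZl// -RintegralD//; last exact: integrable_scale.
by apply: eq_Rintegral => x _; rewrite packet_dual; ring.
Qed.

(* Up to an error of size rho, the pairing of (w1, w2) with a wave packet of
   frequency xi rotates at the angular speed symb xi. *)
Lemma packet_small (w1 w2 : R -> R -> R) A : (forall t, sq_le (w1 t) A) -> (forall t, sq_le (w2 t) A) ->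
  weak_system w1 w2 ->
  (forall phi, test_function phi -> pair (w1 0) phi = 0 /\ pair (w2 0) phi = 0) ->
  forall t la, 0 <= la -> exists2 C : R, 0 <= C & forall rho kap xi,
    0 < rho <= 1 -> 0 <= xi <= la ->
    `|pair (w1 t) (packet (rho ^+ 2) kap xi)| <= C * rho /\
    `|pair (w2 t) (packet (rho ^+ 2) kap xi)| <= C * rho.
Proof.
move=> hw1 hw2 hw w0 t la la0.
have [K K0 hK] := packet_rem_sq hal la0.
have A0 := sq_le_ge0 (hw1 0).
exists (2 * (A + K) * `|t|).
  by apply: mulr_ge0 => //; apply: mulr_ge0 => //; exact: addr_ge0.
move=> rho kap xi /andP[rho0 rho1] xil.
have r0 : 0 < rho ^+ 2 by exact: exprn_gt0.
have r1 : rho ^+ 2 <= 1 by rewrite exprn_ile1// ltW.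
have hrem : sq_le (fun x => rho ^+ 2 * packet_rem al (rho ^+ 2) kap xi x)
    (K * rho ^+ 2) by apply: hK; rewrite ?r0.
pose phi := packet (rho ^+ 2) kap xi.
pose rem x := rho ^+ 2 * packet_rem al (rho ^+ 2) kap xi x.
pose p := symb xi.
have tphi : test_function phi by exact: packet_test.
(* The remainder has squared norm [K rho^2]; the weight [rho] in [norm_pair_le] makes both terms
   linear in [rho]. *)
have small w : sq_le w A -> `|pair w rem| <= 2^-1 * ((A + K) * rho).
  move=> h; have := norm_pair_le h hrem rho0.
  by congr (_ <= _); field; rewrite gt_eqF.
pose a s := pair (w1 s) phi; pose b s := pair (w2 s) phi.
pose e1 s := pair (w1 s) rem; pose e2 s := pair (w2 s) rem.
have da s : has_derive a s (- (p * b s + e2 s)).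
  have [h _] := hw _ tphi s; apply: (has_derive_eq h); congr (- _).
  exact: pair_packet_dual (hw2 s) hrem.
have db s : has_derive b s (p * a s + e1 s).
  have [_ h] := hw _ tphi s; apply: (has_derive_eq h).
  exact: pair_packet_dual (hw1 s) hrem.
(* In the rotating frame [g + i h = exp (- i p s) (a + i b)] only the remainders are left in the
   derivatives. *)
pose g s := a s * cos (p * s) + b s * sin (p * s).
pose h s := b s * cos (p * s) + - (a s * sin (p * s)).
pose dg s := - (e2 s * cos (p * s)) + e1 s * sin (p * s).
pose dh s := e1 s * cos (p * s) + e2 s * sin (p * s).
have hg s : has_derive g s (dg s).
  rewrite /g; der; [exact: da|exact: db|].
  by rewrite /dg /=; ring.
have hh s : has_derive h s (dh s).
  rewrite /h; der; [exact: db|exact: da|].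
  by rewrite /dh /=; ring.
pose M := (A + K) * rho.
have M0 : 0 <= M by rewrite mulr_ge0 ?addr_ge0// ltW.
have trig (u c : R) : `|u| <= 2^-1 * M -> `|c| <= 1 -> `|u * c| <= 2^-1 * M.
  move=> hu hc; rewrite normrM (le_trans _ hu)// ler_piMr//.
have hdg s : `|dg s| <= M.
  rewrite /dg; have -> : M = 2^-1 * M + 2^-1 * M by field.
  apply: normD_le; first rewrite normrN; apply: trig; rewrite ?cos_max ?sin_max//.
  - exact: small.
  - exact: small.
have hdh s : `|dh s| <= M.
  rewrite /dh; have -> : M = 2^-1 * M + 2^-1 * M by field.
  apply: normD_le; apply: trig; rewrite ?cos_max ?sin_max//.
  - exact: small.
  - exact: small.
have [a0 b0] := w0 _ tphi.
have gt : `|g t| <= M * `|t|.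
  have := @norm_derive_le_sym R g dg 0 t M (fun z _ => hg z) (fun z _ => hdg z).
  by rewrite add0r [g 0]/g /a /b a0 b0 !mul0r addr0 subr0.
have ht : `|h t| <= M * `|t|.
  have := @norm_derive_le_sym R h dh 0 t M (fun z _ => hh z) (fun z _ => hdh z).
  by rewrite add0r [h 0]/h /a /b a0 b0 !mul0r oppr0 addr0 subr0.
have mt (u c : R) : `|u| <= M * `|t| -> `|c| <= 1 -> `|u * c| <= M * `|t|.
  move=> hu hc; rewrite normrM (le_trans _ hu)// ler_piMr//.
have cs := cos2Dsin2 (p * t).
have -> : 2 * (A + K) * `|t| * rho = M * `|t| + M * `|t| by rewrite /M; ring.
rewrite -/(a t) -/(b t).
have -> : a t = g t * cos (p * t) - h t * sin (p * t).
  have -> : g t * cos (p * t) - h t * sin (p * t) =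
    a t * (cos (p * t) ^+ 2 + sin (p * t) ^+ 2) by rewrite /g /h; ring.
  by rewrite cs mulr1.
have -> : b t = g t * sin (p * t) + h t * cos (p * t).
  have -> : g t * sin (p * t) + h t * cos (p * t) =
    b t * (cos (p * t) ^+ 2 + sin (p * t) ^+ 2) by rewrite /g /h; ring.
  by rewrite cs mulr1.
by split; [apply: normB_le|apply: normD_le]; apply: mt; rewrite ?cos_max ?sin_max.
Qed.

(** By Fubini, an average of small pairings is small. The Lipschitz bound makes the inner integral
    continuous in [y]; it carries the factor [v x] because [cos ((x - y) xi)] is Lipschitz in [xi]
    uniformly only for bounded [x]. *)
Lemma kernel_average_le v (h : R -> R) (k : measurableTypeR R * measurableTypeR R -> R)
    (c d C L B : R) :
  mu.-integrable setT (EFin \o v) -> c <= d -> cont_on c d h ->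
  (forall y, c <= y <= d -> `|h y| <= 1) ->
  0 <= C -> measurable_fun setT k -> (forall z, `|k z| <= C) ->
  (forall x y y', `|v x * (k (x, y) - k (x, y'))| <= `|v x| * L * `|y - y'|) ->
  (forall y, c <= y <= d -> `|\int[mu]_x (v x * k (x, y))| <= B) ->
  `|\int[mu]_x (v x * rint c d (fun y => h y * k (x, y)))| <= B * (d - c).
Proof.
move=> iv cd ch h1 C0 mk kC kL hB.
have mky y : measurable_fun setT (fun x : measurableTypeR R => k (x, y)).
  by apply: (measurableT_comp mk); exact: measurable_fun_pair.
have ik y : mu.-integrable setT (EFin \o (fun x => v x * k (x, y))).
  by apply: (integrable_mul_bounded _ iv _ (C := C)).
pose m y := \int[mu]_x (v x * k (x, y)).
have cm : cont_on c d m.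
  move=> y _; apply: (@lipschitz_continuous R m ((\int[mu]_x `|v x|) * L) y) => y'.
  have iB := integrableB measurableT (ik y) (ik y').
  rewrite /m -RintegralB//; apply: (le_trans (le_normr_Rintegral _ _)) => //.
  have ia : mu.-integrable setT (EFin \o (fun x => `|v x|)) by exact: integrable_norm iv.
  have -> : (\int[mu]_x `|v x|) * L * `|y - y'| =
    \int[mu]_x ((L * `|y - y'|) * `|v x|).
    by rewrite RintegralZl//; ring.
  apply: le_Rintegral => //.
  - exact: integrable_norm iB.
  - exact: integrable_scale.
  - move=> x _; have -> : L * `|y - y'| * `|v x| = `|v x| * L * `|y - y'| by ring.
    by rewrite -mulrBr; exact: kL.
have := @Rfubini R _ _ (measurableTypeR R) (measurableTypeR R) mu mu setT
  `[c, d]%classic v h k C C0 measurableT (measurable_itv _) iv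
  (cont_on_integrable ch) mk kC.
rewrite /rint => ->; rewrite -/(rint c d (fun y => h y * m y)).
rewrite -[leRHS](rint_cst B cd).
apply: norm_rint_le => //.
- by move=> y yab; apply: cvgM; [exact: ch|exact: cm].
- by move=> y _; exact: cvg_cst.
- move=> y yab; rewrite normrM (le_trans _ (hB y yab))//.
  by rewrite ler_piMl// h1.
Qed.

Definition fejer_mass la (a b : R) x : R := rint a b (fun y => fejer la (x - y)).

Lemma bump_window w A r : 0 < r -> sq_le w A ->
  mu.-integrable setT (EFin \o (fun x => w x * bump (r * x))).
Proof.
move=> r0 hw; have [B hB] := test_function_sq (packet_test 0 0 r0).
apply: eq_integrable (sq_le_mul_integrable hw hB) => // x _ /=.
by rewrite /packet mul0r addr0 cos0 mulr1.
Qed.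

Lemma fejer_mass_small w A r la B (a b : R) : 0 < r -> sq_le w A -> 0 < la ->
  (forall kap xi, 0 <= xi <= la -> `|pair w (packet r kap xi)| <= B) -> a <= b ->
  `|\int[mu]_x (w x * bump (r * x) * fejer_mass la a b x)| <= B * la * (b - a).
Proof.
move=> r0 hw la0 hB ab; have iv := bump_window r0 hw.
pose v x := w x * bump (r * x).
have vs x : r^-1 < `|x| -> v x = 0.
  move=> rx; rewrite /v bump_support ?mulr0//.
  by rewrite normrM gtr0_norm// -ltr_pdivrMl// mulr1.
have small y : `|\int[mu]_x (v x * fejer la (x - y))| <= B * la.
  pose k (z : measurableTypeR R * measurableTypeR R) : R := cos ((z.1 - y) * z.2).
  have := @kernel_average_le v (fun xi => 1 - xi / la) k 0 la 1 (r^-1 + `|y|) B iv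
    (ltW la0) _ _ ler01.
  rewrite subr0; have -> : (fun x => v x * rint 0 la (fun xi => (1 - xi / la) *
    k (x, xi))) = (fun x => v x * fejer la (x - y)) by [].
  apply.
  - by move=> xi _; cont_der.
  - move=> xi /andP[xi0 xil]; have h1 : xi / la <= 1 by rewrite ler_pdivrMr// mul1r.
    have h0 : 0 <= xi / la by rewrite divr_ge0// ltW.
    by rewrite ger0_norm; lra.
  - exact: measurable_cos_shift.
  - by move=> z; exact: cos_max.
  (* [v] vanishes outside the window, and inside it [|x - y| <= r^-1 + |y|]. *)
  - move=> x xi xi'; have [rx|rx] := ltP r^-1 `|x|.
      by rewrite vs// !mul0r normr0 !mul0r.
    rewrite normrM -mulrA; apply: ler_wpM2l => //; rewrite /k /=.
    rewrite (le_trans (cos_lipschitz _ _))// -mulrBr normrM; apply: ler_wpM2r => //.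
    exact: normB_le.
  - move=> xi xil; have -> : \int[mu]_x (v x * k (x, xi)) =
        pair w (packet r (- (xi * y)) xi).
      apply: eq_Rintegral => x _; rewrite /v /k /packet /= mulrA; congr (_ * cos _).
      ring.
    exact: hB.
pose k (z : measurableTypeR R * measurableTypeR R) : R := fejer la (z.1 - z.2).
have := @kernel_average_le v (fun=> 1) k a b (3 * la) (la ^+ 2) (B * la) iv ab.
have -> : (fun x => v x * rint a b (fun y => 1 * k (x, y))) =
    (fun x => w x * bump (r * x) * fejer_mass la a b x).
  apply/funext => x; congr (_ * _); apply: eq_rint => y _; rewrite mul1r//.
apply.
- by move=> xi _; exact: cvg_cst.
- by move=> y _; rewrite normr1.
- by rewrite mulr_ge0// ltW.
- by apply: (measurableT_comp (measurable_fejer la0)); exact: measurable_funB.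
- by move=> z; exact: fejer_bound.
- move=> x y y'; rewrite normrM -mulrA; apply: ler_wpM2l => //.
  rewrite /k/= (le_trans (fejer_lipschitz _ _ la0))//.
  have -> : x - y - (x - y') = y' - y by ring.
  by rewrite distrC.
- by move=> y _; exact: small.
Qed.

End WeakSystem.

(** * Fejer averages of an interval *)

Section FejerMass.
Context {R : realType}.
Local Notation mu := (@lebesgue_measure R).
Implicit Types (a b x y la z : R).

Lemma fejerN la z : fejer la (- z) = fejer la z.
Proof. by apply: eq_rint => u _; rewrite mulNr cosN. Qed.

Lemma fejer_scale la z : 0 < la -> fejer la z = la * fejer 1 (la * z).
Proof.
move=> l0; have ln : la != 0 by rewrite gt_eqF.
have [->|z0] := eqVneq z 0; first by rewrite mulr0 !fejer_at0// mul1r.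
rewrite !fejerE//; last by rewrite mulf_neq0.
by rewrite !mul1r; field; rewrite ?z0 ?ln.
Qed.

Lemma fejer_continuous la z : 0 < la -> {for z, continuous (fejer la)}.
Proof.
move=> l0; apply: (@lipschitz_continuous R (fejer la) (la ^+ 2)) => y.
exact: fejer_lipschitz.
Qed.

Lemma cont_fejer_mass_integrand la x a b : 0 < la ->
  cont_on a b (fun y => fejer la (x - y)).
Proof.
move=> l0 y _; apply: (@continuous_comp _ _ _ (fun y => x - y) (fejer la)).
  by have : {for y, continuous (fun y => x - y)} by cont_der.
exact: fejer_continuous.
Qed.

Definition fejer_prim (v : R) : R := rint 0 v (fejer 1).

(** Integrating from -1 puts 0 in the interior, so that the primitive has a two-sided derivative
    there as well. *)
Lemma fejer_prim_shift v : 0 <= v ->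
  fejer_prim v = rint (-1) v (fejer 1) - rint (-1) 0 (fejer 1).
Proof.
move=> v0; rewrite (@rint_split _ 0 (-1) v) ?v0 ?lerN10//.
  by rewrite addrC addKr.
by move=> z _; exact: fejer_continuous.
Qed.

Lemma rint_der (f : R -> R) c x : (forall z, {for z, continuous f}) -> c < x ->
  has_derive (fun v => rint c v f) x (f x).
Proof.
move=> cf cx.
have fi : mu.-integrable [set` Interval (BLeft c) (BRight (x + 1))] (EFin \o f).
  by apply: cont_on_integrable => z _; exact: cf.
have xx : x < x + 1 by rewrite ltrDl.
have [dF dE] := continuous_FTC1_closed xx fi cx (cf x).
by split; [exact: dF|rewrite -derive1E; exact: dE].
Qed.

Lemma fejer_mass_inside la a b x : 0 < la -> a <= x <= b ->
  fejer_mass la a b x = fejer_prim (la * (x - a)) + fejer_prim (la * (b - x)).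
Proof.
move=> l0 /andP[ax xb]; have cf1 z : {for z, continuous (fejer 1 : R -> R)}.
  exact: fejer_continuous.
have cc c d : cont_on c d (fun y => fejer la (x - y)).
  exact: cont_fejer_mass_integrand.
have dP (v : R) : 0 <= v -> has_derive (fun v => rint (-1) v (fejer 1)) v (fejer 1 v).
  by move=> v0; apply: rint_der => //; rewrite (lt_le_trans _ v0)// ltrN10.
have left : rint a x (fun y => fejer la (x - y)) = fejer_prim (la * (x - a)).
  rewrite (@rint_FTC _ (fun y => - rint (-1) (la * (x - y)) (fejer 1)) _ _ _ ax (cc _ _)).
    rewrite fejer_prim_shift; last by rewrite mulr_ge0 ?subr_ge0// ltW.
    by rewrite subrr mulr0 opprK addrC.
  move=> y /andP[ay yx].
  have hc : has_derive (fun y => rint (-1) (la * (x - y)) (fejer 1)) y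
      (fejer 1 (la * (x - y)) * (- la)).
    apply: (@der_comp R (fun v => rint (-1) v (fejer 1)) (fun y => la * (x - y))).
      by apply: dP; rewrite mulr_ge0 ?subr_ge0// ltW.
    by der => /=; ring.
  apply: (has_derive_eq (derN hc)); rewrite (fejer_scale _ l0).
  by rewrite mulrN opprK mulrC.
have right : rint x b (fun y => fejer la (x - y)) = fejer_prim (la * (b - x)).
  rewrite (@rint_FTC _ (fun y => rint (-1) (la * (y - x)) (fejer 1)) _ _ _ xb (cc _ _)).
    rewrite fejer_prim_shift; last by rewrite mulr_ge0 ?subr_ge0// ltW.
    by rewrite subrr mulr0.
  move=> y /andP[xy yb].
  have hc : has_derive (fun y => rint (-1) (la * (y - x)) (fejer 1)) y
      (fejer 1 (la * (y - x)) * la).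
    apply: (@der_comp R (fun v => rint (-1) v (fejer 1)) (fun y => la * (y - x))).
      by apply: dP; rewrite mulr_ge0 ?subr_ge0// ltW.
    by der => /=; ring.
  by apply: (has_derive_eq hc); rewrite -[fejer la _]fejerN opprB (fejer_scale _ l0) mulrC.
rewrite -left -right; apply: rint_split; first by rewrite ax.
exact: cc.
Qed.

(* The limit is [pi / 2], but only its positivity matters. *)
Lemma fejer_prim_lim : exists2 c : R, 0 < c & forall d, 0 < d ->
  (fun n : nat => fejer_prim (n.+1%:R * d)) @ \oo --> c.
Proof.
have cf1 z : {for z, continuous (fejer 1 : R -> R)} by exact: fejer_continuous.
have mono (u v : R) : 0 <= u -> u <= v -> fejer_prim u <= fejer_prim v.
  move=> u0 uv; rewrite /fejer_prim.
  have -> : rint 0 v (fejer 1) = rint 0 u (fejer 1) + rint u v (fejer 1).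
    by apply: rint_split; [rewrite u0|move=> z _; exact: cf1].
  by rewrite lerDl; apply: rint_ge0 => z _; exact: fejer_ge0.
have ub (v : R) : 0 <= v -> fejer_prim v <= 3 * (pi / 2).
  move=> v0; apply: (@le_trans _ _ (rint 0 v (fun z => 3 * (1 + z ^+ 2)^-1))).
    apply: le_rint; first by move=> z _; exact: cf1.
      by move=> z _; cont_der; rewrite gt_eqF// ltr_pwDl// sqr_ge0.
    by move=> z _; have := fejer_le z ltr01; rewrite mulr1 mul1r.
  rewrite (@rint_FTC _ (fun z => 3 * atan z))//.
  - by rewrite atan0 mulr0 subr0 ler_pM2l// ltW// atan_ltpi2.
  - by move=> z _; cont_der; rewrite gt_eqF// ltr_pwDl// sqr_ge0.
  - by move=> z _; der => /=; ring.
pose S := [set fejer_prim v | v in [set v | 0 <= v]].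
have hS : has_sup S.
  split; first by exists (fejer_prim 0); exists 0 => //=.
  by exists (3 * (pi / 2)) => _ [v v0 <-]; exact: ub.
exists (sup S).
  apply: (@lt_le_trans _ _ (fejer_prim 1)); last first.
    by apply: sup_upper_bound => //; exists 1 => //=.
  (* On [[0, 1]] the cosine is at least 1/2, and half of the weight [1 - x] integrates to 1/4. *)
  apply: (@lt_le_trans _ _ (rint 0 1 (fun=> 4^-1 : R))).
    by rewrite rint_cst// subr0 mulr1 invr_gt0.
  apply: le_rint; [by move=> z _; exact: cvg_cst|by move=> z _; exact: cf1|].
  move=> z /andP[z0 z1].
  have -> : 4^-1 = rint 0 1 (fun x => (1 - x) / 2) :> R.
    rewrite (@rint_FTC _ (fun x : R => x / 2 - x ^+ 2 / 4)); [by field|by []| |].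
      by move=> x _; cont_der.
    by move=> x _; der => /=; field.
  apply: le_rint; [by move=> x _; cont_der|exact: cont_fejer|].
  move=> x /andP[x0 x1]; rewrite divr1; apply: ler_wpM2l; first by rewrite subr_ge0.
  have := onem_cos_le (z * x); have zx0 : 0 <= z * x by rewrite mulr_ge0.
  have zx1 : z * x <= 1 by rewrite mulr_ile1.
  have : (z * x) ^+ 2 <= 1 by rewrite exprn_ile1.
  lra.
move=> d d0; apply/cvgrPdist_le => e e0.
have [_ [v v0 <-] hv] := sup_adherent e0 hS.
have [n0 hn0] := ex_invSn_lt (v / d) ltr01.
exists n0 => // n /= n0n.
have vn : v <= n.+1%:R * d.
  rewrite -ler_pdivrMr//; move: hn0; rewrite ltr_pdivrMr// mul1r => /ltW h.
  by rewrite (le_trans h)// ler_nat.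
have h1 : fejer_prim (n.+1%:R * d) <= sup S.
  by apply: sup_upper_bound => //; exists (n.+1%:R * d) => //=; rewrite mulr_ge0// ltW.
have h2 := mono _ _ v0 vn.
by rewrite ger0_norm ?subr_ge0//; lra.
Qed.

Lemma fejer_mass_ge0 la a b x : 0 < la -> 0 <= fejer_mass la a b x.
Proof. by move=> l0; apply: rint_ge0 => y _; exact: fejer_ge0. Qed.

(** The majorant for dominated convergence, independent of [la]. For [y] in [[a, b]],
    [1 + x^2 <= c + 2 (y - x)^2]: against the kernel, [c] contributes at most [3 pi c], and the
    square, at most 6 pointwise, contributes at most [6 (b - a)]. *)
Lemma fejer_mass_le a b : a <= b -> exists2 D : R, 0 <= D & forall la x, 1 <= la ->
  fejer_mass la a b x <= D / (1 + x ^+ 2).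
Proof.
move=> ab; pose M := `|a| + `|b|; pose c := 1 + 2 * M ^+ 2.
have c0 : 0 < c by rewrite /c ltr_pwDl// mulr_ge0// exprn_ge0// addr_ge0.
exists (c * 3 * pi + 6 * (b - a)).
  apply: addr_ge0; last by rewrite mulr_ge0// subr_ge0.
  by rewrite mulr_ge0 ?pi_ge0// mulr_ge0// ltW.
move=> la x la1; have l0 : 0 < la by rewrite (lt_le_trans ltr01).
have x0 : 0 < 1 + x ^+ 2 by rewrite ltr_pwDl// sqr_ge0.
pose dH y := c * (3 * (la * (1 + (la * (y - x)) ^+ 2)^-1)) + 6.
pose H y := c * (3 * atan (la * (y - x))) + 6 * y.
have D0 y : 0 < 1 + (la * (y - x)) ^+ 2 by rewrite ltr_pwDl// sqr_ge0.
have cD : cont_on a b dH.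
  by move=> y _; rewrite /dH; cont_der; rewrite gt_eqF.
have hH y : has_derive H y (dH y).
  by rewrite /H /dH; der => /=; ring.
have E : rint a b dH <= c * 3 * pi + 6 * (b - a).
  rewrite (rint_FTC ab cD (fun y _ => hH y)) /H.
  have h1 := atan_ltpi2 (la * (b - x)); have h2 := atan_gtNpi2 (la * (a - x)).
  have : c * (3 * (atan (la * (b - x)) - atan (la * (a - x)))) <= c * (3 * pi).
    by rewrite ler_pM2l// ler_pM2l//; lra.
  lra.
rewrite ler_pdivlMr// mulrC -rintZ; last exact: cont_fejer_mass_integrand.
apply: (le_trans _ E); apply: le_rint => //.
  by move=> y yab; apply: cvgM; [exact: cvg_cst|exact: (@cont_fejer_mass_integrand la _ a b l0 y yab)].
move=> y /andP[ay yb].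
have yM : y ^+ 2 <= M ^+ 2.
  rewrite -real_normK ?num_real//; apply: lerXn2r; rewrite ?nnegrE ?addr_ge0//.
  by rewrite /M ler_norml; have := ler_norm (- a); have := ler_norm b;
    rewrite normrN; have := normr_ge0 a; have := normr_ge0 b; lra.
have hx : 1 + x ^+ 2 <= c + 2 * (y - x) ^+ 2.
  by have := sqr_ge0 (x - 2 * y); rewrite /c; nra.
apply: (@le_trans _ _ ((c + 2 * (y - x) ^+ 2) * fejer la (x - y))).
  by rewrite ler_wpM2r// fejer_ge0.
have hf : fejer la (x - y) <= 3 * (la * (1 + (la * (y - x)) ^+ 2)^-1).
  by rewrite -fejerN opprB mulrA; exact: fejer_le.
apply: (@le_trans _ _ ((c + 2 * (y - x) ^+ 2) * (3 * (la * (1 + (la * (y - x)) ^+ 2)^-1)))).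
  by rewrite ler_wpM2l// addr_ge0 ?(ltW c0)// mulr_ge0// sqr_ge0.
rewrite mulrDl /dH lerD2l.
have -> : 2 * (y - x) ^+ 2 * (3 * (la * (1 + (la * (y - x)) ^+ 2)^-1)) =
    6 * (la * (y - x) ^+ 2 / (1 + (la * (y - x)) ^+ 2)) by ring.
rewrite -[leRHS]mulr1 ler_pM2l// ler_pdivrMr// mul1r.
rewrite exprMn; have := sqr_ge0 (y - x); move: ((y - x) ^+ 2) => q q0.
rewrite expr2 -mulrA.
have : la * q <= la * (la * q).
  by apply: ler_wpM2l; [exact: ltW|rewrite ler_peMl].
lra.
Qed.

Lemma fejer_mass_outside a b x : a <= b -> ~~ (a <= x <= b) ->
  (fun n : nat => fejer_mass n.+1%:R a b x) @ \oo --> (0 : R).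
Proof.
move=> ab xab.
have [r r0 hr] : exists2 r, 0 < r & forall y, a <= y <= b -> r <= `|x - y|.
  move: xab; rewrite negb_and -!ltNge => /orP[xa|bx].
    exists (a - x); first by rewrite subr_gt0.
    by move=> y /andP[ay _]; rewrite distrC (le_trans _ (ler_norm _))// lerB.
  exists (x - b); first by rewrite subr_gt0.
  by move=> y /andP[_ yb]; rewrite (le_trans _ (ler_norm _))// lerB.
apply/cvgrPdist_le => e e0.
have [n0 hn0] := ex_invSn_lt (3 * r ^- 2 * (b - a)) e0.
exists n0 => // n /= n0n; have l0 : 0 < n.+1%:R :> R by rewrite ltr0n.
rewrite sub0r normrN ger0_norm; last exact: fejer_mass_ge0.
apply: (@le_trans _ _ (rint a b (fun=> 3 * r ^- 2 / n.+1%:R))).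
  apply: le_rint; first exact: cont_fejer_mass_integrand.
    by move=> y _; exact: cvg_cst.
  move=> y yab; apply: (le_trans (fejer_le _ l0)).
  have h := hr _ yab.
  have r2 : 0 < r ^+ 2 by exact: exprn_gt0.
  have q : r ^+ 2 <= (x - y) ^+ 2.
    by rewrite -[leRHS]real_normK ?num_real//; apply: lerXn2r; rewrite ?nnegrE// ltW.
  have l2 : 0 < n.+1%:R ^+ 2 :> R by exact: exprn_gt0.
  rewrite ler_pdivrMr; last by rewrite ltr_pwDl// sqr_ge0.
  have -> : 3 * r ^- 2 / n.+1%:R * (1 + (n.+1%:R * (x - y)) ^+ 2) =
    3 * r ^- 2 / n.+1%:R + 3 * n.+1%:R * ((x - y) ^+ 2 / r ^+ 2).
    by field; rewrite !gt_eqF.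
  apply: (@le_trans _ _ (3 * n.+1%:R * ((x - y) ^+ 2 / r ^+ 2))).
    by rewrite ler_peMr ?mulr_ge0 ?(ltW l0)// ler_pdivlMr// mul1r.
  by rewrite lerDr divr_ge0 ?(ltW l0)// mulr_ge0// invr_ge0 ltW.
rewrite rint_cst// (le_trans _ (ltW hn0))// mulrAC.
have B0 : 0 <= 3 * r ^- 2 * (b - a).
  by rewrite mulr_ge0 ?subr_ge0// mulr_ge0// invr_ge0 exprn_ge0// ltW.
by rewrite ler_wpM2l// lef_pV2 ?posrE ?ltr0n// ler_nat.
Qed.

Lemma measurable_fejer_mass la a b : 0 < la -> a <= b ->
  measurable_fun setT (fejer_mass la a b).
Proof.
move=> l0 ab; apply: continuous_measurable_fun => x.
apply: (@lipschitz_continuous R _ (la ^+ 2 * (b - a))) => x'.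
rewrite /fejer_mass -rintB; try exact: cont_fejer_mass_integrand.
have -> : la ^+ 2 * (b - a) * `|x - x'| = rint a b (fun=> la ^+ 2 * `|x - x'|).
  by rewrite rint_cst//; ring.
apply: norm_rint_le; [|by move=> y _; exact: cvg_cst|].
  by move=> y yab; apply: cvgB; exact: (@cont_fejer_mass_integrand la _ a b l0 y yab).
move=> y _; have -> : x - x' = (x - y) - (x' - y) by ring.
exact: fejer_lipschitz.
Qed.

End FejerMass.

(** * Wave packets determine a square-integrable function *)

Section PacketsDetermine.
Context {R : realType}.
Local Notation mu := (@lebesgue_measure R).
Implicit Types (w : R -> R) (A a b : R).

Lemma sq_le_invsqr : sq_le (fun x : R => (1 + x ^+ 2)^-1) pi.
Proof.
have c0 x : 0 < 1 + x ^+ 2 :> R by rewrite ltr_pwDl// sqr_ge0.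
have cc a b : cont_on a b (fun x : R => (1 + x ^+ 2)^-1).
  by move=> x _; cont_der; rewrite gt_eqF.
have mf : measurable_fun setT (fun x : R => (1 + x ^+ 2)^-1).
  by apply: continuous_measurable_fun => x; apply: (cc x x); rewrite lexx.
split => //; apply: (@square_integral_fatou _ _ (fun _ x => (1 + x ^+ 2)^-1)) => //.
- by move=> x _; exact: cvg_cst.
- move=> n; have nn : - n.+1%:R <= n.+1%:R :> R by rewrite lerNl (le_trans (_ : _ <= 0))// ?oppr_le0 ler0n.
  apply: (@le_trans _ _ (rint (- n.+1%:R) n.+1%:R (fun x => (1 + x ^+ 2)^-1))).
    apply: le_rint => //; first by move=> x xn; apply: cvgM; exact: cc xn.
    move=> x _; rewrite expr2 ler_piMl ?invr_ge0 ?(ltW (c0 x))// invf_le1//.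
    by rewrite lerDl sqr_ge0.
  rewrite (@rint_FTC _ (fun x => atan x))//.
    by have := atan_ltpi2 (n.+1%:R : R); have := atan_gtNpi2 (- n.+1%:R : R); lra.
  by move=> x _; der => /=; ring.
Qed.

Lemma sq_le_integrable_itv w A a b : sq_le w A ->
  mu.-integrable `[a, b] (EFin \o w).
Proof.
move=> hw; have [mw _] := hw.
have i1 : mu.-integrable `[a, b] (EFin \o (fun=> 1 : R)).
  by apply: cont_on_integrable => x _; exact: cvg_cst.
have i2 : mu.-integrable `[a, b] (EFin \o (fun x => w x ^+ 2)).
  by apply: integrableS (sq_le_integrable hw).
apply: (le_integrable _ _ _ (integrableD _ i1 i2)) => //.
  by apply/measurable_EFinP; exact: measurable_funTS.
move=> x _; rewrite /= lee_fin -(real_normK (num_real (w x))).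
rewrite [leRHS]ger0_norm; last by rewrite addr_ge0// sqr_ge0.
have := sqr_ge0 (`|w x| - 1).
by have := normr_ge0 (w x); nra.
Qed.

Definition packets_null w : Prop := forall la, 0 <= la ->
  exists2 C : R, 0 <= C & forall rho kap xi, 0 < rho <= 1 -> 0 <= xi <= la ->
    `|pair w (packet (rho ^+ 2) kap xi)| <= C * rho.

(** Inside the interval both primitives of [fejer_mass_inside] tend to [c]. At an end point one of
    them stays 0 and the limit is [c], hence the exclusion. *)
Lemma window_mass_cvg (rho : nat -> R) (c a b x : R) :
  (forall n, 0 < rho n <= n.+1%:R^-1) ->
  (forall d, 0 < d -> (fun n : nat => fejer_prim (n.+1%:R * d)) @ \oo --> c) ->
  a < b -> x != a -> x != b ->
  (fun n => bump (rho n ^+ 2 * x) * fejer_mass n.+1%:R a b x) @ \oo -->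
  2 * c * \1_(`]a, b[%classic) x.
Proof.
move=> hrho hc ab xa xb.
have hb : (fun n => bump (rho n ^+ 2 * x)) @ \oo --> (1 : R).
  have h0 : (fun n => rho n ^+ 2 * x) @ \oo --> (0 : R).
    apply/cvgrPdist_le => e e0; have [n0 hn0] := ex_invSn_lt `|x| e0.
    exists n0 => // n /= n0n; rewrite sub0r normrN normrM [leLHS]mulrC.
    have /andP[r0 r1] := hrho n; rewrite (ger0_norm (exprn_ge0 2 (ltW r0))).
    apply: (le_trans _ (ltW hn0)); apply: ler_wpM2l => //.
    apply: (@le_trans _ _ n.+1%:R^-1).
      apply: (le_trans _ r1); rewrite expr2 ler_piMl ?(ltW r0)// (le_trans r1)//.
      by rewrite invf_le1 ?ltr0n// ler1n.
    by rewrite lef_pV2 ?posrE ?ltr0n// ler_nat.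
  have [g hg _] := @Ck_bump R 1.
  have := cvg_comp _ _ h0 (has_derive_continuous (hg 0)).
  by rewrite bump0.
rewrite -[2 * c * _]mul1r; apply: cvgM => //.
rewrite indicE; have [xab|xab] := boolP (a < x < b).
  have /andP[ax xb'] := xab.
  rewrite mem_set /= ?in_itv//= mulr1.
  have -> : (fun n : nat => fejer_mass n.+1%:R a b x) =
      fun n => fejer_prim (n.+1%:R * (x - a)) + fejer_prim (n.+1%:R * (b - x)).
    by apply/funext => n; rewrite fejer_mass_inside ?ltr0n// !ltW.
  by rewrite mulrDl mul1r; apply: cvgD; apply: hc; rewrite subr_gt0.
rewrite memNset /= ?in_itv/= ?mulr0; last exact/negP.
apply: fejer_mass_outside; first exact: ltW.
by move: xab; rewrite !lt_neqAle xb [a == x]eq_sym xa.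
Qed.

(** A diagonal limit: the frequency cut-off [n + 1] and the window widen together. The Fejer
    averages tend to [2 c] times the indicator of the interval, while the pairings tend to 0. *)
Lemma interval_integral0 w A a b : sq_le w A -> packets_null w -> a < b ->
  rint a b w = 0.
Proof.
move=> hw hp ab.
have /choice[C hC] : forall n : nat, exists C : R, 0 <= C /\
    forall rho kap xi, 0 < rho <= 1 -> 0 <= xi <= n.+1%:R ->
    `|pair w (packet (rho ^+ 2) kap xi)| <= C * rho.
  by move=> n; have [C C0 hC] := hp _ (ler0n R n.+1); exists C.
(* Small enough that [C n * rho n * (n + 1)], the error after averaging over frequencies up to
   [n + 1], is at most [(n + 1)^-1]. *)
pose rho n : R := n.+1%:R^-1 * (n.+1%:R * (C n + 1))^-1.
have N0 (n : nat) : 0 < n.+1%:R :> R by rewrite ltr0n.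
have N1 (n : nat) : 1 <= n.+1%:R :> R by rewrite ler1n.
have C1 n : 1 <= C n + 1 by rewrite lerDr; have [] := hC n.
have C10 n : 0 < C n + 1 by rewrite (lt_le_trans ltr01).
have rho0 n : 0 < rho n.
  by rewrite /rho mulr_gt0// invr_gt0// mulr_gt0.
have rhon n : rho n <= n.+1%:R^-1.
  rewrite /rho ler_piMr ?invr_ge0 ?(ltW (N0 n))// invf_le1 ?mulr_gt0//.
  by rewrite -[leLHS]mul1r ler_pM.
have rho1 n : rho n <= 1 by rewrite (le_trans (rhon n))// invf_le1.
have r0 n : 0 < rho n ^+ 2 by exact: exprn_gt0.
have small n : `|\int[mu]_x (w x * bump (rho n ^+ 2 * x) * fejer_mass n.+1%:R a b x)|
    <= (b - a) * n.+1%:R^-1.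
  have := @fejer_mass_small R w A (rho n ^+ 2) n.+1%:R (C n * rho n) a b (r0 n) hw
    (N0 n).
  move=> /(_ (fun kap xi => (hC n).2 (rho n) kap xi _)) H.
  have rr : 0 < rho n <= 1 by rewrite rho0 rho1.
  apply: (le_trans (H rr (ltW ab))).
  rewrite mulrC; apply: ler_wpM2l; first by rewrite subr_ge0 ltW.
  have -> : C n * rho n * n.+1%:R = C n / (C n + 1) * n.+1%:R^-1.
    by rewrite /rho; field; rewrite !gt_eqF.
  rewrite ler_piMl ?invr_ge0 ?(ltW (N0 n))// ler_pdivrMr// mul1r lerDl//.
have [c c0 hc] := @fejer_prim_lim R.
have [D D0 hD] := fejer_mass_le (ltW ab).
have [B B0 hB] := test_function_bounded (@bump_test R).
pose chi : R -> R := \1_(`]a, b[%classic).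
have ih := sq_le_mul_integrable hw sq_le_invsqr.
(* The window is at most [B] and the Fejer mass at most [D / (1 + x^2)]; as [w] and [(1 + x^2)^-1]
   are square integrable, their product is integrable. *)
have ig : mu.-integrable setT
    (EFin \o (fun x => (B * D) * `|w x * (1 + x ^+ 2)^-1|)).
  by apply: integrable_scale; exact: integrable_norm ih.
have [mw _] := hw.
pose f n x : R := w x * bump (rho n ^+ 2 * x) * fejer_mass n.+1%:R a b x.
pose g x : R := w x * (2 * c * chi x).
have mf n : measurable_fun setT (EFin \o f n).
  apply/measurable_EFinP; apply: measurable_funM; last first.
    by apply: measurable_fejer_mass => //; exact: ltW.
  have /measurable_int/measurable_EFinP := bump_window (r0 n) hw.
  done.
have mg : measurable_fun setT (EFin \o g).
  apply/measurable_EFinP; apply: measurable_funM => //; apply: measurable_funM => //.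
  exact: measurable_indic.
have fg : {ae mu, forall x, setT x -> (fun n => (EFin \o f n) x) @ \oo --> (EFin \o g) x}.
  exists [set a; b]; split.
  - by apply: measurableU; exact: measurable_set1.
  - by apply: countable_lebesgue_measure0; apply: finite_set_countable.
  - move=> x /= hx; apply: contrapT => /not_orP[xa xb]; apply: hx => _.
    apply: cvg_EFin; first by apply: nearW => n.
    have h : (fun n => w x * (bump (rho n ^+ 2 * x) * fejer_mass n.+1%:R a b x)) @ \oo
        --> g x.
      apply: cvgM; first exact: cvg_cst.
      apply: window_mass_cvg => //.
      - by move=> n; rewrite rho0 rhon.
      - exact/eqP.
      - exact/eqP.
    by apply: cvg_trans h; apply: near_eq_cvg; apply: nearW => n; rewrite /f/= mulrA.
have fdom : {ae mu, forall x (n : nat), setT x ->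
    (`|(EFin \o f n) x| <= (EFin \o (fun x => ((B * D) * `|w x * (1 + x ^+ 2)^-1|)%R)) x)%E}.
  apply: aeW => x n _; rewrite /= lee_fin /f normrM normrM [`|w x * (1 + x ^+ 2)^-1|]normrM -mulrA.
  rewrite (ger0_norm (fejer_mass_ge0 _ _ _ (N0 n))).
  have x0 : 0 <= (1 + x ^+ 2)^-1 by rewrite invr_ge0 addr_ge0// sqr_ge0.
  rewrite (ger0_norm x0); have -> : B * D * (`|w x| * (1 + x ^+ 2)^-1) =
    `|w x| * (B * (D / (1 + x ^+ 2))) by ring.
  apply: ler_wpM2l => //; apply: ler_pM => //; first exact: fejer_mass_ge0.
  exact: hD.
have [ig' _ cvg] := @dominated_convergence _ _ R mu setT measurableT _ _ _ mf mg fg ig fdom.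
have g0 : \int[mu]_x g x = 0.
  apply/eqP; rewrite -normr_le0; apply/ler_addgt0Pr => e e0; rewrite add0r.
  have e2 : 0 < e / 2 by rewrite divr_gt0.
  have fing : (\int[mu]_x (EFin \o g) x)%E \is a fin_num by exact: integrable_fin_num.
  have /fine_cvg cvgR : (\int[mu]_x (EFin \o f n) x)%E @[n --> \oo] -->
      (\int[mu]_x g x)%:E by rewrite /Rintegral fineK.
  move/cvgrPdist_le : cvgR => /(_ _ e2)[n1 _ hn1].
  have [n0 hn0] := ex_invSn_lt (b - a) e2.
  have h1 := hn1 (maxn n0 n1) (leq_maxr _ _); have h2 := small (maxn n0 n1).
  have h3 : (b - a) * (maxn n0 n1).+1%:R^-1 <= e / 2.
    apply: (le_trans _ (ltW hn0)); apply: ler_wpM2l; first by rewrite subr_ge0 ltW.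
    by rewrite lef_pV2 ?posrE// ler_nat ltnS leq_maxl.
  move: h1 h2; rewrite /= -/(Rintegral mu setT (f _)) /f.
  move: (Rintegral _ _ _) (Rintegral _ _ _) => J I h1 h2.
  have -> : I = (I - J) + J by ring.
  have -> : e = e / 2 + e / 2 by field.
  by apply: normD_le => //; exact: le_trans h3.
have : 2 * c * rint a b w = 0.
  have iw := sq_le_integrable_itv a b hw.
  have iwo : mu.-integrable `]a, b] (EFin \o w).
    by apply: integrableS iw => //; exact: subset_itv_oc_cc.
  have iwoo : mu.-integrable `]a, b[ (EFin \o w).
    by apply: integrableS iw => //; exact: subset_itv_oo_cc.
  rewrite -[RHS]g0 /rint -Rintegral_itv_obnd_cbnd// -Rintegral_itv_bndo_bndc//.
  rewrite [in LHS]Rintegral_mkcond -RintegralZl//; last first.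
    move: iwoo => /(integrable_mkcond _ _).1 => /(_ (measurable_itv _)).
    by rewrite restrict_EFin.
  apply: eq_Rintegral => x _; rewrite /g /chi patchE indicE.
  case: (_ \in _) => /=; first by ring.
  have -> : point = 0 :> R by [].
  by rewrite !mulr0.
by move=> /eqP; rewrite mulf_eq0 mulf_eq0 pnatr_eq0 (gt_eqF c0)/= => /eqP.
Qed.

(** At a Lebesgue point [x], [w x] is the derivative of the integral from [x - 1], a function that
    is constantly 0. *)
Lemma interval_integral0_ae w A : sq_le w A ->
  (forall a b, a < b -> rint a b w = 0) -> {ae mu, forall x, w x = 0}.
Proof.
move=> hw h; have [mw _] := hw.
have lw : locally_integrable setT w.
  split => //; first exact: openT.
  move=> K _ cK; have [M [_ hM]] := compact_bounded cK.
  have iK := sq_le_integrable_itv (- (M + 1)) (M + 1) hw.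
  have KM : K `<=` `[- (M + 1), M + 1]%classic.
    by move=> x Kx; rewrite /= in_itv/= -ler_norml; apply: hM => //; rewrite ltrDl.
  have /integrableP[_] : mu.-integrable K (EFin \o w).
    by apply: integrableS iK => //; exact: compact_measurable.
  done.
have := lebesgue_differentiation lw; apply: filterS.
  exact: (ae_filter_ringOfSetsType mu).
move=> x xw.
have x1 : x < x + 1 by rewrite ltrDl.
have x0 : ((x - 1)%:E < x%:E)%E by rewrite lte_fin ltrBlDr ltrDl.
have iw := sq_le_integrable_itv (x - 1) (x + 1) hw.
have [_ <-] := @FTC1_lebesgue_pt R w (BLeft (x - 1)) x (x + 1) x1 iw x0 xw.
have -> : (fun y => \int[mu]_(t in [set` Interval (BLeft (x - 1)) (BRight y)]) w t) =
    fun=> 0.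
  apply/funext => y; have [xy|yx|->] := ltgtP (x - 1) y.
  - exact: h.
  - by rewrite set_itv_ge ?Rintegral_set0// bnd_simp -ltNge.
  - by rewrite set_itv1 Rintegral_set1.
by rewrite derive1_cst.
Qed.

Lemma packets_null_ae w A : sq_le w A -> packets_null w -> {ae mu, forall x, w x = 0}.
Proof.
move=> hw hp; apply: (interval_integral0_ae hw) => a b.
exact: interval_integral0 hw hp.
Qed.

Lemma weak_system_unique (al : R) (w1 w2 : R -> R -> R) A : `|al| <= 1 ->
  (forall t, sq_le (w1 t) A) -> (forall t, sq_le (w2 t) A) ->
  weak_system al w1 w2 ->
  (forall phi, test_function phi -> pair (w1 0) phi = 0 /\ pair (w2 0) phi = 0) ->
  forall t, {ae mu, forall x, w1 t x = 0} /\ {ae mu, forall x, w2 t x = 0}.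
Proof.
move=> hal h1 h2 hw w0 t; have H := packet_small hal h1 h2 hw w0 t.
split; [apply: (packets_null_ae (h1 t))|apply: (packets_null_ae (h2 t))] => la la0;
  have [C C0 hC] := H _ la0; exists C => // rho kap xi hr hx;
  by have [] := hC rho kap xi hr hx.
Qed.

End PacketsDetermine.

(** * The solution *)

Section ComplexValued.
Context {R : realType}.
Local Notation mu := (@lebesgue_measure R).
Implicit Types (f g : R -> R[i]) (z : R[i]).
Local Open Scope complex_scope.

Lemma sqr_normc_ReIm z :
  ComplexField.Normc.normc z ^+ 2 = complex.Re z ^+ 2 + complex.Im z ^+ 2.
Proof.
by case: z => a b; rewrite /ComplexField.Normc.normc sqr_sqrtr// addr_ge0// sqr_ge0.
Qed.

Lemma normc_ge0 z : 0 <= ComplexField.Normc.normc z.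
Proof. by case: z => a b; exact: sqrtr_ge0. Qed.

Lemma normc_ge_normRe z : `|complex.Re z| <= ComplexField.Normc.normc z.
Proof.
rewrite -[leRHS]ger0_norm ?normc_ge0// -ler_sqr ?nnegrE// !real_normK ?num_real//.
by rewrite sqr_normc_ReIm lerDl sqr_ge0.
Qed.

Lemma normc_le_ReIm z :
  ComplexField.Normc.normc z <= `|complex.Re z| + `|complex.Im z|.
Proof.
rewrite -ler_sqr ?nnegrE ?addr_ge0 ?normc_ge0// sqr_normc_ReIm sqrrD !real_normK ?num_real//.
by rewrite lerD2r lerDl mulrn_wge0// mulr_ge0.
Qed.

Lemma normLp2E f : (normLp 2%:E f `^ 2 =
  \int[mu]_x (complex.Re (f x) ^+ 2 + complex.Im (f x) ^+ 2)%:E)%E.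
Proof.
rewrite /normLp poweR_Lnorm; last by rewrite pnatr_eq0.
apply: eq_integral => x _; rewrite -[LHS]/((`|ComplexField.Normc.normc (f x)| `^ 2)%:E) powR_mulrn; last exact: normr_ge0.
by rewrite real_normK ?num_real// sqr_normc_ReIm.
Qed.

Lemma normLp2_le f (c : R) : 0 <= c -> (normLp 2%:E f <= c%:E)%E <->
  (\int[mu]_x (complex.Re (f x) ^+ 2 + complex.Im (f x) ^+ 2)%:E <= (c ^+ 2)%:E)%E.
Proof.
move=> c0; rewrite -normLp2E.
have N0 : (0 <= normLp 2%:E f)%E by exact: Lnorm_ge0.
have c2 : (c%:E `^ 2 = (c ^+ 2)%:E)%E by rewrite poweR_EFin powR_mulrn.
have inN (a : \bar R) : (0 <= a)%E -> a \in `[0%E, +oo%E].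
  by move=> a0; rewrite in_itv/= a0 leey.
split=> h.
  rewrite -c2; apply: gt0_ler_poweR => //; apply: inN => //.
have half : (2 * 2^-1 = 1 :> R) by field.
have E (a : \bar R) : (0 <= a)%E -> ((a `^ 2) `^ 2^-1 = a)%E.
  by move=> a0; rewrite -poweRrM half poweRe1.
rewrite -(E _ N0) -(E c%:E)//; apply: gt0_ler_poweR; rewrite ?invr_ge0//.
- by apply: inN; exact: poweR_ge0.
- by apply: inN; exact: poweR_ge0.
- by rewrite c2.
Qed.

Lemma sq_le_ReIm f (c : R) : 0 <= c ->
  measurable_fun setT (fun x => complex.Re (f x)) ->
  measurable_fun setT (fun x => complex.Im (f x)) ->
  (normLp 2%:E f <= c%:E)%E ->
  sq_le (fun x => complex.Re (f x)) (c ^+ 2) /\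
  sq_le (fun x => complex.Im (f x)) (c ^+ 2).
Proof.
move=> c0 mr mi /(normLp2_le _ c0) h.
have mr2 : measurable_fun setT (fun x => complex.Re (f x) ^+ 2) by exact: measurable_funX.
have mi2 : measurable_fun setT (fun x => complex.Im (f x) ^+ 2) by exact: measurable_funX.
split; split => //; apply: (le_trans _ h); apply: ge0_le_integral => //.
all: try by move=> x _; rewrite lee_fin ?lerDl ?lerDr sqr_ge0.
all: by apply/measurable_EFinP => //; exact: measurable_funD.
Qed.

Lemma normLp2_le_sq f (A B c : R) : 0 <= c -> A + B <= c ^+ 2 ->
  sq_le (fun x => complex.Re (f x)) A -> sq_le (fun x => complex.Im (f x)) B ->
  (normLp 2%:E f <= c%:E)%E.
Proof.
move=> c0 ABc [mr hr] [mi hi]; apply/(normLp2_le _ c0).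
under eq_integral do rewrite EFinD.
rewrite ge0_integralD//; last 4 first.
- by move=> x _; rewrite lee_fin sqr_ge0.
- by apply/measurable_EFinP; exact: measurable_funX.
- by move=> x _; rewrite lee_fin sqr_ge0.
- by apply/measurable_EFinP; exact: measurable_funX.
by apply: (le_trans (leeD hr hi)); rewrite -EFinD lee_fin.
Qed.

Lemma continuousC_at_ReIm (T : topologicalType) (f : T -> R[i]) (p : T) :
  (forall e : R, 0 < e -> \forall q \near p, `|complex.Re (f p) - complex.Re (f q)| < e) ->
  (forall e : R, 0 < e -> \forall q \near p, `|complex.Im (f p) - complex.Im (f q)| < e) ->
  continuousC_at f p.
Proof.
move=> hr hi; apply/cvgrPdist_lt => -[a b] /=; rewrite ltcE /= => /andP[/eqP -> a0].
have a2 : 0 < a / 2 by rewrite divr_gt0.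
near=> q.
rewrite normc_def -[_ +i* _]/(a%:C) ltcR.
have -> : Num.sqrt (complex.Re (f p - f q) ^+ 2 + complex.Im (f p - f q) ^+ 2) =
    ComplexField.Normc.normc (f p - f q) by case: (f p - f q).
apply: (le_lt_trans (normc_le_ReIm _)); rewrite !raddfB/=.
have -> : a = a / 2 + a / 2 by field.
by apply: ltrD; near: q; [exact: hr|exact: hi].
Unshelve. all: by end_near. Qed.

End ComplexValued.

(** * From the complex equation to the real system *)

Section WeakComplex.
Context {R : realType} (al : R) (hal : `|al| <= 1).
Local Notation mu := (@lebesgue_measure R).
Implicit Types (phi w v : R -> R) (A B t : R).
Local Open Scope complex_scope.

Lemma pair_lin w A B C (p q : R -> R) (k : R) : sq_le w A -> sq_le p B -> sq_le q C ->
  pair w (fun x => p x - k * q x) = pair w p - k * pair w q.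
Proof.
move=> hw hp hq; have ip := sq_le_mul_integrable hw hp.
have iq := sq_le_mul_integrable hw hq.
rewrite /pair -RintegralZl// -RintegralB//; last exact: integrable_scale.
by apply: eq_Rintegral => x _; ring.
Qed.

Lemma pair_dual w A phi : sq_le w A -> test_function phi ->
  pair w (dual_symb al phi) = pair w phi^`(4)%classic - al * pair w phi^`(2)%classic.
Proof.
move=> hw h; have [B2 h2] := test_function_sq (test_function_deriven 2 h).
have [B4 h4] := test_function_sq (test_function_deriven 4 h).
exact: (pair_lin al hw h4 h2).
Qed.

Lemma pairB w v A B phi : sq_le w A -> sq_le v B -> test_function phi ->
  pair (fun x => w x - v x) phi = pair w phi - pair v phi.
Proof.
move=> hw hv h; have [C hC] := test_function_sq h.
rewrite /pair -RintegralB//; last 2 first.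
- exact: sq_le_mul_integrable hw hC.
- exact: sq_le_mul_integrable hv hC.
by apply: eq_Rintegral => x _; rewrite mulrBl.
Qed.

Lemma schroedinger_ReIm (d : R[i]) (f : R -> R[i]) (p q : R -> R) :
  (0 +i* 1) * d - al%:C * pairing f p + pairing f q = 0 <->
  complex.Re d = - (pair (fun x => complex.Im (f x)) q -
    al * pair (fun x => complex.Im (f x)) p) /\
  complex.Im d = pair (fun x => complex.Re (f x)) q -
    al * pair (fun x => complex.Re (f x)) p.
Proof.
have pE psi : pairing f psi = pair (fun x => complex.Re (f x)) psi +i*
  pair (fun x => complex.Im (f x)) psi by [].
case: d => d1 d2; rewrite !pE; move: (pair _ q) (pair _ q) (pair _ p) (pair _ p).
move=> r4 i4 r2 i2; split=> [/eqP|/= [e1 e2]].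
  by rewrite eq_complex /= => /andP[/eqP e1 /eqP e2]; split; lra.
by apply/eqP; rewrite eq_complex /=; apply/andP; split; apply/eqP; lra.
Qed.

Lemma equation_weak_system (u : R -> R -> R[i]) A :
  (forall t, sq_le (fun x => complex.Re (u t x)) A) ->
  (forall t, sq_le (fun x => complex.Im (u t x)) A) ->
  equation al u ->
  weak_system al (fun t x => complex.Re (u t x)) (fun t x => complex.Im (u t x)).
Proof.
move=> hr hi eu phi h t; have [d [h1 h2] E] := eu phi h t.
have [e1 e2] := (schroedinger_ReIm _ _ _ _).1 E; split.
  apply: (has_derive_eq h1).
  exact: (etrans e1 (congr1 -%R (esym (pair_dual (hi t) h)))).
apply: (has_derive_eq h2).
exact: (etrans e2 (esym (pair_dual (hr t) h))).
Qed.

Lemma weak_systemB (w1 w2 v1 v2 : R -> R -> R) A B :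
  (forall t, sq_le (w1 t) A) -> (forall t, sq_le (w2 t) A) ->
  (forall t, sq_le (v1 t) B) -> (forall t, sq_le (v2 t) B) ->
  weak_system al w1 w2 -> weak_system al v1 v2 ->
  weak_system al (fun t x => w1 t x - v1 t x) (fun t x => w2 t x - v2 t x).
Proof.
move=> hw1 hw2 hv1 hv2 sw sv phi h t; have hd := test_function_dual al h.
have [a1 a2] := sw phi h t; have [b1 b2] := sv phi h t.
rewrite (pairB (hw1 t) (hv1 t) hd) (pairB (hw2 t) (hv2 t) hd); split.
  have -> : (fun t => pair (fun x => w1 t x - v1 t x) phi) =
      fun t => pair (w1 t) phi + - pair (v1 t) phi.
    by apply/funext => s; rewrite (pairB (hw1 s) (hv1 s) h).
  by apply: (has_derive_eq (derD a1 (derN b1))); ring.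
have -> : (fun t => pair (fun x => w2 t x - v2 t x) phi) =
    fun t => pair (w2 t) phi + - pair (v2 t) phi.
  by apply/funext => s; rewrite (pairB (hw2 s) (hv2 s) h).
by apply: (has_derive_eq (derD a2 (derN b2))).
Qed.

Lemma pair_ae0 w A phi : sq_le w A -> {ae mu, forall x, w x = 0} ->
  test_function phi -> pair w phi = 0.
Proof.
move=> hw w0 h; have [mw _] := hw; have mp := test_function_measurable h.
have E : (\int[mu]_x (w x * phi x)%:E = \int[mu]_x (cst 0 x))%E.
  apply: ae_eq_integral => //.
    by apply/measurable_EFinP; exact: measurable_funM.
  move: w0; apply: filterS; first exact: (ae_filter_ringOfSetsType mu).
  by move=> x /= wx _; rewrite wx mul0r.
by rewrite /pair /Rintegral E integral0.
Qed.

Lemma CbL2_bounded (u : R -> R -> R[i]) : in_CbL2 u -> exists A,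
  (forall t, sq_le (fun x => complex.Re (u t x)) A) /\
  (forall t, sq_le (fun x => complex.Im (u t x)) A).
Proof.
move=> [hu _ [M hM]]; exists (`|M| ^+ 2).
have h t : sq_le (fun x => complex.Re (u t x)) (`|M| ^+ 2) /\
    sq_le (fun x => complex.Im (u t x)) (`|M| ^+ 2).
  have [mr mi _] := hu t; apply: sq_le_ReIm => //.
  by apply: (le_trans (hM t)); rewrite lee_fin ler_norm.
by split => t; have [] := h t.
Qed.

Lemma CbL2_solution_unique (u0 : R -> R[i]) (u v : R -> R -> R[i]) :
  CbL2_solution al u0 u -> CbL2_solution al u0 v ->
  forall t, {ae mu, forall x, v t x = u t x}.
Proof.
move=> [bu eu iu] [bv ev iv] t.
have [A [ur ui]] := CbL2_bounded bu; have [B [vr vi]] := CbL2_bounded bv.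
have aeF := ae_filter_ringOfSetsType mu.
pose w1 t x := complex.Re (v t x) - complex.Re (u t x).
pose w2 t x := complex.Im (v t x) - complex.Im (u t x).
have h1 t' : sq_le (w1 t') (2 * B + 2 * A) by exact: sq_leB.
have h2 t' : sq_le (w2 t') (2 * B + 2 * A) by exact: sq_leB.
have sw : weak_system al w1 w2.
  apply: (weak_systemB vr vi ur ui); exact: equation_weak_system.
have z0 : {ae mu, forall x, v 0 x = u 0 x}.
  by move: iu iv; apply: filterS2 => x -> ->.
have w0 phi : test_function phi -> pair (w1 0) phi = 0 /\ pair (w2 0) phi = 0.
  move=> h; split.
    apply: (pair_ae0 (h1 0)) => //; move: z0; apply: filterS => x.
    by rewrite /w1 => ->; rewrite subrr.
  apply: (pair_ae0 (h2 0)) => //; move: z0; apply: filterS => x.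
  by rewrite /w2 => ->; rewrite subrr.
have [z1 z2] := weak_system_unique hal h1 h2 sw w0 t.
move: z1 z2; apply: filterS2 => x /eqP; rewrite subr_eq0 => e1 /eqP; rewrite subr_eq0 => e2.
by apply/eqP; rewrite eq_complex e1.
Qed.

End WeakComplex.

(** * The solution and its properties *)

Section Spike.
Context {R : realType} (al : R) (hal : `|al| <= 1) (xs ts : R).
Local Notation mu := (@lebesgue_measure R).
Local Notation W := (W al).
Local Notation sol := (sol al xs ts).
Implicit Types (phi : R -> R) (t x th e : R).
Local Open Scope complex_scope.

(** Differentiating the real part in time gives the phase [pi / 2], here recognised as minus the
    imaginary part. The default value 0 satisfies the identity at the singular point too. *)
Lemma WDpi th tau y : W (th + pi) tau y = - W th tau y.
Proof.
have [|nz] := boolP ((tau == 0) && (y == 0)).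
  by move=> z; rewrite /W z oppr0.
rewrite negb_and in nz.
have Nn N : Wn al N (th + pi) tau y = - Wn al N th tau y.
  rewrite /Wn /wave -[RHS]mulN1r -rintZ; last by apply: cont_wave.
  apply: eq_rint => k _; rewrite addrAC cosDpi; ring.
have h1 := W_cvg hal (th := th + pi) nz.
have h2 : (fun N => - Wn al N th tau y) @ \oo --> - W th tau y.
  by apply: cvgN; exact: W_cvg.
have E : (fun N => Wn al N (th + pi) tau y) = fun N => - Wn al N th tau y by exact/funext.
by rewrite E in h1; exact: (cvg_unique _ h1 h2).
Qed.

(* Since [cos (z - pi / 2) = sin z], this is the integral over [k >= 1] of
   [k^-1 cos (k (x - xs)) exp (i (t - ts) (k^4 + al k^2))]. *)
Definition spike t x : R[i] := sol 0 t x +i* sol (- (pi / 2)) t x.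

Lemma spike_inLp2 t : inLp 2%:E (spike t) /\
  (normLp 2%:E (spike t) <= (24 * pi + 1)%:E)%E.
Proof.
have h1 := sol_sq hal xs ts 0 t; have h2 := sol_sq hal xs ts (- (pi / 2)) t.
(* The squared norms add up to [24 pi], and [q <= (q + 1)^2] for [q >= 0] avoids a square root. *)
have h : (normLp 2%:E (spike t) <= (24 * pi + 1)%:E)%E.
  have h1' : sq_le (fun x => complex.Re (spike t x)) (12 * pi) by exact: h1.
  have h2' : sq_le (fun x => complex.Im (spike t x)) (12 * pi) by exact: h2.
  have p0 : 0 <= pi :> R by exact: pi_ge0.
  have c0 : 0 <= 24 * pi + 1 :> R by rewrite addr_ge0// mulr_ge0.
  have cc : 12 * pi + 12 * pi <= (24 * pi + 1) ^+ 2 :> R.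
    by move: p0; move: pi => q q0; have := sqr_ge0 (24 * q); nra.
  exact: (normLp2_le_sq c0 cc h1' h2').
split => //; split; [by case: h1|by case: h2|].
by rewrite (le_lt_trans h)// ltry.
Qed.

Lemma sol_diff_sq th t0 e : 0 < e -> exists2 d, 0 < d & forall t, `|t0 - t| < d ->
  sq_le (fun x => sol th t x - sol th t0 x) e.
Proof.
move=> e0; have [d d0 hd] := W_diff_square_integral hal th (t0 - ts) e0.
exists d => // t htd.
have := hd (t - ts); have -> : t0 - ts - (t - ts) = t0 - t by ring.
move=> /(_ htd) h.
apply: (@sq_le_shift _ (fun y => W th (t - ts) y - W th (t0 - ts) y)); split.
  by apply: measurable_funB; exact: measurable_W.
apply: le_trans h; rewrite le_eqVlt; apply/orP; left; apply/eqP.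
by apply: eq_integral => y _; rewrite -sqrrN opprB.
Qed.

Lemma spike_CbL2 : in_CbL2 spike.
Proof.
split; first by move=> t; have [] := spike_inLp2 t.
  move=> t0.
  have H e : 0 < e -> \forall t \near t0,
      (normLp 2%:E (fun x => (spike t x - spike t0 x)%R) <= e%:E)%E.
    move=> e0; have e2 : 0 < e ^+ 2 / 2 by rewrite divr_gt0// exprn_gt0.
    have [d1 p1 h1] := sol_diff_sq 0 t0 e2.
    have [d2 p2 h2] := sol_diff_sq (- (pi / 2)) t0 e2.
    exists (Num.min d1 d2) => /=; first by rewrite lt_min p1.
    move=> t /=; rewrite /ball/= lt_min => /andP[t1 t2].
    apply: (@normLp2_le_sq _ _ (e ^+ 2 / 2) (e ^+ 2 / 2)); first exact: ltW.
    - by rewrite -splitr.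
    - exact: h1.
    - exact: h2.
  apply/fine_cvgP; split.
    have := H 1 ltr01; apply: filterS => t h.
    by rewrite ge0_fin_numE ?Lnorm_ge0// (le_lt_trans h)// ltry.
  apply/cvgrPdist_le => e e0; have := H e e0; apply: filterS => t h.
  have N0 : (0 <= normLp 2%:E (fun x => (spike t x - spike t0 x)%R))%E by exact: Lnorm_ge0.
  rewrite sub0r normrN ger0_norm ?fine_ge0//.
  by rewrite -lee_fin fineK// ge0_fin_numE// (le_lt_trans h)// ltry.
by exists (24 * pi + 1) => t; have [] := spike_inLp2 t.
Qed.

Lemma spike_equation : equation al spike.
Proof.
move=> phi h t.
pose d1 := pair (sol (0 + pi / 2) t) (dual_symb al phi).
pose d2 := pair (sol (- (pi / 2) + pi / 2) t) (dual_symb al phi).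
exists (d1 +i* d2).
  by split; exact: sol_der.
have E0 : sol (- (pi / 2) + pi / 2) t = sol 0 t by rewrite addNr.
have E1 : sol (0 + pi / 2) t = fun x => - sol (- (pi / 2)) t x.
  have -> : 0 + pi / 2 = - (pi / 2) + pi :> R by field.
  by apply/funext => x; rewrite /sol WDpi.
have e1 : d1 = - (pair (sol (- (pi / 2)) t) phi^`(4)%classic -
    al * pair (sol (- (pi / 2)) t) phi^`(2)%classic).
  have E : d1 = - pair (sol (- (pi / 2)) t) (dual_symb al phi).
    rewrite /d1 E1 /pair -[RHS]mulN1r -RintegralZl//.
      by apply: eq_Rintegral => x _; rewrite mulNr mulN1r.
    have [B hB] := test_function_sq (test_function_dual al h).
    exact: sq_le_mul_integrable (sol_sq hal xs ts (- (pi / 2)) t) hB.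
  exact: (etrans E (congr1 -%R (pair_dual al (sol_sq hal xs ts (- (pi / 2)) t) h))).
have e2 : d2 = pair (sol 0 t) phi^`(4)%classic - al * pair (sol 0 t) phi^`(2)%classic.
  by rewrite /d2 E0; exact: (pair_dual al (sol_sq hal xs ts 0 t) h).
by apply/schroedinger_ReIm; split; [exact: e1|exact: e2].
Qed.

Lemma spike_smooth t : t != ts -> smoothC (spike t).
Proof.
move=> tts; have t0 : t - ts != 0 by rewrite subr_eq0.
have S th : smooth (sol th t).
  apply: Ck_smooth => n.
  have := @Ck_affine R n (W th (t - ts)) 1 (- xs) (W_Ck hal th n t0).
  by congr Ck; apply/funext => x; rewrite mul1r.
by split; exact: S.
Qed.

Lemma spike_Linfty t : t != ts -> inLp +oo%E (spike t).
Proof.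
move=> tts; have t0 : t - ts != 0 by rewrite subr_eq0.
have [_ _] := (spike_inLp2 t).1; have [mr mi _] := (spike_inLp2 t).1 => _; split => //.
pose M := (1 + pi) / Num.sqrt `|t - ts| + (1 + pi) / Num.sqrt `|t - ts|.
have hM x : ComplexField.Normc.normc (spike t x) <= M.
  apply: (le_trans (normc_le_ReIm _)); apply: lerD; exact: W_bound.
rewrite /normLp unlock; case: ifPn => _; last by rewrite ltry.
apply: (@le_lt_trans _ _ M%:E); last by rewrite ltry.
apply/ess_sup_inf.ess_supP; apply: aeW => x.
suff : (`|ComplexField.Normc.normc (spike t x)|%:E <= M%:E)%E by [].
by rewrite lee_fin ger0_norm ?normc_ge0.
Qed.

Lemma spike_blows_up : blows_up_at spike xs ts.
Proof.
apply/cvgryPge => A; have [d d0 hd] := W_blowup hal A.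
rewrite near_withinE; exists (ball xs d, ball ts d) => /=.
  by split; exact: nbhsx_ballx.
move=> p /= [p1 p2] pn.
(* The real part alone tends to [+oo]. *)
apply: (@le_trans _ _ (complex.Re (spike p.2 p.1))); last first.
  exact: (le_trans (ler_norm _) (normc_ge_normRe (spike p.2 p.1))).
apply: hd; [by rewrite distrC|by rewrite distrC|].
rewrite !subr_eq0 -negb_and; apply: contra pn => /andP[/eqP e1 /eqP e2].
by rewrite [p]surjective_pairing e1 e2.
Qed.

Lemma spike_continuous p : p.2 != ts -> continuousC_at (fun q : R * R => spike q.2 q.1) p.
Proof.
move=> pts; have t0 : p.2 - ts != 0 by rewrite subr_eq0.
have H th e : 0 < e -> \forall q \near p, `|sol th p.2 p.1 - sol th q.2 q.1| < e.
  move=> e0; have [d d0 hd] := W_close_ne0 hal th (p.1 - xs) t0 e0.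
  exists (ball p.1 d, ball p.2 d) => /=; first by split; exact: nbhsx_ballx.
  move=> q /= [q1 q2]; apply: hd.
    by have -> : p.2 - ts - (q.2 - ts) = p.2 - q.2 by ring.
  by have -> : p.1 - xs - (q.1 - xs) = p.1 - q.1 by ring.
by apply: continuousC_at_ReIm => e e0; exact: H.
Qed.

Lemma spike_continuous_slice x : x != xs -> continuousC_at (spike ts) x.
Proof.
move=> xxs; have x0 : x - xs != 0 by rewrite subr_eq0.
have H th e : 0 < e -> \forall q \near x, `|sol th ts x - sol th ts q| < e.
  move=> e0; have [d d0 hd] := W_close_eq0 hal th x0 e0.
  exists d => // q /= xq; rewrite /sol subrr; apply: hd.
  by have -> : x - xs - (q - xs) = x - q by ring.
by apply: continuousC_at_ReIm => e e0; exact: H.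
Qed.

End Spike.

Unset Implicit Arguments.
Set Strict Implicit.
Set Printing Implicit Defensive.
Local Open Scope complex_scope.

Theorem proposition6p5 (R : realType) (alpha : R)
    (halpha : alpha \in [:: 0; -1; 1]) (xs ts : R) (hts : ts != 0) :
  exists u0 : R -> R[i],
    [/\ smoothC u0, inLp 2%:E u0, inLp +oo%E u0 &
      exists u : R -> R -> R[i],
        [/\ the_CbL2_solution alpha u0 u,
            blows_up_at u xs ts,
            (forall p : R * R, p.2 != ts ->
               continuousC_at (fun q : R * R => u q.2 q.1) p) &
            (forall x : R, x != xs -> continuousC_at (u ts) x)]].
Proof.
have hal : `|alpha| <= 1.
  by move: halpha; rewrite !inE => /or3P[] /eqP ->; rewrite ?normrN ?normr0 ?normr1.
have t0 : 0 != ts by rewrite eq_sym.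
have sol : CbL2_solution alpha (spike alpha xs ts 0) (spike alpha xs ts).
  split; [exact: spike_CbL2|exact: spike_equation|].
  exact: aeW.
(* Since [ts != 0], the initial time is not the singular one, so this slice is smooth and
   bounded. *)
exists (spike alpha xs ts 0); split.
- exact: spike_smooth.
- by have [] := spike_inLp2 hal xs ts 0.
- exact: spike_Linfty.
exists (spike alpha xs ts); split.
- split => // v sv t; exact: (CbL2_solution_unique hal sol sv t).
- exact: spike_blows_up.
- by move=> p; exact: spike_continuous.
- by move=> x; exact: spike_continuous_slice.
Qed.
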